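(* Let $\Omega\subset \mathbb{R}^n\times(0,\infty)$ be a region cut by a smooth hypersurface $\Gamma=\{(x,t): S(x,t)=0\}$ into left- and right-hand parts $\Omega_{\mp}$. Let $(U,\rho)$, $\Gamma$, with $\rho=\widehat\rho+e\,\delta(\Gamma)$, be a $\delta$-shock wave type solution of the system $$\rho_t+\nabla\cdot(\rho F(U))=0,\qquad (\rho U)_t+\nabla\cdot(\rho N(U))=0,$$ and suppose that $(U,\rho)$ is smooth in $\Omega_\pm$ and has one-sided limits $U^\pm$, $\widehat\rho^{\pm}$ on $\Gamma$. Then the Rankine--Hugoniot conditions for the $\delta$-shock $$\frac{\delta e}{\delta t}+\nabla_{\Gamma_t}\cdot(eU_\delta)=\big([\rho F(U)],[\rho]\big)\cdot\mathbf{n},$$ $$\frac{\delta (eU_\delta)}{\delta t}+\nabla_{\Gamma_t}\cdot(eU_\delta\otimes U_\delta)=\big([\rho N(U)],[\rho U]\big)\cdot\mathbf{n}$$ hold on the discontinuity hypersurface $\Gamma$, where $\mathbf{n}=(\nu,-G)=\frac{\nabla_{(x,t)}S}{|\nabla S|}$ is the space-time normal to $\Gamma$. Equivalent forms of these conditions are $$\frac{\delta e}{\delta t}+\nabla_{\Gamma_t}\cdot(eU_\delta)=\big([\rho F(U)]-[\rho]U_\delta\big)\cdot\nu,$$ $$\frac{\delta (eU_\delta)}{\delta t}+\nabla_{\Gamma_t}\cdot(eU_\delta\otimes U_\delta)=\big([\rho N(U)]-[\rho U]U_\delta\big)\cdot\nu,$$ or $$\frac{\delta e}{\delta t}-2\mathcal{K}Ge=\big([\rho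 F(U)]-[\rho]U_\delta\big)\cdot\nu,$$ $$\frac{\delta (eU_\delta)}{\delta t}-2\mathcal{K}GeU_\delta=\big([\rho N(U)]-[\rho U]U_\delta\big)\cdot\nu,$$ where $\mathcal{K}$ is the mean curvature of the moving wave front $\Gamma_t$.
   Context: System. $F=(F_1,\dots,F_n)$ is a given vector field and $N=(N_1,\dots,N_n)$, $N_k=(N_{k1},\dots,N_{kn})$, a given tensor field, $F_j,N_{kj}:\mathbb{R}^n\to\mathbb{R}$. The unknowns are $\rho=\rho(x,t)\in\mathbb{R}$ and $U=(u_1,\dots,u_n)(x,t)\in\mathbb{R}^n$, $x\in\mathbb{R}^n$, $t\ge0$. In coordinates the system reads $\rho_t+\sum_j\partial_{x_j}(\rho F_j(U))=0$, $(\rho u_k)_t+\sum_j\partial_{x_j}(\rho N_{kj}(U))=0$, $k=1,\dots,n$. Here $\nabla=(\partial_{x_1},\dots,\partial_{x_n})$ and $\nabla_{(x,t)}=(\nabla,\partial_t)$. Geometry. $S\in C^\infty(\mathbb{R}^n\times[0,\infty))$ with $\nabla S\ne0$ on $\{S=0\}$ for each fixed $t$; $\Gamma=\{(x,t):S(x,t)=0\}$ is a hypersurface in $\mathbb{R}^n\times[0,\infty)$, $\Gamma_t=\{x:S(x,t)=0\}$, and $\Gamma_0=\{x:S^0(x)=0\}$, with $\nabla S^0\ne0$ on $\{S^0=0\}$, is the initial position of the front ($\Gamma_t$ at $t=0$). The minus side of $\Gamma$ is $S<0$ and the plus side is $S>0$. The unit space normal is $\nu=\nabla S/|\nabla S|$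 (pointing from $\{S<0\}$ to $\{S>0\}$), and $G=-S_t/|\nabla S|$ is the normal velocity of $\Gamma_t$. The $\delta$-shock velocity is $U_\delta=\nu G=-\frac{S_t\nabla S}{|\nabla S|^2}$ on $\Gamma$. For $f$ defined on $\Gamma$, the $\delta$-derivatives are $$\frac{\delta f}{\delta t}=\partial_t\widetilde f+G\,\partial_\nu\widetilde f,\qquad \frac{\delta f}{\delta x_j}=\partial_{x_j}\widetilde f-\nu_j\,\partial_\nu\widetilde f,\qquad \partial_\nu=\nu\cdot\nabla,$$ where $\widetilde f$ is a smooth extension of $f$ to a neighbourhood of $\Gamma$; they depend only on the values of $f$ on $\Gamma$. $\nabla_{\Gamma_t}=(\frac{\delta}{\delta x_1},\dots,\frac{\delta}{\delta x_n})$ is the tangent gradient and $\nabla_{\Gamma_t}\cdot A=\sum_j\frac{\delta A_j}{\delta x_j}$; $\nabla_{\Gamma_t}\cdot(eU_\delta\otimes U_\delta)$ is the vector with $k$-th component $\sum_j\frac{\delta(eu_{\delta k}u_{\delta j})}{\delta x_j}$, $u_{\delta k}$ being the $k$-th component of $U_\delta$. The mean curvature is $\mathcal{K}=-\frac12\nabla_{\Gamma_t}\cdot\nu$. $d\mu$ denotes the surface measure on the corresponding surface. $\delta(\Gamma)$ is the distribution $\langle\delta(\Gamma),\varphi\rangle=\int\int_{\Gamma_t}\varphi\,d\mu(x)\,dt=\int_\Gamma\varphi\,\frac{d\mu(x,t)}{\sqrt{1+G^2}}$. Jumps. $[f(U,\rho)]=f(U^-,\rho^-)-f(U^+,\rho^+)$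 is the jump across $\Gamma$, where $\rho^\pm$ are the one-sided limits $\widehat\rho^\pm$. The vector $[\rho N(U)]\cdot\nu$ has $k$-th component $[\rho N_k(U)]\cdot\nu$; $[\rho U]U_\delta\cdot\nu$ means $[\rho U](U_\delta\cdot\nu)$; $([\rho F(U)],[\rho])\cdot(\nu,-G)=[\rho F(U)]\cdot\nu-[\rho]G$ and $([\rho N(U)],[\rho U])\cdot(\nu,-G)=[\rho N(U)]\cdot\nu-[\rho U]G$. Definition of solution. Initial data are $(U^0,\rho^0;U^0_\delta)$, where $\rho^0=\widehat\rho^0+e^0\delta(\Gamma_0)$, $U^0\in L^\infty(\mathbb{R}^n;\mathbb{R}^n)$, $\widehat\rho^0\in L^\infty(\mathbb{R}^n;\mathbb{R})$, $e^0\in C(\Gamma_0)$, $\delta(\Gamma_0)$ is the Dirac delta function concentrated on $\Gamma_0$, and $U^0_\delta(x)$, $x\in\Gamma_0$, is the initial velocity of the $\delta$-shock. Distributions $(U,\rho)$ and a hypersurface $\Gamma$, with $\rho=\widehat\rho+e\,\delta(\Gamma)$, $U\in L^\infty(\mathbb{R}^n\times(0,\infty);\mathbb{R}^n)$, $\widehat\rho\in L^\infty(\mathbb{R}^n\times(0,\infty);\mathbb{R})$, $e\in C(\Gamma)$, form a $\delta$-shock wave type solution (of the Cauchy problem) if $$\int_0^\infty\!\!\int\widehat\rho\,(\varphi_t+F(U)\cdot\nabla\varphi)\,dx\,dt+\int_\Gamma e\frac{\delta\varphi}{\delta t}\frac{d\mu(x,t)}{\sqrt{1+G^2}}+\int\widehat\rho^0\varphi(x,0)\,dx+\int_{\Gamma_0}e^0\varphi(x,0)\,d\mu(x)=0,$$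 $$\int_0^\infty\!\!\int\widehat\rho\,(U\varphi_t+N(U)\cdot\nabla\varphi)\,dx\,dt+\int_\Gamma eU_\delta\frac{\delta\varphi}{\delta t}\frac{d\mu(x,t)}{\sqrt{1+G^2}}+\int U^0\widehat\rho^0\varphi(x,0)\,dx+\int_{\Gamma_0}e^0U^0_\delta\varphi(x,0)\,d\mu(x)=0$$ for all $\varphi\in\mathcal{D}(\mathbb{R}^n\times[0,\infty))$ (smooth, compactly supported, not necessarily vanishing at $t=0$). Here $N(U)\cdot\nabla\varphi$ is the vector with components $N_k(U)\cdot\nabla\varphi$, and $\int\cdot\,dx$ is over $\mathbb{R}^n$.
   Formalization: The given fields F and N are assumed continuous (without this the jump formula can fail), and e is assumed to have a smooth extension near the part of Γ inside Ω, so that its δ-derivatives are defined. *)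

(* Defs.v *)
From HB Require Import structures.
From mathcomp Require Import all_boot all_order all_algebra.
From mathcomp Require Import all_classical all_reals all_analysis.
Import Order.TTheory GRing.Theory Num.Theory.
Import numFieldNormedType.Exports.

Set Implicit Arguments.
Unset Strict Implicit.
Unset Printing Implicit Defensive.

Local Open Scope classical_set_scope.
Local Open Scope ring_scope.

(* The sigma-algebra is generated by the coordinates, as the library does for
   tuples; on a finite-dimensional real space it is the Borel sigma-algebra. *)
Section measurable_rV.
Context (R : realType) (m : nat).

Let coord (i : 'I_m) (x : 'rV[R]_m) : measurableTypeR R := x 0 i.

Let rV_set0 : g_sigma_preimage coord set0.
Proof. exact: sigma_algebra0. Qed.

Let rV_setC A : g_sigma_preimage coord A -> g_sigma_preimage coord (~` A).
Proof. exact: sigma_algebraC. Qed.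

Let rV_bigcup (A : (set 'rV[R]_m)^nat) :
  (forall i, g_sigma_preimage coord (A i)) ->
  g_sigma_preimage coord (\bigcup_i A i).
Proof. exact: sigma_algebra_bigcup. Qed.

HB.instance Definition _ := @isMeasurable.Build default_measure_display
  'rV[R]_m (g_sigma_preimage coord) rV_set0 rV_setC rV_bigcup.

Lemma measurable_rV_coord (i : 'I_m) :
  measurable_fun [set: 'rV[R]_m]
    (fun x : 'rV[R]_m => x 0 i : measurableTypeR R).
Proof.
move=> _ Y mY; rewrite setTI; apply: sub_sigma_algebra => /=.
rewrite -bigcup_seq/=; exists i => /=; first by rewrite mem_index_enum.
by exists Y => //; rewrite setTI.
Qed.

Lemma measurable_fun_rVP d (T : measurableType d) (f : T -> 'rV[R]_m) :
  (forall i, measurable_fun [set: T] (fun x => f x 0 i : measurableTypeR R)) ->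
  measurable_fun [set: T] f.
Proof.
move=> mf.
have : g_sigma_preimage (fun i => coord i \o f) `<=` measurable.
  apply: smallest_sub; first exact: sigma_algebra_measurable.
  rewrite -bigcup_seq; apply: bigcup_sub => i _ A [B mB <-].
  exact: mf.
rewrite g_sigma_preimage_comp => prefS _ A mA.
by apply: prefS; exists A.
Qed.

End measurable_rV.

(* [insert_coord j s y] is the point whose [j]-th coordinate is [s] and whose other
   coordinates are, in order, those of [y]. *)
Definition insert_coord (R : realType) (m : nat) (j : 'I_m) (s : R)
    (y : 'rV[R]_m.-1) : 'rV[R]_m :=
  \row_i (if unlift j i is Some k then y 0 k else s).

(* The space-time point [(x, t)] is encoded in ['rV[R]_n.+1] with the time
   first: coordinate [ord0] is [t] and coordinate [lift ord0 j] is [x_j]. *)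
Definition pt (R : realType) (n : nat) (t : R) (x : 'rV[R]_n) : 'rV[R]_n.+1 :=
  insert_coord ord0 t x.

Section lebesgue_rV.
Context (R : realType).

Let cons (n : nat) (p : measurableTypeR R * 'rV[R]_n) : 'rV[R]_n.+1 :=
  pt p.1 p.2.

Let decons (n : nat) (P : 'rV[R]_n.+1) : measurableTypeR R * 'rV[R]_n :=
  (P 0 ord0, \row_j P 0 (lift ord0 j)).

Lemma pt_ord0 n (t : R) (x : 'rV[R]_n) : pt t x 0 ord0 = t.
Proof. by rewrite mxE unlift_none. Qed.

Lemma pt_lift n (t : R) (x : 'rV[R]_n) j : pt t x 0 (lift ord0 j) = x 0 j.
Proof. by rewrite mxE liftK. Qed.

Let consK n : cancel (@cons n) (@decons n).
Proof.
move=> [t x]; rewrite /decons /cons /= pt_ord0; congr pair.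
by apply/rowP => j; rewrite mxE pt_lift.
Qed.

Let measurable_cons n : measurable_fun [set: _] (@cons n).
Proof.
apply: measurable_fun_rVP => i.
case: (unliftP ord0 i) => [j|] ->.
  rewrite (_ : (fun _ => _) =
      (fun x : 'rV[R]_n => x 0 j : measurableTypeR R) \o snd).
    exact: (measurableT_comp (@measurable_rV_coord R n j)).
  by apply/funext => p; rewrite /cons /= pt_lift.
rewrite (_ : (fun _ => _) = fst); first exact: (@measurable_fst _ _ (measurableTypeR R) 'rV[R]_n).
by apply/funext => p; rewrite /cons /= pt_ord0.
Qed.

Let measurable_decons n : measurable_fun [set: _] (@decons n).
Proof.
apply: measurable_fun_pair; first exact: measurable_rV_coord.
apply: measurable_fun_rVP => i.
rewrite (_ : (fun _ => _) =
    (fun x : 'rV[R]_n.+1 => x 0 (lift ord0 i) : measurableTypeR R)).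
  exact: measurable_rV_coord.
by apply/funext => P; rewrite mxE.
Qed.

Section step.
Context (n : nat) (mu : {sigma_finite_measure set 'rV[R]_n -> \bar R}).

Definition lebesgue_step : set 'rV[R]_n.+1 -> \bar R :=
  pushforward (lebesgue_measure \x mu)%E (@cons n).

Let step0 : lebesgue_step set0 = 0%E.
Proof. by rewrite /lebesgue_step /pushforward preimage_set0 measure0. Qed.

Let step_ge0 A : (0 <= lebesgue_step A)%E.
Proof. by rewrite /lebesgue_step /pushforward measure_ge0. Qed.

Let step_sigma_additive : semi_sigma_additive lebesgue_step.
Proof.
move=> F mF tF mUF; rewrite /lebesgue_step /pushforward preimage_bigcup.
apply: measure_semi_sigma_additive.
- by move=> i; rewrite -[X in measurable X]setTI; exact: measurable_cons.
- apply/trivIsetP => /= i j _ _ ij; rewrite -preimage_setI.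
  by move/trivIsetP : tF => /(_ _ _ _ _ ij) ->//; rewrite preimage_set0.
- rewrite -preimage_bigcup -[X in measurable X]setTI.
  exact: measurable_cons.
Qed.

HB.instance Definition _ := isMeasure.Build _ _ _ lebesgue_step
  step0 step_ge0 step_sigma_additive.

Let step_sigma_finite : sigma_finite [set: 'rV[R]_n.+1] lebesgue_step.
Proof.
have /sigma_finiteP[F [FT ndF Foo]] :=
  sigma_finiteT (@lebesgue_measure R : {sigma_finite_measure set _ -> \bar R}).
have /sigma_finiteP[H [HT ndH Hoo]] := sigma_finiteT mu.
exists (fun i => @decons n @^-1` (F i `*` H i)).
  rewrite -preimage_bigcup -[LHS](preimage_setT (@decons n)).
  congr (_ @^-1` _); rewrite -setXTT FT HT predeqE => -[x y]; split.
    move=> [/= [i _ Fix] [k _ Hky]]; exists (maxn i k) => //; split.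
    - by move: x Fix; exact/subsetPset/ndF/leq_maxl.
    - by move: y Hky; exact/subsetPset/ndH/leq_maxr.
  by move=> [i _ []/= ? ?]; split; exists i.
move=> k; have [mF Fk] := Foo k; have [mH Hk] := Hoo k.
have mFH : measurable (F k `*` H k) by exact: measurableX.
split; first by rewrite -[X in measurable X]setTI; exact: measurable_decons.
rewrite /lebesgue_step /pushforward -comp_preimage (_ : _ \o _ = id); last first.
  by apply/funext => p; exact: consK.
by rewrite preimage_id product_measure1E// lte_mul_pinfty// ge0_fin_numE.
Qed.

HB.instance Definition _ := Measure_isSigmaFinite.Build _ _ _ lebesgue_step
  step_sigma_finite.

End step.

Fixpoint lebesgue_rV (m : nat) : {sigma_finite_measure set 'rV[R]_m -> \bar R} :=
  if m is n.+1 then lebesgue_step (lebesgue_rV n) else \d_ (0 : 'rV[R]_0).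

End lebesgue_rV.

Section calculus.
Context (R : realType).

Definition dot m (u v : 'rV[R]_m) : R := \sum_i u 0 i * v 0 i.

(* The library norm of ['rV[R]_m] is the sup norm. *)
Definition enorm m (v : 'rV[R]_m) : R := Num.sqrt (dot v v).

Definition partial m (i : 'I_m) (f : 'rV[R]_m -> R) (P : 'rV[R]_m) : R :=
  'D_(delta_mx 0 i) f P.

Definition grad m (f : 'rV[R]_m -> R) (P : 'rV[R]_m) : 'rV[R]_m :=
  \row_i partial i f P.

(* For an open set [V]: all partial derivatives of [f] of order at most [k]
   exist and are continuous in [V]. *)
Fixpoint Ck m (k : nat) (V : set 'rV[R]_m) (f : 'rV[R]_m -> R) : Prop :=
  (forall P, V P -> {for P, continuous f}) /\
  if k is k'.+1 then
    forall i : 'I_m, (forall P, V P -> derivable f P (delta_mx 0 i)) /\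
                     Ck k' V (partial i f)
  else True.

Definition smooth m (V : set 'rV[R]_m) (f : 'rV[R]_m -> R) : Prop :=
  forall k, Ck k V f.

Definition smooth_vec m p (V : set 'rV[R]_m) (f : 'rV[R]_m -> 'rV[R]_p) : Prop :=
  forall k, smooth V (fun P => f P 0 k).

(* [mu] is the surface measure of the hypersurface [M] of [R^m]: it is carried
   by [M], and on every piece of [M] that is the graph [x_j = g(y)] of a C^1
   function of the other coordinates it is the area [sqrt(1 + |grad g|^2) dy].
   The graph is taken over a Borel subset [B] of the domain of [g] so that a
   hypersurface of the closed half-space [t >= 0] is covered up to [t = 0]. *)
Definition is_surface_measure m (M : set 'rV[R]_m)
    (mu : {measure set 'rV[R]_m -> \bar R}) : Prop :=
  mu (~` M) = 0%E /\
  forall (j : 'I_m) (W B : set 'rV[R]_m.-1) (g : 'rV[R]_m.-1 -> R),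
    open W -> Ck 1 W g -> measurable B -> B `<=` W ->
    [set insert_coord j (g y) y | y in B] `<=` M ->
    mu [set insert_coord j (g y) y | y in B] =
    (\int[lebesgue_rV R m.-1]_(y in B)
       (Num.sqrt (1 + dot (grad g y) (grad g y)))%:E)%E.

Definition in_Linfty m (D : set 'rV[R]_m) (f : 'rV[R]_m -> R) : Prop :=
  measurable_fun D (f : 'rV[R]_m -> measurableTypeR R) /\
  exists C : R, {ae lebesgue_rV R m, forall P, D P -> `|f P| <= C}.

(* Restrictions of these functions to [t >= 0] form D(R^n x [0, oo)). *)
Definition test_function m (phi : 'rV[R]_m -> R) : Prop :=
  smooth setT phi /\
  exists2 K : set 'rV[R]_m, compact K & forall P, ~ K P -> phi P = 0.

End calculus.

Section front.
Context (R : realType) (n : nat).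
Notation point := 'rV[R]_n.+1.
Notation vec := 'rV[R]_n.
Implicit Types (S f : point -> R) (P : point) (M : set point).

Definition time P : R := P 0 ord0.

Definition dt f P : R := partial ord0 f P.

Definition dx (j : 'I_n) f P : R := partial (lift ord0 j) f P.

Definition gradx f P : vec := \row_j dx j f P.

Definition Gamma S : set point := [set P | 0 <= time P /\ S P = 0].

Definition nu S P : vec := (enorm (gradx S P))^-1 *: gradx S P.

Definition G S P : R := - dt S P / enorm (gradx S P).

Definition Udelta S P : vec := G S P *: nu S P.

Definition dnu S f P : R := dot (nu S P) (gradx f P).

(* The delta-derivatives of a function that is given in a neighbourhood of the
   front. *)
Definition ddt S f P : R := dt f P + G S P * dnu S f P.

Definition ddx S (j : 'I_n) f P : R := dx j f P - nu S P 0 j * dnu S f P.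

(* [M] is (a part of) the front, [f] is relevant only through its values on
   [M], and [ft] is a smooth extension of [f] from [M]. *)
Definition smooth_extension M f (ft : point -> R) : Prop :=
  exists V : set point,
    [/\ open V, M `<=` V, smooth V ft & forall P, M P -> ft P = f P].

Definition smooth_on_front M f : Prop := exists ft, smooth_extension M f ft.

Definition extension M f : point -> R := xget f [set ft | smooth_extension M f ft].

Definition delta_t S M f P : R := ddt S (extension M f) P.

Definition delta_x S M (j : 'I_n) f P : R := ddx S j (extension M f) P.

Definition tangent_div S M (A : point -> vec) P : R :=
  \sum_j delta_x S M j (fun Q => A Q 0 j) P.

Definition mean_curvature S M P : R := - 2^-1 * tangent_div S M (nu S) P.

End front.

Section delta_shock.
Context (R : realType) (n : nat).
Notation point := 'rV[R]_n.+1.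
Notation vec := 'rV[R]_n.

(* [N u] is the matrix with rows [N_1 u], ..., [N_n u]. *)
Implicit Types (F : vec -> vec) (N : vec -> 'M[R]_n).

(* [S] is a smooth function on R^n x R of which only the restriction to
   [t >= 0] matters; such restrictions are the elements of
   C^oo(R^n x [0, oo)). *)
Definition moving_front (S : point -> R) : Prop :=
  smooth setT S /\ forall P, Gamma S P -> gradx S P != 0.

Definition initial_front (S : point -> R) (S0 : vec -> R) : Prop :=
  [/\ smooth setT S0, forall x, S0 x = 0 -> grad S0 x != 0 &
      forall x, S0 x = 0 <-> S (pt 0 x) = 0].

Definition upper_half_space : set point := [set P | 0 < time P].

(* Weak form of (rho^ + e delta(Gamma))_t + div (rho^ f) = 0 with the integrals
   on Gamma and Gamma_0 taken for the surface measures [mu] and [mu0]. Here [r]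
   and [fl] are the density and the flux, [a] is the strength on Gamma, and
   [r0] and [a0] are the initial data. *)
Definition weak_balance (S : point -> R)
    (mu : {measure set point -> \bar R}) (Gamma0 : set vec)
    (mu0 : {measure set vec -> \bar R})
    (r : point -> R) (fl : point -> vec) (a : point -> R)
    (r0 : vec -> R) (a0 : vec -> R) : Prop :=
  forall phi : point -> R, test_function phi ->
    \int[lebesgue_rV R n.+1]_(P in upper_half_space)
       (r P * dt phi P + dot (fl P) (gradx phi P))
    + \int[mu]_(P in Gamma S)
       (a P * ddt S phi P / Num.sqrt (1 + G S P ^+ 2))
    + \int[lebesgue_rV R n]_(x in setT) (r0 x * phi (pt 0 x))
    + \int[mu0]_(x in Gamma0) (a0 x * phi (pt 0 x)) = 0.

(* The density rho = rho^ + e delta(Gamma) is given by [rho] (for rho^) and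
   [e]; only the values of [e] on Gamma, and of [e0] and [Ud0] on Gamma_0,
   matter. *)
Definition delta_shock_solution F N (S : point -> R) (S0 : vec -> R)
    (mu : {measure set point -> \bar R}) (mu0 : {measure set vec -> \bar R})
    (U : point -> vec) (rho e : point -> R)
    (U0 : vec -> vec) (rho0 e0 : vec -> R) (Ud0 : vec -> vec) : Prop :=
  let Gamma0 := [set x | S0 x = 0] in
  [/\ [/\ forall k, in_Linfty setT (fun x => U0 x 0 k),
          in_Linfty setT rho0 & {within Gamma0, continuous e0}],
      [/\ forall k, in_Linfty upper_half_space (fun P => U P 0 k),
          in_Linfty upper_half_space rho & {within Gamma S, continuous e}],
      weak_balance S mu Gamma0 mu0
        rho (fun P => rho P *: F (U P)) e rho0 e0 &
      forall k : 'I_n, weak_balance S mu Gamma0 mu0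
        (fun P => rho P * U P 0 k) (fun P => rho P *: row k (N (U P)))
        (fun P => e P * Udelta S P 0 k)
        (fun x => U0 x 0 k * rho0 x) (fun x => e0 x * Ud0 x 0 k)].

Definition one_sided_limit (T : topologicalType) (D M : set point)
    (f fl : point -> T) : Prop :=
  forall P, M P -> f Q @[Q --> within D (nbhs P)] --> fl P.

Section rankine_hugoniot.
Context (F : vec -> vec) (N : vec -> 'M[R]_n) (S : point -> R) (M : set point)
  (e : point -> R) (Um Up : point -> vec) (rm rp : point -> R) (P : point).

Definition jump_rho : R := rm P - rp P.
Definition jump_rhoF : vec := rm P *: F (Um P) - rp P *: F (Up P).
Definition jump_rhoU : vec := rm P *: Um P - rp P *: Up P.
Definition jump_rhoN : 'M[R]_n := rm P *: N (Um P) - rp P *: N (Up P).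

(* (nu, -G), in the encoding of space-time. *)
Definition st_normal : point := pt (- G S P) (nu S P).

Definition mass_lhs : R :=
  delta_t S M e P + tangent_div S M (fun Q => e Q *: Udelta S Q) P.

Definition momentum_lhs (k : 'I_n) : R :=
  delta_t S M (fun Q => e Q * Udelta S Q 0 k) P +
  tangent_div S M (fun Q => (e Q * Udelta S Q 0 k) *: Udelta S Q) P.

Definition mass_rhs : R := dot (jump_rhoF - jump_rho *: Udelta S P) (nu S P).

Definition momentum_rhs (k : 'I_n) : R :=
  dot (row k jump_rhoN) (nu S P) -
  jump_rhoU 0 k * dot (Udelta S P) (nu S P).

Definition RH_mass : Prop :=
  mass_lhs = dot (pt jump_rho jump_rhoF) st_normal.

Definition RH_momentum : Prop := forall k,
  momentum_lhs k = dot (pt (jump_rhoU 0 k) (row k jump_rhoN)) st_normal.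

Definition RH_mass_velocity : Prop := mass_lhs = mass_rhs.

Definition RH_momentum_velocity : Prop :=
  forall k, momentum_lhs k = momentum_rhs k.

Definition RH_mass_curvature : Prop :=
  delta_t S M e P - 2 * mean_curvature S M P * G S P * e P = mass_rhs.

Definition RH_momentum_curvature : Prop := forall k,
  delta_t S M (fun Q => e Q * Udelta S Q 0 k) P
  - 2 * mean_curvature S M P * G S P * (e P * Udelta S P 0 k) = momentum_rhs k.

End rankine_hugoniot.

End delta_shock.

(* Main.v *)
Require Import Defs.
From HB Require Import structures.
From mathcomp Require Import all_boot all_order all_algebra.
From mathcomp Require Import all_classical all_reals all_analysis.
From mathcomp Require Import measurable_realfun ring lra.
Import Order.TTheory GRing.Theory Num.Theory.
Import numFieldNormedType.Exports.

(** The weak form is tested near a point [P] of the front with functions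
    [phi_eps = z * bump1 eps (S)], a fixed bump [z] along the front times a bump
    across it of width [eps], equal to [1] on the front. As the front is regular
    in space, some space derivative [d_J S] does not vanish at [P], and near [P]
    the front is a graph [x_J = g(y)] where [y] consists of time and of the other
    space coordinates ([zero_set_graph]); [z] is a function of [y].

    The bulk term is the integral of [A . grad phi_eps] for the space-time field
    [A = (r, fl)] made of the density and the flux. The part of the gradient along
    the front contributes [O(eps)]. Across the front, on every line parallel to
    the [J]-axis, [bump1 eps (S)] rises from [0] to [1] and falls back to [0], so
    the integral tends to the integral of [z] times the jump of
    [A . grad S / d_J S] ([slice_estimate], [layer_limit]). Only the one-sided
    limits of [A] at [P] enter, up to an oscillation that is small in a small
    neighbourhood.

    The front term does not depend on [eps]: [delta / delta t] is the derivative
    along [(1, U_delta)], which is tangent to the front, where [phi_eps = z]. In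
    the coordinates [y] it pairs [grad z] with the components of
    [a |grad_x S| (1, U_delta) / |d_J S|], [a] being the strength of the delta
    function ([area_ratio], [surface_integral_graph]). An integration by parts
    turns it into minus the integral of [z] times the divergence in [y]
    ([front_term]); as the field is tangent to the level sets of [S], this
    divergence is the space-time divergence of [a |grad_x S| (1, U_delta)] over
    [|d_J S|] ([graph_divergence]). The latter is [|grad_x S|] times
    [delta a / delta t + div_Gamma (a U_delta)] ([div_transport_field],
    [front_transport]), because tangential derivatives may be computed with any
    extension of [a] and [div_Gamma (a U_delta) = a G div_Gamma nu].

    The initial terms vanish since [phi_eps] is supported in [t > 0]. Comparing
    the two limits and shrinking the neighbourhood gives the jump condition at
    [P] ([jump_balance]), which is applied to the mass and to each component of
    the momentum. The equivalent forms follow from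
    [(nu, - G) = grad S / |grad_x S|], [U_delta . nu = G] and
    [div_Gamma nu = - 2 K], [K] being the mean curvature
    ([RH_equivalent_forms]). *)

Set Implicit Arguments.
Unset Strict Implicit.
Unset Printing Implicit Defensive.

Local Open Scope classical_set_scope.
Local Open Scope ring_scope.

(** * Functions of class C^k and smooth functions *)

Section chain_rule.
Context (R : realType) (V : normedModType R).
Implicit Types (f : V -> R) (h : R -> R).

Lemma derive_line f P v :
  'D_v f P = (fun t : R => f (t *: v + P))^`()%classic 0.
Proof.
rewrite derive1E /derive.
set g1 := fun t => t^-1 *: _; set g2 := fun t => t^-1 *: _.
suff -> : g1 = g2 by [].
by apply/funext => s; rewrite /g1 /g2 /= addr0 scale0r add0r [_%:A]mulr1.
Qed.

Lemma is_derive_comp1 h f (P v : V) (dh : R) :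
  derivable f P v -> is_derive (f P) 1 h dh ->
  is_derive P v (h \o f) (dh * 'D_v f P).
Proof.
move=> /(derivable1P _ _ _).1 df [dhP <-].
have {}dhP : derivable h (f (0 *: v + P)) 1 by rewrite scale0r add0r.
apply: DeriveDef.
  apply/derivable1P; apply/derivable1_diffP.
  apply: (@differentiable_comp _ _ _ _ (fun t : R => f (t *: v + P)) h).
    exact/derivable1_diffP.
  exact/derivable1_diffP.
rewrite 2!derive_line (derive1_comp df dhP) derive1E.
by rewrite [in X in 'D__ _ X]scale0r add0r.
Qed.

End chain_rule.

Section Ck_calculus.
Context (R : realType) (m : nat).
Implicit Types (V : set 'rV[R]_m) (f g : 'rV[R]_m -> R).

Lemma CkW k V f : Ck k.+1 V f -> Ck k V f.
Proof.
elim: k f => [|k IH] f /= [cf H]; split=> // i.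
by split; [exact: (H i).1|exact/IH/(H i).2].
Qed.

Lemma Ck_sub k V V' f : V `<=` V' -> Ck k V' f -> Ck k V f.
Proof.
move=> VV'; elim: k f => [|k IH] f [cf H]; first by split=> // P /VV'/cf.
split=> [P /VV'/cf//|i]; split; last exact/IH/(H i).2.
by move=> P /VV'; exact: (H i).1.
Qed.

Lemma CkU k V V' f : Ck k V f -> Ck k V' f -> Ck k (V `|` V') f.
Proof.
elim: k f => [|k IH] f [cf H] [cf' H'].
  by split=> // P [/cf|/cf'].
split=> [P [/cf|/cf']//|i].
split; last by apply: IH; [exact: (H i).2|exact: (H' i).2].
by move=> P []; [exact: (H i).1|exact: (H' i).1].
Qed.

Lemma near_open V (p : 'rV[R]_m -> Prop) P : open V -> V P ->
  (forall Q, V Q -> p Q) -> \forall Q \near P, p Q.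
Proof.
move=> oV VP Vp.
have nV : nbhs P V by exact: open_nbhs_nbhs.
by apply: filterS nV => Q /Vp.
Qed.

Lemma partial_eq V f g i P : open V -> V P -> (forall Q, V Q -> f Q = g Q) ->
  partial i f P = partial i g P.
Proof. by move=> oV VP fg; apply: near_eq_derive; exact: near_open fg. Qed.

Lemma Ck_eq k V f g : open V -> (forall P, V P -> f P = g P) ->
  Ck k V f -> Ck k V g.
Proof.
move=> oV; elim: k f g => [|k IH] f g fg /= [cf H].
  split=> // P VP; have := cf _ VP; rewrite /prop_for/= /continuous_at -(fg _ VP).
  by apply: cvg_trans; exact: near_eq_cvg (near_open oV VP fg).
split=> [P VP|i].
  have := cf _ VP; rewrite /prop_for/= /continuous_at -(fg _ VP).
  by apply: cvg_trans; exact: near_eq_cvg (near_open oV VP fg).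
split=> [P VP|].
  by apply: near_eq_derivable (near_open oV VP fg) _; exact: (H i).1.
by apply: IH (H i).2 => P VP; exact: partial_eq fg.
Qed.

Lemma Ck_cst k V (c : R) : Ck k V (fun=> c).
Proof.
elim: k c => [|k IH] c; first by split=> // P _; exact: (@cst_continuous _ _ c P).
split=> [P _|i]; first exact: (@cst_continuous _ _ c P).
split=> [P _|]; first exact: derivable_cst.
rewrite (_ : partial i _ = fun=> 0)//.
by apply/funext => P; rewrite /partial derive_cst.
Qed.

Lemma is_derive_coord i (P v : 'rV[R]_m) :
  is_derive P v (fun Q : 'rV[R]_m => Q 0 i) (v 0 i).
Proof.
have E : (fun t : R => t^-1 *: ((t *: v + P) 0 i - P 0 i)) @ 0^' --> v 0 i.
  apply: cvg_near_cst; near=> t.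
  rewrite !mxE addrK /GRing.scale/= mulKf//.
  by near: t; exact: nbhs_dnbhs_neq.
by apply: DeriveDef; [apply/cvg_ex; exists (v 0 i)|exact: cvg_lim E].
Unshelve. all: by end_near. Qed.

Lemma Ck_coord k V i : Ck k V (fun Q => Q 0 i).
Proof.
case: k => [|k]; first by split=> // P _; exact: coord_continuous.
split=> [P _|j]; first exact: coord_continuous.
split=> [P _|]; first by have [] := is_derive_coord i P (delta_mx 0 j).
rewrite (_ : partial j _ = fun=> (delta_mx 0 j : 'rV[R]_m) 0 i); first exact: Ck_cst.
by apply/funext => P; have [_] := is_derive_coord i P (delta_mx 0 j).
Qed.

Lemma CkD k V f g : open V -> Ck k V f -> Ck k V g -> Ck k V (fun P => f P + g P).
Proof.
move=> oV; elim: k f g => [|k IH] f g /= [cf Hf] [cg Hg].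
  by split=> // P VP; apply: continuousD; [exact: cf|exact: cg].
split=> [P VP|i]; first by apply: continuousD; [exact: cf|exact: cg].
have [df cdf] := Hf i; have [dg cdg] := Hg i.
split=> [P VP|]; first by apply: derivableD; [exact: df|exact: dg].
apply: Ck_eq (IH _ _ cdf cdg) => // P VP.
by rewrite /partial [RHS]deriveD//; [exact: df|exact: dg].
Qed.

Lemma CkM k V f g : open V -> Ck k V f -> Ck k V g -> Ck k V (fun P => f P * g P).
Proof.
move=> oV; elim: k f g => [|k IH] f g Hf Hg.
  case: Hf => cf _; case: Hg => cg _.
  by split=> // P VP; apply: continuousM; [exact: cf|exact: cg].
have [Ckf Ckg] := (CkW Hf, CkW Hg).
case: Hf => cf Hf; case: Hg => cg Hg.
split=> [P VP|i]; first by apply: continuousM; [exact: cf|exact: cg].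
have [df cdf] := Hf i; have [dg cdg] := Hg i.
split=> [P VP|]; first by apply: derivableM; [exact: df|exact: dg].
apply: Ck_eq (CkD oV (IH _ _ Ckf cdg) (IH _ _ Ckg cdf)) => // P VP.
by rewrite /partial [RHS]deriveM//; [exact: df|exact: dg].
Qed.

Lemma CkZ k V (c : R) f : open V -> Ck k V f -> Ck k V (fun P => c * f P).
Proof. by move=> oV Cf; apply: CkM => //; exact: Ck_cst. Qed.

Lemma Ck_sum k V I (s : seq I) (F : I -> 'rV[R]_m -> R) : open V ->
  (forall i, Ck k V (F i)) -> Ck k V (fun P => \sum_(i <- s) F i P).
Proof.
move=> oV CF; elim: s => [|i s IH].
  by rewrite (_ : (fun _ => _) = fun=> 0); [exact: Ck_cst|apply/funext => P; rewrite big_nil].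
rewrite (_ : (fun _ => _) = fun P => F i P + \sum_(j <- s) F j P); first exact: CkD.
by apply/funext => P; rewrite big_cons.
Qed.

(** The chain rule keeps the partial derivatives of the composites in the
    algebra generated by the family, so the induction on [k] treats all its
    members at once. This is the situation of the derivatives of [exp(-1/x)]. *)
Lemma Ck_comp_family (h : nat -> R -> R) (a b : nat -> R) V f :
  open V -> (forall k (x : R), is_derive x (1 : R) (h k) (a k * h k.+1 x + b k * h k.+2 x)) ->
  smooth V f -> forall k j, Ck k V (h j \o f).
Proof.
move=> oV dh sf; elim=> [|k IH] j.
  split=> // P VP; apply: continuous_comp; first exact: (sf 0%N).1.
  by apply/differentiable_continuous/derivable1_diffP; have [] := dh j (f P).
have [cf Hf] := sf 1%N.
split=> [P VP|i].
  apply: continuous_comp; first exact: cf.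
  by apply/differentiable_continuous/derivable1_diffP; have [] := dh j (f P).
have dhf P : V P -> is_derive P (delta_mx 0 i) (h j \o f)
    ((a j * h j.+1 (f P) + b j * h j.+2 (f P)) * partial i f P).
  by move=> VP; apply: is_derive_comp1 => //; exact: (Hf i).1.
split=> [P /dhf[]//|].
apply: (@Ck_eq k V (fun P => (a j * (h j.+1 \o f) P + b j * (h j.+2 \o f) P) *
   partial i f P)) => // [P /dhf[_ <-]//|].
apply: CkM => //; last by have [_ /(_ i)[]] := sf k.+1.
by apply: CkD => //; apply: CkZ.
Qed.

Definition rsqrt (x : R) : R := (Num.sqrt x)^-1.

Lemma sqr_rsqrt x : 0 < x -> rsqrt x ^+ 2 * x = 1.
Proof. by move=> x0; rewrite exprVn sqr_sqrtr ?ltW// mulVf// gt_eqF. Qed.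

Lemma is_derive_rsqrt (x : R) : 0 < x -> is_derive x (1 : R) rsqrt (- 2^-1 * rsqrt x ^+ 3).
Proof.
move=> x0; have dx := is_derive1_sqrt x0.
have s0 : Num.sqrt x != 0 by rewrite gt_eqF// sqrtr_gt0.
apply: is_derive_eq; first exact: is_deriveV.
rewrite /rsqrt /GRing.scale/=.
field.
by rewrite s0.
Qed.

Lemma partial_rsqrt V q i P : smooth V q -> (forall Q, V Q -> 0 < q Q) -> V P ->
  is_derive P (delta_mx 0 i) (rsqrt \o q)
    (- 2^-1 * rsqrt (q P) ^+ 3 * partial i q P).
Proof.
move=> sq q0 VP; apply: is_derive_comp1; last exact/is_derive_rsqrt/q0.
by have [_ /(_ i)[+ _]] := sq 1%N; exact.
Qed.

Lemma smooth_rsqrt V q : open V -> smooth V q -> (forall P, V P -> 0 < q P) ->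
  smooth V (rsqrt \o q).
Proof.
move=> oV sq q0.
have cq : forall P, V P -> {for P, continuous (rsqrt \o q)}.
  move=> P VP; apply: continuous_comp; first exact: (sq 0%N).1.
  apply/differentiable_continuous/derivable1_diffP.
  by have [] := is_derive_rsqrt (q0 _ VP).
elim=> [|k IH]; first by split.
split=> // i; split=> [P VP|]; first by have [] := partial_rsqrt i sq q0 VP.
apply: (@Ck_eq k V (fun P => - 2^-1 * ((rsqrt \o q) P *
   ((rsqrt \o q) P * (rsqrt \o q) P)) * partial i q P)) => //.
  move=> P VP; have [_ /= pE] := partial_rsqrt i sq q0 VP.
  by rewrite /partial pE; congr (_ * _ * _); rewrite !exprS expr0 mulr1.
apply: CkM => //; last by have [_ /(_ i)[]] := sq k.+1.
by apply: CkZ => //; do ?apply: CkM.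
Qed.

Lemma smooth_partial V f i : smooth V f -> smooth V (partial i f).
Proof. by move=> sf k; have [_ /(_ i)[]] := sf k.+1. Qed.

Lemma smooth_derivable V f i P : smooth V f -> V P -> derivable f P (delta_mx 0 i).
Proof. by move=> sf; have [_ /(_ i)[+ _]] := sf 1%N; exact. Qed.

Lemma smooth_continuous V f P : smooth V f -> V P -> {for P, continuous f}.
Proof. by move=> /(_ 0%N)[+ _]; exact. Qed.

Lemma smoothD V f g : open V -> smooth V f -> smooth V g ->
  smooth V (fun P => f P + g P).
Proof. by move=> oV sf sg k; exact: CkD. Qed.

Lemma smoothM V f g : open V -> smooth V f -> smooth V g ->
  smooth V (fun P => f P * g P).
Proof. by move=> oV sf sg k; exact: CkM. Qed.

Lemma smoothZ V (c : R) f : open V -> smooth V f -> smooth V (fun P => c * f P).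
Proof. by move=> oV sf k; exact: CkZ. Qed.

Lemma smoothN V f : open V -> smooth V f -> smooth V (fun P => - f P).
Proof.
move=> oV /(smoothZ (-1) oV); rewrite (_ : (fun P => _) = fun P => - f P)//.
by apply/funext => P; rewrite mulN1r.
Qed.

Lemma smooth_sum V I (s : seq I) (F : I -> 'rV[R]_m -> R) : open V ->
  (forall i, smooth V (F i)) -> smooth V (fun P => \sum_(i <- s) F i P).
Proof. by move=> oV sF k; apply: Ck_sum => // i; exact: sF. Qed.

Lemma smooth_sub V V' f : V `<=` V' -> smooth V' f -> smooth V f.
Proof. by move=> VV' sf k; exact: Ck_sub VV' (sf k). Qed.

Lemma smooth_eq V f g : open V -> (forall P, V P -> f P = g P) ->
  smooth V f -> smooth V g.
Proof. by move=> oV fg sf k; exact: Ck_eq oV fg (sf k). Qed.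

End Ck_calculus.

(** * Differentiability and vanishing on a hypersurface *)

Section mean_value.
Context (R : realType).

Lemma dist_half (x y z eps : R) :
  `|z - y| <= eps / 2 -> `|x - y| <= eps / 2 -> `|x - z| <= eps.
Proof. by rewrite !ler_norml => /andP[? ?] /andP[? ?]; apply/andP; split; lra. Qed.

Lemma is_derive_line (V : normedModType R) (f : V -> R) (Q v : V) (t df : R) :
  is_derive (Q + t *: v) v f df ->
  is_derive t (1 : R) (fun s : R => f (Q + s *: v)) df.
Proof.
move=> [] + <-; rewrite /derivable /derive.
set g1 := fun t => t^-1 *: _ => dg1.
have E : g1 = (fun h : R => h^-1 *:
   (((fun s : R => f (Q + s *: v)) \o shift t) (h *: (1 : R)) - f (Q + t *: v))).
  by apply/funext => h; rewrite /g1 /= [_%:A]mulr1 addrCA -scalerDl.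
rewrite E in dg1 *.
exact: DeriveDef.
Qed.

(** Both signs of [a] are allowed because increments of coordinates have no
    definite sign. *)
Lemma MVT0 (h dh : R -> R) (a : R) :
  (forall s, `|s| <= `|a| -> is_derive s (1 : R) h (dh s)) ->
  exists2 s, `|s| <= `|a| & h a - h 0 = dh s * a.
Proof.
move=> dhP.
have ch s : `|s| <= `|a| -> {for s, continuous h}.
  by move=> /dhP[ds _]; apply/differentiable_continuous/derivable1_diffP.
have [a0|a0] := leP 0 a.
  have sa s : s \in `[0, a] -> `|s| <= `|a|.
    by rewrite in_itv/= => /andP[s0 sa]; rewrite !ger0_norm.
  have ds s : s \in `]0, a[ -> is_derive s (1 : R) h (dh s).
    by move=> s0a; apply/dhP/sa; move: s s0a; exact: subset_itv_oo_cc.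
  have [|s s0a E] := MVT_segment a0 ds.
    by apply: continuous_in_subspaceT => s; rewrite inE => s0a; exact/ch/sa.
  by exists s; [exact: sa|rewrite E subr0].
have sa s : s \in `[a, 0] -> `|s| <= `|a|.
  by rewrite in_itv/= => /andP[s0 sa]; rewrite !ler0_norm ?lerN2// ltW.
have ds s : s \in `]a, 0[ -> is_derive s (1 : R) h (dh s).
  by move=> s0a; apply/dhP/sa; move: s s0a; exact: subset_itv_oo_cc.
have [|s s0a E] := MVT_segment (ltW a0) ds.
  by apply: continuous_in_subspaceT => s; rewrite inE => s0a; exact/ch/sa.
by exists s; [exact: sa|rewrite -opprB E sub0r mulrN opprK].
Qed.

Lemma diff_expansion (V : normedModType R) (f : V -> R) (L : {linear V -> R}) P :
  continuous L ->
  (forall eps : R, 0 < eps ->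
    \forall h \near (0 : V), `|f (P + h) - f P - L h| <= eps * `|h|) ->
  differentiable f P /\ 'd f P = L :> (V -> R).
Proof.
move=> cL fL.
have E : f \o shift P = cst (f P) + L +o_ (0 : V) id.
  apply/eqaddoP => _/posnumP[eps].
  apply: filterS (fL eps%:num [gt0 of eps%:num]) => h.
  by rewrite [P + h]addrC /= opprD addrA.
have dE := diff_unique cL E.
by split=> //; apply/diff_locallyP; rewrite dE.
Qed.

End mean_value.

Section differentiability.
Context (R : realType) (m : nat).
Implicit Types (V : set 'rV[R]_m) (f : 'rV[R]_m -> R) (P Q v h : 'rV[R]_m).

Notation e_ i := (delta_mx 0 i : 'rV[R]_m).

Lemma normr_coord v i : `|v 0 i| <= `|v|.
Proof. by rewrite [leRHS]/Num.Def.normr/= mx_normrE; exact: (le_bigmax _ _ (0, i)). Qed.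

Lemma normr_rV_le v (c : R) : 0 <= c -> (forall i, `|v 0 i| <= c) -> `|v| <= c.
Proof.
move=> c0 vc; rewrite [leLHS]/Num.Def.normr/= mx_normrE bigmax_le// => -[i j] _.
by rewrite ord1.
Qed.

Lemma near_norm (p : 'rV[R]_m -> Prop) P : (\forall Q \near P, p Q) ->
  exists2 r : R, 0 < r & forall Q, `|Q - P| < r -> p Q.
Proof.
move=> /nbhs_ballP[r /= r0 rp]; exists r => // Q Qr; apply: rp.
by rewrite -ball_normE/= distrC.
Qed.

Lemma norm_near (p : 'rV[R]_m -> Prop) P (r : R) : 0 < r ->
  (forall Q, `|Q - P| < r -> p Q) -> \forall Q \near P, p Q.
Proof.
move=> r0 rp; apply/nbhs_ballP; exists r => //= Q.
by rewrite -ball_normE/= distrC; exact: rp.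
Qed.

Lemma dotC (u v : 'rV[R]_m) : dot u v = dot v u.
Proof. by apply: eq_bigr => i _; rewrite mulrC. Qed.

Lemma dotDl (u v w : 'rV[R]_m) : dot (u + v) w = dot u w + dot v w.
Proof. by rewrite -big_split; apply: eq_bigr => i _; rewrite mxE mulrDl. Qed.

Lemma dotZl (c : R) (u v : 'rV[R]_m) : dot (c *: u) v = c * dot u v.
Proof. by rewrite mulr_sumr; apply: eq_bigr => i _; rewrite mxE mulrA. Qed.

Lemma dotBl (u v w : 'rV[R]_m) : dot (u - v) w = dot u w - dot v w.
Proof. by rewrite dotDl -scaleN1r dotZl mulN1r. Qed.

Lemma dot_gt0 v : v != 0 -> 0 < dot v v.
Proof.
move=> v0; rewrite lt_neqAle sumr_ge0 ?andbT => [|i _]; last by rewrite -expr2 sqr_ge0.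
apply: contra v0; rewrite eq_sym psumr_eq0 => [/allP v0|i _]; last by rewrite -expr2 sqr_ge0.
apply/eqP/rowP => i; rewrite mxE; apply/eqP.
by have := v0 i (mem_index_enum i); rewrite /= -expr2 sqrf_eq0.
Qed.

Lemma dot_e v i : dot v (e_ i) = v 0 i.
Proof.
rewrite /dot (bigD1 i)//= mxE !eqxx mulr1 big1 ?addr0// => j ji.
by rewrite mxE (negPf ji) andbF mulr0.
Qed.

(** Moving the coordinates one at a time expresses an increment of [f] through
    values of its partial derivatives at points near [P]. *)
Lemma increment_sum f P h (eps : R) :
  0 <= eps ->
  (forall Q i, `|Q - P| <= `|h| -> derivable f Q (e_ i) /\
     `|partial i f Q - partial i f P| <= eps) ->
  `|f (P + h) - f P - dot h (grad f P)| <= m%:R * eps * `|h|.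
Proof.
move=> eps0 H.
pose tr (k : nat) : 'rV[R]_m := \row_i (if (i < k)%N then h 0 i else 0).
have -> : f (P + h) - f P = \sum_(k < m) (f (P + tr k.+1) - f (P + tr k)).
  have := telescope_sumr (fun k => f (P + tr k)) (leq0n m).
  rewrite big_mkord => ->; congr (f (_ + _) - f _).
    by apply/rowP => i; rewrite mxE ltn_ord.
  by rewrite -[LHS]addr0; congr (_ + _); apply/rowP => i; rewrite !mxE.
rewrite /dot -sumrB (le_trans (ler_norm_sum _ _ _))//.
rewrite -mulrA -[X in X%:R](card_ord m) mulr_natl -sumr_const.
apply: ler_sum => k _.
have trS : tr k.+1 = tr k + h 0 k *: e_ k.
  apply/rowP => i; rewrite !mxE eqxx/= ltnS leq_eqVlt.
  have [->|ik] := eqVneq i k; first by rewrite eqxx ltnn/= mulr1 add0r.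
  by rewrite (negPf (ik : (i : nat) != k))/= mulr0 addr0.
have near s : `|s| <= `|h 0 k| -> `|P + tr k + s *: e_ k - P| <= `|h|.
  move=> sh; rewrite -[P + _ + _]addrA [P + _]addrC addrK; apply: normr_rV_le => // i.
  rewrite !mxE eqxx/=; have [->|ik] := eqVneq i k.
    by rewrite ltnn add0r mulr1 (le_trans sh)// normr_coord.
  rewrite mulr0 addr0; case: ifPn => _; last by rewrite normr0.
  exact: normr_coord.
have [s|s sh E] := @MVT0 R (fun s => f (P + tr k + s *: e_ k))
    (fun s => partial k f (P + tr k + s *: e_ k)) (h 0 k).
  move=> sh; apply: is_derive_line; apply: DeriveDef => //.
  by have [] := H _ k (near s sh).
rewrite trS addrA.
have -> : f (P + tr k) = f (P + tr k + 0 *: e_ k) by rewrite scale0r addr0.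
rewrite E mxE [h 0 k * _]mulrC -mulrBl normrM ler_pM//.
  by have [] := H _ k (near s sh).
exact: normr_coord.
Qed.

Lemma dot_linear (w : 'rV[R]_m) : linear (fun h => dot h w).
Proof. by move=> c u v; rewrite dotDl dotZl. Qed.

Lemma dot_continuous v : continuous (fun h => dot h v).
Proof.
move=> h; apply: (Ck_sum _ (k := 0) openT _).1 => // i.
by apply: CkM => //; [exact: openT|exact: Ck_coord|exact: Ck_cst].
Qed.

Lemma diff_dot f P w : (forall eps : R, 0 < eps ->
    \forall h \near (0 : 'rV[R]_m), `|f (P + h) - f P - dot h w| <= eps * `|h|) ->
  differentiable f P /\ forall v, 'd f P v = dot v w.
Proof.
move=> fw.
pose LM := GRing.isLinear.Build _ _ _ _ _ (dot_linear w).
pose L : {linear 'rV[R]_m -> R} := HB.pack (fun h => dot h w) LM.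
have [df dE] := @diff_expansion R _ f L P (@dot_continuous w) fw.
by split=> // v; rewrite dE.
Qed.

(** Near [P] all the partial derivatives are within [eps / (m + 1)] of their
    values at [P], so the sum over the [m] coordinates stays below [eps]. *)
Lemma Ck1_expansion V f P : open V -> Ck 1 V f -> V P -> forall eps : R, 0 < eps ->
  \forall h \near (0 : 'rV[R]_m), `|f (P + h) - f P - dot h (grad f P)| <= eps * `|h|.
Proof.
move=> oV [cf Hf] VP eps eps0.
pose d := eps / m.+1%:R.
have d0 : 0 < d by rewrite divr_gt0.
have : \forall Q \near P, V Q /\ forall i, `|partial i f P - partial i f Q| <= d.
  apply: filterI; first exact: open_nbhs_nbhs.
  apply: (@filter_forall _ 'I_m (fun i Q => `|partial i f P - partial i f Q| <= d) (nbhs P) (nbhs_filter P)) => i.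
  have [_ [/(_ _ VP) /cvgrPdist_le H _]] := Hf i; exact: H.
move=> /nbhs_ballP[r /= r0 rP].
have nr : \forall h \near (0 : 'rV[R]_m), `|h| < r.
  by apply/nbhs_ballP; exists r => //= h; rewrite -ball_normE/= sub0r normrN.
apply: filterS nr => h hr.
apply: (@le_trans _ _ (m%:R * d * `|h|)).
  apply: increment_sum => [|Q i Qh]; first exact: ltW.
  have [|VQ dQ] := rP Q; first by rewrite -ball_normE/= distrC (le_lt_trans Qh).
  by rewrite distrC; split=> //; exact: (Hf i).1.
rewrite ler_wpM2r// /d mulrCA ler_piMr ?ltW//.
by rewrite ltr_pdivrMr// mul1r ltr_nat.
Qed.

(** Both mixed derivatives are limits of the same second difference. *)
Lemma schwarz V f i j P : open V -> smooth V f -> V P ->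
  partial i (partial j f) P = partial j (partial i f) P.
Proof.
move=> oV sf VP.
pose D (k l : 'I_m) (h : R) := f (P + h *: e_ k + h *: e_ l) - f (P + h *: e_ l)
  - (f (P + h *: e_ k) - f P).
have DC k l (a : R) : D k l a = D l k a by rewrite /D [P + _ + _]addrAC; ring.
have [r r0 rV] : exists2 r : R, 0 < r & forall Q, `|Q - P| < r -> V Q.
  by apply: near_norm; exact: open_nbhs_nbhs.
have ne k : `|e_ k| <= 1.
  apply: normr_rV_le => // l; rewrite mxE eqxx/=.
  by case: (_ == _); rewrite ?normr1// normr0.
have nD k l s t (a : R) : `|s| <= `|a| -> `|t| <= `|a| ->
    `|P + s *: e_ k + t *: e_ l - P| <= 2 * `|a|.
  move=> sa ta; rewrite -[P + _ + _]addrA [P + _]addrC addrK.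
  rewrite (le_trans (ler_normD _ _))// mulr_natl mulr2n lerD// normrZ.
    by rewrite -[leRHS]mulr1 ler_pM.
  by rewrite -[leRHS]mulr1 ler_pM.
have Dmean k l (a : R) : 2 * `|a| < r -> exists2 Q, `|Q - P| <= 2 * `|a| &
    D k l a = partial l (partial k f) Q * a * a.
  move=> ar.
  have Vst s t : `|s| <= `|a| -> `|t| <= `|a| -> V (P + s *: e_ k + t *: e_ l).
    by move=> sa ta; apply/rV/(le_lt_trans _ ar)/nD.
  have Vts s t : `|s| <= `|a| -> `|t| <= `|a| -> V (P + t *: e_ l + s *: e_ k).
    by move=> sa ta; rewrite addrAC; exact: Vst.
  have V0 s : `|s| <= `|a| -> V (P + s *: e_ k).
    by move=> sa; rewrite -[P + _]addr0 -(scale0r (e_ l)); apply: Vst => //; rewrite normr0.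
  have [s|s sa] := @MVT0 R
    (fun s => f (P + a *: e_ l + s *: e_ k) - f (P + s *: e_ k))
    (fun s => partial k f (P + a *: e_ l + s *: e_ k) - partial k f (P + s *: e_ k)) a.
    move=> sa; apply: is_deriveB; apply: is_derive_line; apply: DeriveDef => //.
      exact: smooth_derivable sf (Vts _ _ sa (lexx _)).
    exact: smooth_derivable sf (V0 _ sa).
  rewrite !scale0r !addr0 -/(D l k a) DC => ->.
  have [t|t ta] := @MVT0 R
    (fun t => partial k f (P + s *: e_ k + t *: e_ l))
    (fun t => partial l (partial k f) (P + s *: e_ k + t *: e_ l)) a.
    move=> ta; apply: is_derive_line; apply: DeriveDef => //.
    exact: smooth_derivable (smooth_partial _ sf) (Vst _ _ sa ta).
  rewrite !scale0r !addr0 [P + a *: _ + _]addrAC => ->.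
  by exists (P + s *: e_ k + t *: e_ l) => //; exact: nD.
apply/eqP; rewrite -subr_eq0 -normr_le0; apply/ler_addgt0Pr => eps eps0; rewrite add0r.
have cD k l : \forall Q \near P,
    `|partial k (partial l f) P - partial k (partial l f) Q| <= eps / 2.
  have /cvgrPdist_le := smooth_continuous
    (smooth_partial k (smooth_partial l sf)) VP.
  by apply; rewrite divr_gt0.
have [d d0 dP] := near_norm (filterI (cD i j) (cD j i)).
have [a a0 [ar ad]] : exists2 a : R, 0 < a & 2 * `|a| < r /\ 2 * `|a| < d.
  have rd : 0 < Num.min r d by rewrite lt_min r0.
  exists (Num.min r d / 4); first by rewrite divr_gt0.
  have h : 2 * (Num.min r d / 4) < Num.min r d by lra.
  by rewrite gtr0_norm ?divr_gt0//; apply/andP; rewrite -lt_min.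
have [Q Qa EQ] := Dmean i j a ar; have [Q' Qa' EQ'] := Dmean j i a ar.
have QQ' : partial i (partial j f) Q' = partial j (partial i f) Q.
  have an0 : a != 0 by rewrite gt_eqF.
  by move: EQ; rewrite DC EQ' => /(mulIf an0)/(mulIf an0).
have [_ d1] := dP Q (le_lt_trans Qa ad).
have [d2 _] := dP Q' (le_lt_trans Qa' ad).
move: d1 d2; rewrite -QQ'; move: (partial i (partial j f) Q') => y.
move: (partial i (partial j f) P) (partial j (partial i f) P) => x z.
exact: dist_half.
Qed.

(** Near a zero [P] of [S], in every plane spanned by a tangent vector [v] and
    the normal [grad S P] the intermediate value theorem gives zeros of [S] at
    [P + t (v + s grad S P)] with [t] and [s] as small as desired, so the
    derivative of [f] along [v] is a limit of difference quotients of [f] that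
    vanish. *)
Lemma tangent_derivative0 V (S f : 'rV[R]_m -> R) P v :
  open V -> Ck 1 V S -> Ck 1 V f -> V P -> S P = 0 -> grad S P != 0 ->
  (forall Q, V Q -> S Q = 0 -> f Q = 0) ->
  dot v (grad S P) = 0 -> dot v (grad f P) = 0.
Proof.
move=> oV CS Cf VP SP0 gS0 Sf v0.
pose w := grad S P; pose kap := dot w w.
have kap0 : 0 < kap by exact: dot_gt0.
pose K := `|v| + `|w|.
have K0 : 0 <= K by rewrite addr_ge0.
have bnd (eps : R) : 0 < eps -> eps <= 1 ->
    `|dot v (grad f P)| <= eps * (`|dot w (grad f P)| + K).
  move=> eps0 eps1.
  (* with this precision the error in the expansion of [S] is smaller than its
     variation [t eps kap] along the normal *)
  pose eta := eps * kap / (K + 1).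
  have K1 : 0 < K + 1 by rewrite ltr_wpDl.
  have eta0 : 0 < eta by rewrite divr_gt0// mulr_gt0.
  have etaK : eta * K < eps * kap.
    by rewrite /eta mulrAC ltr_pdivrMr// ltr_pM2l ?mulr_gt0// ltrDl.
  have nV : \forall h \near (0 : 'rV[R]_m), V (P + h).
    have [r r0 rV] : exists2 r : R, 0 < r & forall Q, `|Q - P| < r -> V Q.
      by apply: near_norm; exact: open_nbhs_nbhs.
    by apply: (norm_near r0) => h; rewrite subr0 => hr; apply: rV; rewrite [P + h]addrC addrK.
  have [r r0 rP] := near_norm (filterI nV (filterI
    (Ck1_expansion oV Cf VP eps0) (Ck1_expansion oV CS VP eta0))).
  pose t := r / (K + 1).
  have t0 : 0 < t by rewrite divr_gt0.
  pose h (s : R) : 'rV[R]_m := t *: (v + s *: w).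
  have hK s : `|s| <= eps -> `|h s| <= t * K.
    move=> se; rewrite normrZ gtr0_norm// ler_pM2l// (le_trans (ler_normD _ _))//.
    by rewrite lerD2l normrZ ler_piMl// (le_trans se).
  have hr s : `|s| <= eps -> [/\ V (P + h s),
      `|f (P + h s) - f P - dot (h s) (grad f P)| <= eps * `|h s| &
      `|S (P + h s) - S P - dot (h s) w| <= eta * `|h s|].
    move=> /hK hs; have [|? []] // := rP (h s).
    rewrite subr0 (le_lt_trans hs)//.
    by rewrite /t mulrAC ltr_pdivrMr// ltr_pM2l// ltrDl.
  have dh s (u : 'rV[R]_m) : dot (h s) u = t * (dot v u + s * dot w u).
    by rewrite dotZl dotDl dotZl.
  have Sh s : `|s| <= eps -> `|S (P + h s) - t * (s * kap)| <= eta * (t * K).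
    move=> se; have [_ _] := hr s se; rewrite SP0 subr0 dh v0 add0r => /le_trans.
    by apply; rewrite ler_pM2l// hK.
  have eN : `|- eps| <= eps by rewrite normrN gtr0_norm.
  have eP : `|eps| <= eps by rewrite gtr0_norm.
  have small : eta * (t * K) < t * (eps * kap) by rewrite mulrCA ltr_pM2l.
  have Se : 0 < S (P + h eps).
    by have := Sh _ eP; rewrite ler_norml => /andP[+ _]; lra.
  have SNe : S (P + h (- eps)) < 0.
    by have := Sh _ eN; rewrite ler_norml => /andP[_]; lra.
  have [|||s sE Ss] := @IVT R (fun s => S (P + h s)) (- eps) eps 0.
  - by rewrite ge0_cp// ltW.
  - apply: continuous_in_subspaceT => s; rewrite inE/= in_itv/= -ler_norml => se.
    apply: continuous_comp; last by apply: CS.1; have [] := hr s se.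
    apply: continuousD; first exact: cst_continuous.
    apply: (@continuous_comp _ _ _ (fun s : R => v + s *: w) ( *:%R t)).
      apply: continuousD; first exact: cst_continuous.
      exact: scalel_continuous.
    exact: scaler_continuous.
  - by rewrite ge_min le_max (ltW Se) (ltW SNe) orbT.
  move: sE; rewrite in_itv/= -ler_norml => se.
  have [Vs + _] := hr s se; rewrite (Sf _ Vs Ss) (Sf _ VP SP0) subrr sub0r normrN.
  rewrite dh normrM gtr0_norm// => /le_trans => /(_ (eps * (t * K))).
  rewrite ler_pM2l// => /(_ (hK _ se)); rewrite mulrCA ler_pM2l// => le1.
  rewrite -[dot v _](addrK (s * dot w (grad f P))) (le_trans (ler_normB _ _))//.
  rewrite mulrDr addrC lerD// normrM ler_wpM2r//.
apply/eqP; rewrite -normr_le0; apply/ler_addgt0Pr => e e0; rewrite add0r.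
pose C := `|dot w (grad f P)| + K.
have C0 : 0 <= C by rewrite addr_ge0.
have C1 : 0 < C + 1 by rewrite ltr_wpDl.
have m0 : 0 < Num.min 1 (e / (C + 1)) by rewrite lt_min ltr01 divr_gt0.
rewrite (le_trans (bnd _ m0 _))// ?ge_min ?lexx// -/C.
rewrite (@le_trans _ _ (e / (C + 1) * C))//; first by rewrite ler_wpM2r// ge_min lexx orbT.
by rewrite mulrAC ler_pdivrMr// ler_pM2l// lerDl.
Qed.

End differentiability.

(** * Differential calculus of the front *)

Section partial_rules.
Context (R : realType) (m : nat).
Implicit Types (V : set 'rV[R]_m) (f g : 'rV[R]_m -> R) (P : 'rV[R]_m).

Lemma partialM V f g i P : smooth V f -> smooth V g -> V P ->
  partial i (fun Q => f Q * g Q) P = partial i f P * g P + f P * partial i g P.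
Proof.
move=> sf sg VP; have df : derivable f P (delta_mx 0 i) by exact: smooth_derivable sf VP.
have dg : derivable g P (delta_mx 0 i) by exact: smooth_derivable sg VP.
rewrite /partial [LHS](deriveM df dg) addrC; congr (_ + _); exact: mulrC.
Qed.

Lemma partialN V f i P : smooth V f -> V P ->
  partial i (fun Q => - f Q) P = - partial i f P.
Proof. by move=> sf VP; rewrite /partial [LHS]deriveN//; exact: smooth_derivable. Qed.

Lemma partial_sum V k (F : 'I_k -> 'rV[R]_m -> R) i P :
  (forall j, smooth V (F j)) -> V P ->
  partial i (fun Q => \sum_j F j Q) P = \sum_j partial i (F j) P.
Proof.
move=> sF VP; rewrite /partial -derive_sum => [|j]; last exact: smooth_derivable (sF j) VP.
by congr (derive _ P _); apply/funext => Q; rewrite fct_sumE.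
Qed.

Lemma gradB V f g P : open V -> smooth V f -> smooth V g -> V P ->
  grad (fun Q => f Q - g Q) P = grad f P - grad g P.
Proof.
move=> oV sf sg VP; apply/rowP => i; rewrite !mxE /partial [LHS]deriveB//.
  exact: smooth_derivable sf VP.
exact: smooth_derivable sg VP.
Qed.

End partial_rules.

Section front_calculus.
Context (R : realType) (n : nat).
Notation point := 'rV[R]_n.+1.
Implicit Types (S f g a : point -> R) (P Q : point) (V M : set point).

Lemma gradE f P : grad f P = pt (dt f P) (gradx f P).
Proof.
apply/rowP => i; rewrite mxE; have [j ->|->] := unliftP ord0 i.
  by rewrite pt_lift mxE.
by rewrite pt_ord0.
Qed.

Lemma dot_pt (s t : R) (u v : 'rV[R]_n) : dot (pt s u) (pt t v) = s * t + dot u v.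
Proof.
rewrite /dot big_ord_recl !pt_ord0; congr (_ + _).
by apply: eq_bigr => i _; rewrite !pt_lift.
Qed.

Lemma ddtE S f P : ddt S f P = dot (pt 1 (Udelta S P)) (grad f P).
Proof. by rewrite gradE dot_pt mul1r /Udelta dotZl. Qed.

Lemma ddxE S j f P :
  ddx S j f P = dot (pt 0 (delta_mx 0 j - nu S P 0 j *: nu S P)) (grad f P).
Proof.
by rewrite gradE dot_pt mul0r add0r dotBl dotZl dotC dot_e mxE.
Qed.

Section nondegenerate.
Context (S : point -> R).
Hypothesis sS : smooth [set: point] S.

Definition sqgradx P : R := dot (gradx S P) (gradx S P).
Definition regular : set point := [set P | 0 < sqgradx P].

Lemma smooth_dx j : smooth [set: point] (dx j S).
Proof. exact: smooth_partial. Qed.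

Lemma smooth_dt : smooth [set: point] (dt S).
Proof. exact: smooth_partial. Qed.

Lemma smooth_sqgradx : smooth [set: point] sqgradx.
Proof.
rewrite (_ : sqgradx = fun P => \sum_j dx j S P * dx j S P).
  by apply: smooth_sum => [|j]; [exact: openT|apply: smoothM; [exact: openT| |]; exact: smooth_dx].
by apply/funext => P; apply: eq_bigr => j _; rewrite !mxE.
Qed.

Lemma sqgradxE P : sqgradx P = \sum_j dx j S P * dx j S P.
Proof. by apply: eq_bigr => j _; rewrite !mxE. Qed.

Lemma open_regular : open regular.
Proof.
apply: (@open_comp _ _ sqgradx [set x | 0 < x]); last exact: open_gt.
by move=> P _; exact: smooth_continuous smooth_sqgradx _.
Qed.

Notation b := (@rsqrt R \o sqgradx).

Lemma smooth_rsqgradx : smooth regular b.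
Proof.
apply: smooth_rsqrt; [exact: open_regular| |by []].
exact: smooth_sub smooth_sqgradx.
Qed.

Lemma nuE P j : nu S P 0 j = b P * dx j S P.
Proof. by rewrite !mxE. Qed.

Lemma GE P : G S P = - dt S P * b P.
Proof. by []. Qed.

Lemma smooth_nu j : smooth regular (fun P => nu S P 0 j).
Proof.
apply: (@smooth_eq _ _ _ (fun P => b P * dx j S P)); first exact: open_regular.
  by move=> P _; rewrite nuE.
apply: smoothM; [exact: open_regular|exact: smooth_rsqgradx|].
exact: smooth_sub (smooth_dx j).
Qed.

Lemma smooth_G : smooth regular (G S).
Proof.
apply: (@smooth_eq _ _ _ (fun P => - dt S P * b P)); [exact: open_regular|by []|].
apply: smoothM; [exact: open_regular| |exact: smooth_rsqgradx].
by apply: smooth_sub (smoothN _ smooth_dt) => //; exact: openT.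
Qed.

Lemma smooth_Udelta j : smooth regular (fun P => Udelta S P 0 j).
Proof.
apply: (@smooth_eq _ _ _ (fun P => G S P * nu S P 0 j)); first exact: open_regular.
  by move=> P _; rewrite [RHS]mxE.
by apply: smoothM; [exact: open_regular|exact: smooth_G|exact: smooth_nu].
Qed.

Lemma b2q P : regular P -> b P * b P * sqgradx P = 1.
Proof. by move=> rP; rewrite -expr2 sqr_rsqrt. Qed.

Lemma enormE P : regular P -> enorm (gradx S P) = sqgradx P * b P.
Proof.
move=> rP; rewrite /rsqrt/= -{1}[sqgradx P]sqr_sqrtr ?ltW// expr2 mulfK//.
by rewrite gt_eqF// sqrtr_gt0.
Qed.

Lemma dot_nu_nu P : regular P -> dot (nu S P) (nu S P) = 1.
Proof. by move=> rP; rewrite /nu dotZl dotC dotZl mulrA; exact: b2q. Qed.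

Lemma dot_nu_gradx P : regular P -> dot (nu S P) (gradx S P) = enorm (gradx S P).
Proof. by move=> rP; rewrite /nu dotZl [RHS]enormE// mulrC. Qed.

(** The velocity [G = - S_t / |grad_x S|] is defined by the level sets of [S]
    off the front too, so [(1, U_delta)] is tangent to all of them. *)
Lemma ddt_level P : regular P -> dot (pt 1 (Udelta S P)) (grad S P) = 0.
Proof.
move=> rP; rewrite gradE dot_pt mul1r /Udelta dotZl dot_nu_gradx//.
by rewrite /G divfK ?subrr// gt_eqF// sqrtr_gt0.
Qed.

Lemma ddx_level P j : regular P ->
  dot (pt 0 (delta_mx 0 j - nu S P 0 j *: nu S P)) (grad S P) = 0.
Proof.
move=> rP; rewrite gradE dot_pt mul0r add0r dotBl dotZl dot_nu_gradx//.
rewrite dotC dot_e nuE enormE// mulrAC mulrA [X in _ - X]mulrC.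
rewrite [X in _ * X](_ : _ = 1) ?mulr1; first by rewrite mxE subrr.
by rewrite -[RHS](b2q rP) mulrAC.
Qed.

Lemma ddxM V f g j P : smooth V f -> smooth V g -> V P ->
  ddx S j (fun Q => f Q * g Q) P = ddx S j f P * g P + f P * ddx S j g P.
Proof.
move=> sf sg VP; rewrite /ddx /dnu /dx (partialM _ sf sg VP).
have -> : dot (nu S P) (gradx (fun Q => f Q * g Q) P) =
    dot (nu S P) (gradx f P) * g P + f P * dot (nu S P) (gradx g P).
  rewrite mulr_suml mulr_sumr -big_split; apply: eq_bigr => k _.
  by rewrite /= !mxE /dx (partialM _ sf sg VP); ring.
by ring.
Qed.

(** The tangential gradient is the gradient minus its component along [nu]. *)
Lemma nu_ddx f P : regular P -> \sum_j nu S P 0 j * ddx S j f P = 0.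
Proof.
move=> rP; rewrite /ddx.
under eq_bigr do rewrite mulrBr mulrA.
rewrite sumrB -mulr_suml -/(dot (nu S P) (nu S P)) dot_nu_nu// mul1r.
rewrite [X in X - _](_ : _ = dnu S f P) ?subrr//.
by apply: eq_bigr => j _; rewrite [X in _ = _ * X]mxE.
Qed.

Lemma partial_b i P : regular P ->
  partial i b P = - 2^-1 * (b P * b P * b P) * partial i sqgradx P.
Proof.
move=> rP.
have [_ E] := partial_rsqrt i (smooth_sub (@subsetT _ regular) smooth_sqgradx)
  (fun Q (rQ : regular Q) => rQ) rP.
by rewrite /partial E !exprS expr0 mulr1 mulrA.
Qed.

Lemma partial_sqgradx i P :
  partial i sqgradx P = 2 * \sum_j dx j S P * partial i (dx j S) P.
Proof.
rewrite (_ : sqgradx = fun P => \sum_j dx j S P * dx j S P); last first.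
  by apply/funext => Q; apply: eq_bigr => j _; rewrite !mxE.
have sd j := smooth_dx j.
rewrite (@partial_sum _ _ setT) => [|j|//].
  rewrite mulr_sumr; apply: eq_bigr => j _; rewrite (partialM i (sd j) (sd j))//.
  by ring.
by apply: smoothM; [exact: openT| |]; exact: smooth_dx.
Qed.

(** The tangential divergence of [nu] is its full spatial divergence: the
    difference is [nu . d_nu nu], which vanishes because [|nu| = 1]. *)
Lemma sum_ddx_nu P : regular P ->
  \sum_j ddx S j (fun Q => nu S Q 0 j) P =
  \sum_j (partial (lift ord0 j) b P * dx j S P + b P * dx j (dx j S) P).
Proof.
move=> rP.
have pnu i j : partial i (fun Q => nu S Q 0 j) P =
    partial i b P * dx j S P + b P * partial i (dx j S) P.
  rewrite -(partialM i smooth_rsqgradx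
    (smooth_sub (@subsetT _ regular) (smooth_dx j)) rP).
  by congr (partial i _ P); apply/funext => Q; rewrite nuE.
rewrite sumrB [X in _ - X](_ : _ = 0) ?subr0; last first.
  rewrite /dnu; under eq_bigr do rewrite mulr_sumr.
  rewrite exchange_big big1//= => k _.
  have -> : \sum_j nu S P 0 j * (nu S P 0 k * gradx (fun Q => nu S Q 0 j) P 0 k) =
     nu S P 0 k * (b P * partial (lift ord0 k) b P * sqgradx P +
       b P * b P * (2^-1 * partial (lift ord0 k) sqgradx P)).
    rewrite partial_sqgradx mulKf// sqgradxE.
    rewrite !mulr_sumr -big_split mulr_sumr; apply: eq_bigr => j _.
    have -> : gradx (fun Q => nu S Q 0 j) P 0 k = partial (lift ord0 k) b P *
        dx j S P + b P * partial (lift ord0 k) (dx j S) P by rewrite mxE -pnu.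
    rewrite !nuE.
    move: (b P) (partial _ b P) (dx j S P) (dx k S P) (partial _ (dx j S) P).
    by move=> b0 pb sj sk pS; rewrite /=; ring.
  rewrite partial_b//.
  have -> : b P * (- 2^-1 * (b P * b P * b P) * partial (lift ord0 k) sqgradx P) *
     sqgradx P = - (b P * b P) * (2^-1 * partial (lift ord0 k) sqgradx P) *
     (b P * b P * sqgradx P) by ring.
  by rewrite b2q//; ring.
by apply: eq_bigr => j _; rewrite [LHS]pnu.
Qed.

(** This is [a |grad_x S| (1, U_delta)]; in the present form a single inverse
    square root is differentiated. *)
Definition transport_field a (i : 'I_n.+1) P : R :=
  a P * b P * pt (sqgradx P) (- dt S P *: gradx S P) 0 i.

Lemma transport_field0 a P : transport_field a ord0 P = a P * b P * sqgradx P.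
Proof. by rewrite /transport_field pt_ord0. Qed.

Lemma transport_fieldS a j P :
  transport_field a (lift ord0 j) P = a P * b P * (- dt S P * dx j S P).
Proof. by rewrite /transport_field pt_lift !mxE. Qed.

Lemma transport_fieldE a i P : regular P ->
  transport_field a i P = a P * enorm (gradx S P) * pt 1 (Udelta S P) 0 i.
Proof.
move=> rP; rewrite enormE//; have [j ->|->] := unliftP ord0 i.
  rewrite transport_fieldS pt_lift mxE GE nuE.
  transitivity (a P * b P * (- dt S P * dx j S P) * (b P * b P * sqgradx P)).
    by rewrite b2q// mulr1.
  by ring.
by rewrite transport_field0 pt_ord0; ring.
Qed.

Lemma smooth_transport_field V a i : open V -> V `<=` regular -> smooth V a ->
  smooth V (transport_field a i).
Proof.
move=> oV Vr sa.
have sb : smooth V b by exact: smooth_sub Vr smooth_rsqgradx.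
have sub f : smooth setT f -> smooth V f by exact: smooth_sub.
apply: smoothM => //; first exact: smoothM.
have [j ->|->] := unliftP ord0 i.
  apply: (@smooth_eq _ _ _ (fun P => - dt S P * dx j S P)) => //.
    by move=> P _; rewrite pt_lift !mxE.
  by apply: smoothM => //; [apply: smoothN => //; exact/sub/smooth_dt|exact/sub/smooth_dx].
apply: (@smooth_eq _ _ _ sqgradx) => //; last exact/sub/smooth_sqgradx.
by move=> P _; rewrite pt_ord0.
Qed.

(** For [a = 1] the field is [(|grad_x S|, - S_t nu)]. The time derivative of
    [|grad_x S|] is [nu . grad_x S_t], which cancels the derivative of [- S_t]
    along [nu], and what remains is [- S_t div nu = |grad_x S| G div nu]. *)
Lemma div_transport_field V a P : open V -> V `<=` regular -> smooth V a -> V P ->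
  \sum_i partial i (transport_field a i) P =
  enorm (gradx S P) * (ddt S a P +
    a P * G S P * \sum_j ddx S j (fun Q => nu S Q 0 j) P).
Proof.
move=> oV Vr sa VP; have rP := Vr _ VP.
have sb : smooth V b by exact: smooth_sub Vr smooth_rsqgradx.
have sub f : smooth setT f -> smooth V f by exact: smooth_sub.
have sab : smooth V (fun Q => a Q * b Q) by exact: smoothM.
have sSt : smooth V (fun Q => - dt S Q) by apply: smoothN => //; exact/sub/smooth_dt.
rewrite big_ord_recl (_ : transport_field a ord0 = fun Q => a Q * b Q * sqgradx Q);
  last by apply/funext => Q; exact: transport_field0.
rewrite (partialM _ sab (sub _ smooth_sqgradx) VP) (partialM _ sa sb VP).
under eq_bigr => j _.
  rewrite (_ : transport_field a (lift ord0 j) =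
      fun Q => a Q * b Q * (- dt S Q * dx j S Q)); last first.
    by apply/funext => Q; exact: transport_fieldS.
  rewrite (partialM _ sab (smoothM oV sSt (sub _ (smooth_dx j))) VP).
  rewrite (partialM _ sa sb VP) (partialM _ sSt (sub _ (smooth_dx j)) VP).
  rewrite (partialN _ (sub _ smooth_dt) VP).
  rewrite (_ : partial (lift ord0 j) (dt S) P = partial ord0 (dx j S) P); last first.
    exact: schwarz openT sS _.
  over.
rewrite sum_ddx_nu// enormE// /ddt /dnu.
rewrite (_ : dot (nu S P) (gradx a P) = b P * \sum_j dx j S P * dx j a P); last first.
  by rewrite mulr_sumr; apply: eq_bigr => j _; rewrite nuE mxE mulrA.
pose A1 := \sum_j dx j S P * dx j a P.
pose A2 := \sum_j partial (lift ord0 j) b P * dx j S P.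
pose A3 := \sum_j dx j (dx j S) P.
pose A4 := \sum_j dx j S P * partial ord0 (dx j S) P.
rewrite [X in _ + X = _](_ : _ = - (b P * dt S P * A1) - a P * dt S P * A2
   - a P * b P * A4 - a P * b P * dt S P * A3); last first.
  rewrite /A1 /A2 /A3 /A4 !mulr_sumr -!sumrN -!big_split.
  apply: eq_bigr => j _; rewrite -/(dx j a P) -/(dx j (dx j S) P) -/(dx j b P).
  move: (dx j a P) (dx j b P) (dx j S P) (dx j (dx j S) P) (partial _ (dx j S) P).
  move: (a P) (b P) (dt S P) => a0 b0 st aj bj sj sjj stj.
  by rewrite /=; ring.
rewrite big_split/= -mulr_sumr -/A1 -/A2 -/A3 partial_b// partial_sqgradx -/A4 GE.
have := b2q rP; rewrite -/(dt a P) -![rsqrt (sqgradx P)]/(b P).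
move: (dt a P) (dt S P) (a P) (b P) (sqgradx P) => at_ st a0 b0 q0 bq.
transitivity (at_ * b0 * q0 - b0 * st * A1 - a0 * st * A2 - a0 * b0 * st * A3 +
  a0 * b0 * A4 * (1 - b0 * b0 * q0)).
  by field.
rewrite bq subrr mulr0 addr0.
transitivity (at_ * b0 * q0 - (b0 * b0 * q0) * (b0 * st * A1) -
   (b0 * b0 * q0) * (a0 * st * A2) - (b0 * b0 * q0) * (a0 * b0 * st * A3)).
  by rewrite bq !mul1r.
by ring.
Qed.

End nondegenerate.

End front_calculus.

(** * Delta-derivatives and the equivalent forms *)

Section delta_derivatives.
Context (R : realType) (n : nat) (S : 'rV[R]_n.+1 -> R).
Notation point := 'rV[R]_n.+1.
Hypothesis S_front : moving_front S.
Context (Omega : set point).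
Hypotheses (Omega_open : open Omega) (Omega_upper : Omega `<=` @upper_half_space R n).

Let M := Gamma S `&` Omega.
Let sS : smooth [set: point] S := S_front.1.

Lemma front_regular P : Gamma S P -> regular S P.
Proof. by move=> /S_front.2; exact: dot_gt0. Qed.

Lemma extensionP a : smooth_on_front M a -> smooth_extension M a (extension M a).
Proof. by move=> sa; exact: xgetPex sa. Qed.

Lemma smooth_extension_front a at_ : smooth_extension M a at_ -> smooth_on_front M a.
Proof. by exists at_. Qed.

(** The difference of two extensions vanishes on the front, hence so do its
    tangential derivatives: the delta-derivatives do not depend on the
    extension. *)
Lemma smooth_extension_tangent a f g P v :
  smooth_extension M a f -> smooth_extension M a g -> M P ->
  dot v (grad S P) = 0 -> dot v (grad f P) = dot v (grad g P).
Proof.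
move=> [V [oV MV sf fa]] [W [oW MW sg ga]] MP v0.
pose X := V `&` W `&` Omega.
have oX : open X by apply: openI => //; exact: openI.
have XP : X P by split; [split; [exact: MV|exact: MW]|exact: MP.2].
have sfX : smooth X f by apply: smooth_sub sf => Q [[]].
have sgX : smooth X g by apply: smooth_sub sg => Q [[]].
have gS0 : grad S P != 0.
  apply/eqP => gS; have := front_regular MP.1.
  rewrite /regular/= /sqgradx (_ : gradx S P = 0); last first.
    by apply/rowP => j; have /rowP/(_ (lift ord0 j)) := gS; rewrite !mxE.
  by rewrite /dot big1 ?ltxx// => j _; rewrite mxE mul0r.
apply/eqP; rewrite -subr_eq0 dotC [dot v _]dotC -dotBl dotC; apply/eqP.
rewrite -(gradB oX sfX sgX XP).
apply: (@tangent_derivative0 _ _ X S _ P v) => //.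
- exact: smooth_sub (@subsetT _ X) sS 1%N.
- apply: (smoothD oX sfX (smoothN oX sgX) 1%N).
- exact: MP.1.2.
- move=> Q [[VQ WQ] OQ] SQ; have MQ : M Q.
    by split=> //; split=> //; exact/ltW/Omega_upper.
  by rewrite fa// ga// subrr.
Qed.

Lemma delta_tE a at_ P : smooth_extension M a at_ -> M P ->
  delta_t S M a P = ddt S at_ P.
Proof.
move=> ea MP; rewrite /delta_t !ddtE.
apply: (smooth_extension_tangent (extensionP (smooth_extension_front ea)) ea MP).
exact/ddt_level/front_regular/MP.1.
Qed.

Lemma delta_xE a at_ j P : smooth_extension M a at_ -> M P ->
  delta_x S M j a P = ddx S j at_ P.
Proof.
move=> ea MP; rewrite /delta_x !ddxE.
apply: (smooth_extension_tangent (extensionP (smooth_extension_front ea)) ea MP).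
exact/ddx_level/front_regular/MP.1.
Qed.

Lemma smooth_extension_mul a at_ f : smooth_extension M a at_ ->
  smooth (regular S) f ->
  smooth_extension M (fun Q => a Q * f Q) (fun Q => at_ Q * f Q).
Proof.
move=> [V [oV MV sa aE]] sf; exists (V `&` regular S).
have oVr : open (V `&` regular S) by apply: openI => //; exact: open_regular.
split=> //.
- by move=> P MP; split; [exact: MV|exact/front_regular/MP.1].
- apply: smoothM => //; first by apply: smooth_sub sa => Q [].
  by apply: smooth_sub sf => Q [].
- by move=> P MP; rewrite aE.
Qed.

Lemma smooth_extension_regular f : smooth (regular S) f -> smooth_extension M f f.
Proof.
move=> sf; exists (regular S); split=> //; first exact: open_regular.
by move=> P [/front_regular].
Qed.

Lemma tangent_div_nuE P : M P ->
  tangent_div S M (nu S) P = \sum_j ddx S j (fun Q => nu S Q 0 j) P.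
Proof.
move=> MP; apply: eq_bigr => j _; apply: delta_xE => //.
exact/smooth_extension_regular/smooth_nu.
Qed.

(** In the product rule for [a G nu] the derivatives of [a G] do not
    contribute, since the tangential gradient is orthogonal to [nu]. *)
Lemma tangent_div_velocity a P : smooth_on_front M a -> M P ->
  tangent_div S M (fun Q => a Q *: Udelta S Q) P =
  a P * G S P * tangent_div S M (nu S) P.
Proof.
move=> [at_ ea] MP; rewrite tangent_div_nuE//.
have rP := front_regular MP.1.
have [V [oV MV saG aGE]] := smooth_extension_mul ea (smooth_G sS).
have Xr : V `&` regular S `<=` regular S by move=> Q [].
have sX : smooth (V `&` regular S) (fun Q => at_ Q * G S Q).
  by apply: smooth_sub saG => Q [].
transitivity (\sum_j ddx S j (fun Q => (at_ Q * G S Q) * nu S Q 0 j) P).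
  apply: eq_bigr => j _; apply: delta_xE => //.
  have [W [oW MW sW WE]] := smooth_extension_mul (smooth_extension_mul ea (smooth_G sS))
    (smooth_nu sS j).
  by exists W; split=> // Q MQ; rewrite WE// !mxE mulrA.
under eq_bigr => j _.
  rewrite (ddxM S j sX (smooth_sub Xr (smooth_nu sS j)) (conj (MV _ MP) rP)).
  rewrite mulrC; over.
rewrite big_split/= nu_ddx// add0r mulr_sumr.
by apply: eq_bigr => j _; rewrite aGE.
Qed.

Lemma mean_curvature_velocity a P : smooth_on_front M a -> M P ->
  tangent_div S M (fun Q => a Q *: Udelta S Q) P =
  - (2 * mean_curvature S M P * G S P * a P).
Proof. by move=> sa MP; rewrite tangent_div_velocity// /mean_curvature; field. Qed.

(** The left-hand side of the Rankine-Hugoniot conditions is a divergence in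
    space-time, so the integral over the front in the weak form can be
    integrated by parts. *)
Lemma front_transport V a at_ P : open V -> V `<=` regular S -> smooth V at_ ->
  smooth_extension M a at_ -> M P -> V P ->
  \sum_i partial i (transport_field S at_ i) P = enorm (gradx S P) *
  (delta_t S M a P + tangent_div S M (fun Q => a Q *: Udelta S Q) P).
Proof.
move=> oV Vr sa ea MP VP; rewrite (div_transport_field sS oV Vr sa VP).
rewrite (delta_tE ea MP) (tangent_div_velocity (smooth_extension_front ea) MP).
rewrite tangent_div_nuE//; have [W [_ _ _ ->//]] := ea.
Qed.

Lemma smooth_on_front_velocity a k : smooth_on_front M a ->
  smooth_on_front M (fun Q => a Q * Udelta S Q 0 k).
Proof.
move=> [at_ ea]; eexists; apply: smooth_extension_mul ea _.
exact: smooth_Udelta.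
Qed.

Lemma st_normalE P : Gamma S P -> st_normal S P = (enorm (gradx S P))^-1 *: grad S P.
Proof.
move=> _; rewrite gradE /st_normal; apply/rowP => i; rewrite [RHS]mxE.
have [j ->|->] := unliftP ord0 i; first by rewrite !pt_lift mxE.
by rewrite !pt_ord0 /G mulNr opprK mulrC.
Qed.

Lemma dot_st_normal s v P : Gamma S P ->
  dot (pt s v) (st_normal S P) = dot v (nu S P) - s * dot (Udelta S P) (nu S P).
Proof.
move=> GP; rewrite dot_pt /Udelta dotZl dot_nu_nu; last exact: front_regular.
by rewrite mulr1 mulrN addrC.
Qed.

End delta_derivatives.

Section equivalent_forms.
Context (R : realType) (n : nat) (F : 'rV[R]_n -> 'rV[R]_n) (N : 'rV[R]_n -> 'M[R]_n).
Context (S : 'rV[R]_n.+1 -> R) (Omega : set 'rV[R]_n.+1).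
Hypothesis S_front : moving_front S.
Hypotheses (Omega_open : open Omega) (Omega_upper : Omega `<=` @upper_half_space R n).
Context (e : 'rV[R]_n.+1 -> R) (Um Up : 'rV[R]_n.+1 -> 'rV[R]_n)
  (rm rp : 'rV[R]_n.+1 -> R).
Let M := Gamma S `&` Omega.
Hypothesis e_smooth : smooth_on_front M e.

Lemma RH_equivalent_forms P : M P ->
  st_normal S P = (enorm (gradx S P))^-1 *: grad S P /\
  [/\ RH_mass F S M e Um Up rm rp P <-> RH_mass_velocity F S M e Um Up rm rp P,
      RH_momentum N S M e Um Up rm rp P <->
        RH_momentum_velocity N S M e Um Up rm rp P,
      RH_mass F S M e Um Up rm rp P <->
        RH_mass_curvature F S M e Um Up rm rp P &
      RH_momentum N S M e Um Up rm rp P <->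
        RH_momentum_curvature N S M e Um Up rm rp P].
Proof.
move=> MP; split; first exact: (st_normalE MP.1).
have massE : dot (pt (jump_rho rm rp P) (jump_rhoF F Um Up rm rp P)) (st_normal S P) =
    mass_rhs F S Um Up rm rp P.
  by rewrite (dot_st_normal S_front _ _ MP.1) /mass_rhs [RHS]dotBl [in RHS]dotZl.
have momE k : dot (pt (jump_rhoU Um Up rm rp P 0 k) (row k (jump_rhoN N Um Up rm rp P)))
    (st_normal S P) = momentum_rhs N S Um Up rm rp P k.
  by rewrite (dot_st_normal S_front _ _ MP.1).
have massC : mass_lhs S M e P =
    delta_t S M e P - 2 * mean_curvature S M P * G S P * e P.
  by rewrite /mass_lhs (mean_curvature_velocity S_front).
have momC k : momentum_lhs S M e P k =
    delta_t S M (fun Q => e Q * Udelta S Q 0 k) P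
    - 2 * mean_curvature S M P * G S P * (e P * Udelta S P 0 k).
  rewrite /momentum_lhs (mean_curvature_velocity S_front)//.
  exact: smooth_on_front_velocity.
split.
- by rewrite /RH_mass massE.
- by split=> H k; move: (H k); rewrite momE.
- by rewrite /RH_mass massE massC.
- by split=> H k; move: (H k); rewrite momE momC.
Qed.

End equivalent_forms.

(** * The front as a graph *)

Section insert_coord.
Context (R : realType) (n : nat) (J : 'I_n.+1).
Implicit Types (s t : R) (y h : 'rV[R]_n) (Q : 'rV[R]_n.+1).

Notation ins := (@insert_coord R n.+1 J).

Lemma insert_coordJ s y : ins s y 0 J = s.
Proof. by rewrite mxE unlift_none. Qed.

Lemma insert_coord_lift s y k : ins s y 0 (lift J k) = y 0 k.
Proof. by rewrite mxE liftK. Qed.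

Lemma rowJP Q Q' : Q 0 J = Q' 0 J ->
  (forall k, Q 0 (lift J k) = Q' 0 (lift J k)) -> Q = Q'.
Proof.
by move=> EJ E; apply/rowP => i; have [k ->|->] := unliftP J i.
Qed.

Lemma insert_coord_eta Q : ins (Q 0 J) (col' J Q) = Q.
Proof.
by apply: rowJP => [|k]; rewrite ?insert_coordJ// insert_coord_lift mxE.
Qed.

Lemma col'_insert_coord s y : col' J (ins s y) = y.
Proof. by apply/rowP => k; rewrite mxE insert_coord_lift. Qed.

Lemma insert_coordB s t y h : ins s y - ins t h = ins (s - t) (y - h).
Proof.
by apply: rowJP => [|k]; rewrite !(mxE, insert_coordJ, insert_coord_lift) ?unlift_none ?liftK// !mxE.
Qed.

Lemma insert_coordD s t y h : ins s y + ins t h = ins (s + t) (y + h).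
Proof.
apply: rowJP => [|k]; first by rewrite mxE !insert_coordJ.
by rewrite mxE !insert_coord_lift mxE.
Qed.

Lemma insert_coord_eJ s y t : ins (s + t) y = ins s y + t *: delta_mx 0 J.
Proof.
apply: rowJP => [|k]; rewrite [RHS]mxE ?insert_coordJ ?insert_coord_lift.
  by rewrite !mxE !eqxx mulr1.
by rewrite !mxE eqxx/= eq_sym (negPf (neq_lift _ _)) mulr0 addr0.
Qed.

Lemma dot_insert_coord s y Q : dot (ins s y) Q = s * Q 0 J + dot y (col' J Q).
Proof.
rewrite /dot (bigD1_ord J)//= insert_coordJ; congr (_ + _).
by apply: eq_bigr => k _; rewrite insert_coord_lift mxE.
Qed.

Lemma norm_insert_coord s y (r : R) : `|ins s y| < r <-> `|s| < r /\ `|y| < r.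
Proof.
split=> [Qr|[sr yr]].
  split; first by apply: le_lt_trans Qr; rewrite -{1}(insert_coordJ s y) normr_coord.
  apply: le_lt_trans Qr; apply: normr_rV_le => // k.
  by rewrite -(insert_coord_lift s) normr_coord.
rewrite (@le_lt_trans _ _ (Num.max `|s| `|y|))// ?gt_max ?sr//.
apply: normr_rV_le; first by rewrite le_max normr_ge0.
move=> i; have [k ->|->] := unliftP J i; rewrite ?insert_coordJ ?insert_coord_lift le_max.
  by rewrite normr_coord orbT.
by rewrite lexx.
Qed.

Lemma norm_insert_coord_le s y : `|ins s y| <= `|s| + `|y|.
Proof.
apply: normr_rV_le; first by rewrite addr_ge0.
move=> i; have [k ->|->] := unliftP J i; rewrite ?insert_coordJ ?insert_coord_lift.
  by rewrite ler_wpDl// normr_coord.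
by rewrite lerDl.
Qed.

Lemma insert_coord_continuous (T : topologicalType) (f : T -> R)
    (g : T -> 'rV[R]_n) x :
  {for x, continuous f} -> {for x, continuous g} ->
  {for x, continuous (fun z => ins (f z) (g z))}.
Proof.
move=> /cvgrPdist_lt cf /cvgrPdist_lt cg; apply/cvgrPdist_lt => r r0.
apply: filterS (filterI (cf r r0) (cg r r0)) => z [fz gz].
by rewrite insert_coordB; exact/norm_insert_coord.
Qed.

Lemma id_continuous_for (T : topologicalType) (x : T) : {for x, continuous (@id T)}.
Proof. by []. Qed.

Lemma cst_continuous_for (T U : topologicalType) (x : T) (c : U) :
  {for x, continuous (fun=> c)}.
Proof. exact: cst_continuous. Qed.

Lemma insert_coord_continuousr s : continuous (fun y => ins s y).
Proof.
move=> y; exact: (@insert_coord_continuous 'rV[R]_n (fun=> s) id y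
  (@cst_continuous_for _ _ y s) (@id_continuous_for _ y)).
Qed.

Lemma insert_coord_continuousl y : continuous (fun s => ins s y).
Proof.
move=> s; exact: (@insert_coord_continuous R id (fun=> y) s
  (@id_continuous_for _ s) (@cst_continuous_for _ _ s y)).
Qed.

End insert_coord.

Section implicit_function.
Context (R : realType) (n : nat) (J : 'I_n.+1).
Implicit Types (S f : 'rV[R]_n.+1 -> R) (P Q : 'rV[R]_n.+1) (y h : 'rV[R]_n)
  (g : 'rV[R]_n -> R).

Notation ins := (@insert_coord R n.+1 J).

Lemma dot_le m (u v : 'rV[R]_m) : `|dot u v| <= (\sum_i `|v 0 i|) * `|u|.
Proof.
rewrite (le_trans (ler_norm_sum _ _ _))// mulr_suml ler_sum// => i _.
by rewrite normrM mulrC ler_wpM2l// normr_coord.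
Qed.

Lemma is_derive_insert S s y : derivable S (ins s y) (delta_mx 0 J) ->
  is_derive s (1 : R) (fun s => S (ins s y)) (partial J S (ins s y)).
Proof.
move=> dS; have E (t : R) : ins t y = ins 0 y + t *: delta_mx 0 J.
  by rewrite -insert_coord_eJ add0r.
under eq_fun do rewrite E.
by apply: is_derive_line; rewrite -E; exact: DeriveDef.
Qed.

(** The mean value theorem along the [J]-axis. The bound on the derivative is
    assumed in the cube of radius [3 rho] because it contains the segments
    from [ins t y] of length less than [2 rho]. *)
Lemma insert_growth S (sg c : R) (P : 'rV[R]_n.+1) (rho s t : R) y :
  (forall Q, `|Q - P| < 3 * rho -> derivable S Q (delta_mx 0 J) /\
    c <= sg * partial J S Q) ->
  `|y - col' J P| < rho -> `|s - P 0 J| < rho -> `|t - P 0 J| < rho ->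
  c * (s - t) ^+ 2 <= sg * (S (ins s y) - S (ins t y)) * (s - t).
Proof.
move=> HQ yr sr tr.
have inQ (x : R) : `|x| <= `|s - t| -> `|ins (t + x) y - P| < 3 * rho.
  rewrite -[P](insert_coord_eta J) insert_coordB => xs.
  apply/norm_insert_coord; split; last first.
    by rewrite (lt_le_trans yr)// ler_peMl ?ler1n//; exact/ltW/(le_lt_trans _ yr).
  have : `|s - t| < 2 * rho.
    rewrite -(subrKA (P 0 J)) (le_lt_trans (ler_normD _ _))// mulr_natl mulr2n.
    by rewrite ltrD// distrC.
  move=> /(le_lt_trans xs); move: tr; clear; rewrite !ltr_norml.
  by move=> /andP[? ?] /andP[? ?]; apply/andP; split; lra.
have [x|x xs] := @MVT0 R (fun x => S (ins (t + x) y))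
    (fun x => partial J S (ins (t + x) y)) (s - t).
  move=> xs; under eq_fun do rewrite insert_coord_eJ.
  rewrite insert_coord_eJ; apply: is_derive_line; rewrite -insert_coord_eJ.
  by apply: DeriveDef => //; have [] := HQ _ (inQ _ xs).
rewrite addr0 subrKC => ->; rewrite mulrA -mulrA -expr2 ler_wpM2r ?sqr_ge0//.
by have [] := HQ _ (inQ _ xs).
Qed.

(** A parametrisation of the zero set of [S] near [P] as a graph
    [x_J = g(y)] over a cube of radius [r], inside a cube of radius [rho] where
    [d_J S] has the sign [sg]. The growth condition makes [|S|] comparable to
    the distance to the graph along the [J]-axis. *)
Record graph_chart S P (sg c rho r : R) g : Prop := GraphChart {
  chart_sg : `|sg| = 1;
  chart_c : 0 < c;
  chart_r : 0 < r;
  chart_rho : r <= rho;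
  chart_partial : forall Q, `|Q - P| < rho -> c <= sg * partial J S Q;
  chart_growth : forall y s t, `|y - col' J P| < r ->
    `|s - P 0 J| < rho -> `|t - P 0 J| < rho ->
    c * (s - t) ^+ 2 <= sg * (S (ins s y) - S (ins t y)) * (s - t);
  chart_graph : forall y, `|y - col' J P| < r ->
    `|g y - P 0 J| < rho / 2 /\ S (ins (g y) y) = 0
}.

(** On a line parallel to the [J]-axis through a point close to [P], the
    growth condition forces [S] to take both signs near [P_J]; the zero is
    given by the intermediate value theorem. *)
Lemma zero_set_graph S (N : set 'rV[R]_n.+1) P (sg : R) :
  smooth setT S -> S P = 0 -> `|sg| = 1 -> 0 < sg * partial J S P -> open N -> N P ->
  exists rho r c g, graph_chart S P sg c rho r g /\ forall Q, `|Q - P| < rho -> N Q.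
Proof.
move=> sS SP sg1 dSP oN NP.
pose c := sg * partial J S P / 2.
have c0 : 0 < c by rewrite divr_gt0.
have nearP : \forall Q \near P, N Q /\ c <= sg * partial J S Q.
  apply: filterI; first exact: open_nbhs_nbhs.
  have /cvgrPdist_lt/(_ c c0) := @smooth_continuous _ _ _ _ P
    (smoothZ sg openT (smooth_partial J sS)) I. apply: filterS => Q.
  by rewrite /c; set u := sg * _; set v := sg * _; rewrite ltr_norml => /andP[_ ?]; lra.
have [rho3 rho30 rho3P] := near_norm nearP.
pose rho := rho3 / 3.
have rho0 : 0 < rho by rewrite divr_gt0.
have rho3E : 3 * rho = rho3 by rewrite /rho mulrC divfK.
have growth y s t : `|y - col' J P| < rho -> `|s - P 0 J| < rho -> `|t - P 0 J| < rho ->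
    c * (s - t) ^+ 2 <= sg * (S (ins s y) - S (ins t y)) * (s - t).
  apply: insert_growth => Q; rewrite rho3E => /rho3P[_ ?]; split=> //.
  exact: smooth_derivable sS _.
have csS Q : {for Q, continuous (fun Q => sg * S Q)}.
  exact: smooth_continuous (smoothZ sg openT sS) I.
have cSy : {for col' J P, continuous (fun y => sg * S (ins (P 0 J) y))}.
  apply: (@continuous_comp _ _ _ (fun y => ins (P 0 J) y) (fun Q => sg * S Q)).
    exact: insert_coord_continuousr.
  exact: csS.
have [r1 r10 r1P] : exists2 r : R, 0 < r & forall y, `|y - col' J P| < r ->
    `|sg * S (ins (P 0 J) y)| < c * (rho / 2).
  apply: near_norm; have /cvgrPdist_lt/(_ (c * (rho / 2))) := cSy.
  rewrite insert_coord_eta SP mulr0 mulr_gt0 ?divr_gt0// => /(_ isT).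
  by apply: filterS => y; rewrite sub0r normrN.
pose r := Num.min r1 rho.
have r0 : 0 < r by rewrite lt_min r10.
have zero y : exists s, `|y - col' J P| < r -> `|s - P 0 J| < rho / 2 /\ S (ins s y) = 0.
  have [yr|yr] := ltP `|y - col' J P| r; last by exists 0.
  have yrho : `|y - col' J P| < rho by apply: lt_le_trans yr _; rewrite ge_min lexx orbT.
  have Sp : `|sg * S (ins (P 0 J) y)| < c * (rho / 2).
    by apply: r1P; apply: lt_le_trans yr _; rewrite ge_min lexx.
  pose phi s := sg * S (ins s y).
  have gr s t : `|s - P 0 J| < rho -> `|t - P 0 J| < rho ->
      c * (s - t) ^+ 2 <= (phi s - phi t) * (s - t).
    by move=> sr tr; rewrite /phi -mulrBr; exact: growth.
  have p0 : `|P 0 J - P 0 J| < rho by rewrite subrr normr0.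
  have r20 : 0 < rho / 2 by rewrite divr_gt0.
  have rh : rho / 2 < rho by rewrite ltr_pdivrMr// ltr_pMr// ltr1n.
  have up : 0 < phi (P 0 J + rho / 2).
    have E : P 0 J + rho / 2 - P 0 J = rho / 2 by rewrite addrAC subrr add0r.
    have := gr (P 0 J + rho / 2) (P 0 J); rewrite E (gtr0_norm r20) => /(_ rh p0).
    rewrite expr2 [c * _]mulrA (ler_pM2r r20) => H.
    by move: Sp H; rewrite -/(phi (P 0 J)) ltr_norml => /andP[+ _]; clear; lra.
  have dn : phi (P 0 J - rho / 2) < 0.
    have E : P 0 J - rho / 2 - P 0 J = - (rho / 2) by rewrite addrAC subrr add0r.
    have := gr (P 0 J - rho / 2) (P 0 J); rewrite E normrN (gtr0_norm r20) => /(_ rh p0).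
    rewrite sqrrN mulrN -mulNr expr2 [c * _]mulrA (ler_pM2r r20) => H.
    by move: Sp H; rewrite -/(phi (P 0 J)) ltr_norml => /andP[_ +]; clear; lra.
  have [|||s] := @IVT R phi (P 0 J - rho / 2) (P 0 J + rho / 2) 0.
  - by rewrite lerD2l ge0_cp// ltW.
  - apply: continuous_in_subspaceT => s _.
    apply: (@continuous_comp _ _ _ (fun s => ins s y) (fun Q => sg * S Q)).
      exact: insert_coord_continuousl.
    exact: csS.
  - by rewrite ge_min le_max (ltW up) (ltW dn) orbT.
  rewrite in_itv/= => /andP[s1 s2] phis.
  have sr : `|s - P 0 J| < rho.
    by rewrite (le_lt_trans _ rh)// ler_distl s1 s2.
  exists s => _; split; last first.
    have sg0 : sg != 0 by apply: contraTneq dSP => ->; rewrite mul0r ltxx.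
    by move/eqP: phis; rewrite mulf_eq0 (negPf sg0) => /eqP.
  have [->|sp] := eqVneq s (P 0 J); first by rewrite subrr normr0.
  have sp0 : 0 < `|s - P 0 J| by rewrite normr_gt0 subr_eq0.
  have := gr s (P 0 J) sr p0; rewrite phis sub0r => le1.
  have : c * `|s - P 0 J| ^+ 2 < c * (rho / 2) * `|s - P 0 J|.
    rewrite real_normK ?num_real// (le_lt_trans le1)// (le_lt_trans (ler_norm _))//.
    by rewrite normrM normrN ltr_pM2r.
  by rewrite expr2 -[c * (rho / 2) * _]mulrA (ltr_pM2l c0) (ltr_pM2r sp0).
have [g gP] := choice zero.
have inN Q : `|Q - P| < rho -> N Q /\ c <= sg * partial J S Q.
  by move=> QP; apply: rho3P; rewrite (lt_le_trans QP)// -rho3E ler_peMl ?ler1n// ltW.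
exists rho, r, c, g; split; last by move=> Q /inN[].
split=> //; first by rewrite ge_min lexx orbT.
  by move=> Q /inN[].
move=> y s t yr; apply: growth; apply: lt_le_trans yr _.
by rewrite ge_min lexx orbT.
Qed.

(** For [f = S] this gives the derivative of the implicit function [g], and
    for other [f] the chain rule along its graph. The Lipschitz bound on [g]
    absorbs the error of the linear expansion of [f]. *)
Lemma graph_expansion V f g y (L : R) : open V -> Ck 1 V f -> V (ins (g y) y) ->
  0 < L -> (\forall h \near (0 : 'rV[R]_n), `|g (y + h) - g y| <= L * `|h|) ->
  forall eps : R, 0 < eps -> \forall h \near (0 : 'rV[R]_n),
    `|f (ins (g (y + h)) (y + h)) - f (ins (g y) y) -
      ((g (y + h) - g y) * partial J f (ins (g y) y) +
       dot h (col' J (grad f (ins (g y) y))))| <= eps * `|h|.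
Proof.
move=> oV Cf Vy L0 gL eps eps0.
have e0 : 0 < eps / (L + 1) by rewrite divr_gt0// addr_gt0.
have [d d0 dP] := near_norm (Ck1_expansion oV Cf Vy e0).
have [d' d'0 d'P] := near_norm gL.
apply: (@norm_near _ _ _ _ (Num.min d' (d / (L + 1)))).
  by rewrite lt_min d'0 divr_gt0// addr_gt0.
move=> h; rewrite subr0 lt_min => /andP[hd' hd].
have gh : `|g (y + h) - g y| <= L * `|h| by apply: d'P; rewrite subr0.
pose k := ins (g (y + h) - g y) h.
have kh : `|k| <= (L + 1) * `|h|.
  by rewrite (le_trans (norm_insert_coord_le _ _ _))// mulrDl mul1r lerD2r.
have := dP k; rewrite subr0 => /(_ _)/le_trans.
have -> : ins (g y) y + k = ins (g (y + h)) (y + h).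
  by rewrite insert_coordD; congr ins; rewrite addrCA subrr addr0.
rewrite dot_insert_coord [grad f _ 0 J]mxE; apply.
  by rewrite (le_lt_trans kh)// mulrC -ltr_pdivlMr// addr_gt0.
by rewrite -mulrA ler_pM2l// ler_pdivrMl// addr_gt0.
Qed.

Lemma diff_lip m (g : 'rV[R]_m -> R) (y w : 'rV[R]_m) :
  (forall eps : R, 0 < eps -> \forall h \near (0 : 'rV[R]_m),
    `|g (y + h) - g y - dot h w| <= eps * `|h|) ->
  \forall h \near (0 : 'rV[R]_m),
    `|g (y + h) - g y| <= (1 + \sum_i `|w 0 i|) * `|h|.
Proof.
move=> /(_ 1 ltr01); apply: filterS => h gh.
rewrite -[g (y + h) - g y](subrK (dot h w)) (le_trans (ler_normD _ _))//.
by rewrite mulrDl lerD// dot_le.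
Qed.

Lemma graph_chain V W f g y : open V -> Ck 1 V f -> open W -> Ck 1 W g ->
  V (ins (g y) y) -> W y ->
  differentiable (fun y => f (ins (g y) y)) y /\
  forall k, partial k (fun y => f (ins (g y) y)) y =
    partial (lift J k) f (ins (g y) y) + partial J f (ins (g y) y) * partial k g y.
Proof.
move=> oV Cf oW Cg Vy Wy.
have eg := Ck1_expansion oW Cg Wy.
pose fJ := partial J f (ins (g y) y).
pose fy := col' J (grad f (ins (g y) y)).
have [|df dfE] := @diff_dot _ _ (fun y => f (ins (g y) y)) y (fy + fJ *: grad g y).
  move=> eps eps0.
  have f0 : 0 < 2 * (1 + `|fJ|) by rewrite mulr_gt0// addr_gt0// ltr_pwDl.
  have f1 : 0 < 1 + `|fJ| by rewrite ltr_pwDl.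
  have L0 : 0 < 1 + \sum_i `|grad g y 0 i| by rewrite ltr_pwDl// sumr_ge0.
  have e1 : 0 < eps / 2 by rewrite divr_gt0.
  have e2 : 0 < eps / (2 * (1 + `|fJ|)) by rewrite divr_gt0.
  apply: filterS (filterI (graph_expansion oV Cf Vy L0 (diff_lip eg) e1) (eg _ e2)).
  move=> h [H1 H2].
  rewrite dotC dotDl [dot _ h]dotC dotZl [dot _ h]dotC.
  set D1 := f _ - _ in H1 *; set D2 := g _ - _ in H1 H2 *.
  have -> : D1 - (dot h fy + fJ * dot h (grad g y)) =
    (D1 - (D2 * fJ + dot h fy)) + fJ * (D2 - dot h (grad g y)) by ring.
  have -> : eps * `|h| = eps / 2 * `|h| + eps / 2 * `|h| by rewrite -mulrDl -splitr.
  apply: (le_trans (ler_normD _ _)); apply: lerD; first exact: H1.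
  rewrite normrM.
  rewrite (@le_trans _ _ (`|fJ| * (eps / (2 * (1 + `|fJ|)) * `|h|)))// ?ler_wpM2l//.
  have -> : `|fJ| * (eps / (2 * (1 + `|fJ|)) * `|h|) =
      eps / 2 * `|h| * (`|fJ| / (1 + `|fJ|)) by field; rewrite gt_eqF.
  by rewrite ler_piMr ?mulr_ge0 ?(ltW eps0)// ler_pdivrMr// mul1r lerDr.
split=> // k; rewrite /partial deriveE// dfE dotC dot_e !mxE.
by rewrite /partial.
Qed.

Section zero_set.
Context (S : 'rV[R]_n.+1 -> R) (g : 'rV[R]_n -> R) (sg c rho r : R) (P : 'rV[R]_n.+1).
Hypotheses (sS : smooth setT S) (ch : graph_chart S P sg c rho r g).
Let c0 := chart_c ch.
Let rrho := chart_rho ch.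
Let dS := chart_partial ch.
Let growth := chart_growth ch.
Let gP := chart_graph ch.

Let W := [set y | `|y - col' J P| < r].

Lemma open_norm_ball m (x : 'rV[R]_m) (d : R) : open [set y | `|y - x| < d].
Proof.
rewrite (_ : [set y | _] = ball x d); first exact: ball_open.
by apply/seteqP; split=> y; rewrite -ball_normE/= distrC.
Qed.

Lemma graph_in_cube y : W y -> `|ins (g y) y - P| < rho.
Proof.
move=> Wy; have [gy _] := gP Wy.
rewrite -[P](insert_coord_eta J) insert_coordB; apply/norm_insert_coord.
split; last exact: lt_le_trans Wy rrho.
rewrite (lt_le_trans gy)// ler_pdivrMr// ler_peMr ?ler1n//.
by have := le_lt_trans (normr_ge0 _) gy; rewrite pmulr_lgt0// => /ltW.
Qed.

Let gP1 y : W y -> `|g y - P 0 J| < rho.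
Proof.
move=> /graph_in_cube; rewrite -{1}[P](insert_coord_eta J) insert_coordB.
by move/norm_insert_coord => [].
Qed.

Let dSn0 y : W y -> partial J S (ins (g y) y) != 0.
Proof.
move=> /graph_in_cube/dS; apply: contraTneq => ->.
by rewrite mulr0 -ltNge.
Qed.

(** As [S] vanishes at both points of the graph, the growth condition bounds
    the increment of [g] by the increment of [S] in the other variables. *)
Lemma graph_lip y : W y -> exists2 L : R, 0 < L &
  \forall h \near (0 : 'rV[R]_n), `|g (y + h) - g y| <= L * `|h|.
Proof.
move=> Wy; pose Q := ins (g y) y.
have C1S : Ck 1 setT S := sS 1.
have eS := Ck1_expansion openT C1S (I : [set: 'rV[R]_n.+1] Q).
have [d d0 dP] := near_norm (diff_lip eS).
pose B := 1 + \sum_i `|grad S Q 0 i|.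
have B0 : 0 < B by rewrite ltr_pwDl// sumr_ge0.
have [d' d'0 d'P] : exists2 d : R, 0 < d & forall z, `|z - y| < d -> W z.
  by apply: near_norm; apply: open_nbhs_nbhs; split=> //; exact: open_norm_ball.
exists ((1 + `|sg|) * B / c); first by rewrite divr_gt0// mulr_gt0// ltr_pwDl.
apply: (@norm_near _ _ _ _ (Num.min d d')); first by rewrite lt_min d0.
move=> h; rewrite subr0 lt_min => /andP[hd hd'].
have Wh : W (y + h) by apply: d'P; rewrite [y + h]addrC addrK.
have [->|gyh] := eqVneq (g (y + h)) (g y).
  by rewrite subrr normr0 mulr_ge0// ltW// divr_gt0// mulr_gt0// ltr_pwDl.
have D0 : 0 < `|g (y + h) - g y| by rewrite normr_gt0 subr_eq0.
have := growth Wh (gP1 Wy) (gP1 Wh); rewrite (gP Wh).2 subr0 => H.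
have {}H : c * `|g (y + h) - g y| <= `|sg| * `|S (ins (g y) (y + h))|.
  rewrite -(ler_pM2r D0) -mulrA -expr2 distrC real_normK ?num_real//.
  by rewrite (le_trans H)// (le_trans (ler_norm _))// !normrM.
have n0h : `|ins 0 h - 0| < d by rewrite subr0; apply/norm_insert_coord; rewrite normr0.
have := dP _ n0h; rewrite insert_coordD addr0 (gP Wy).2 subr0 -/B => H'.
rewrite mulrAC ler_pdivlMr// mulrC (le_trans H)//.
rewrite -mulrA ler_pM// ?lerDr//; apply: (le_trans H'); rewrite ler_pM2l//.
by rewrite (le_trans (norm_insert_coord_le _ _ _))// normr0 add0r.
Qed.

(** The expansion of [S] along its own zero set, solved for the increment of
    [g]. *)
Lemma graph_diff y : W y -> differentiable g y /\ forall k,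
  partial k g y = - partial (lift J k) S (ins (g y) y) / partial J S (ins (g y) y).
Proof.
move=> Wy; have [L L0 gL] := graph_lip Wy.
pose SJ := partial J S (ins (g y) y).
have SJ0 : 0 < `|SJ| by rewrite normr_gt0; exact: dSn0.
pose Sy := col' J (grad S (ins (g y) y)).
have nW : \forall h \near (0 : 'rV[R]_n), W (y + h).
  have [d d0 dP] : exists2 d : R, 0 < d & forall z, `|z - y| < d -> W z.
    by apply: near_norm; apply: open_nbhs_nbhs; split=> //; exact: open_norm_ball.
  by apply: (norm_near d0) => h; rewrite subr0 => hd; apply: dP; rewrite [y + h]addrC addrK.
have [|dg dgE] := @diff_dot _ _ g y (- SJ^-1 *: Sy).
  move=> eps eps0; have e0 : 0 < eps * `|SJ| by rewrite mulr_gt0.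
  apply: filterS (filterI nW
    (graph_expansion openT (sS 1) (I : setT (ins (g y) y)) L0 gL e0)) => h [Wh].
  rewrite (gP Wh).2 (gP Wy).2 subrr sub0r normrN -/SJ -/Sy.
  rewrite mulrAC -ler_pdivrMr// -normfV -normrM [dot h (_ *: _)]dotC dotZl dotC.
  by rewrite mulrDl mulfK ?dSn0// mulNr opprK [SJ^-1 * _]mulrC.
split=> // k; rewrite /partial deriveE// dgE dotC dot_e !mxE -/SJ.
by rewrite mulrC mulrN mulNr.
Qed.

Lemma graph_continuous y : W y -> {for y, continuous (fun y => ins (g y) y)}.
Proof.
move=> Wy; apply: insert_coord_continuous; last exact: id_continuous_for.
by have [dg _] := graph_diff Wy; exact: differentiable_continuous.
Qed.

Lemma graph_Ck1 : Ck 1 W g.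
Proof.
split=> [y Wy|k]; first by have [dg _] := graph_diff Wy; exact: differentiable_continuous.
split=> [y Wy|]; first by have [dg _] := graph_diff Wy; exact: diff_derivable.
apply: (@Ck_eq _ _ 0 W (fun y => - partial (lift J k) S (ins (g y) y) /
    partial J S (ins (g y) y))); first exact: open_norm_ball.
  by move=> y Wy; have [_ ->] := graph_diff Wy.
split=> // y Wy.
have c1 i : {for y, continuous (fun y => partial i S (ins (g y) y))}.
  apply: (@continuous_comp _ _ _ (fun y => ins (g y) y) (partial i S)).
    exact: graph_continuous.
  exact: smooth_continuous (smooth_partial i sS) I.
apply: continuousM; first exact/continuousN/c1.
by apply: continuousV; [exact: dSn0|exact: c1].
Qed.

End zero_set.

End implicit_function.

(** * Lebesgue measure and Fubini's theorem *)

Section borel_rV.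
Context (R : realType) (m : nat).
Implicit Types (V A : set 'rV[R]_m) (f : 'rV[R]_m -> R).

Lemma measurable_cube (q : 'rV[R]_m) (r : R) : 0 < r ->
  measurable [set x : 'rV[R]_m | `|x - q| < r].
Proof.
move=> r0.
rewrite (_ : [set x | _] = \bigcap_(i in [set: 'I_m])
    [set x : 'rV[R]_m | x 0 i \in `]q 0 i - r, q 0 i + r[]).
  apply: fin_bigcap_measurable; first exact: finite_finset.
  move=> i _; rewrite -[X in measurable X]setTI.
  apply: (@measurable_rV_coord R m i measurableT `]q 0 i - r, q 0 i + r[%classic).
  exact: measurable_itv.
apply/seteqP; split=> [x /= xq i _|x /= xq].
  rewrite /= in_itv/= -ltr_distl (le_lt_trans _ xq)//.
  by have := normr_coord (x - q) i; rewrite !mxE.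
rewrite [ltLHS]/Num.Def.normr/= mx_normrE; apply: bigmax_lt => // -[i j] _.
by rewrite ord1 !mxE/= ltr_distl; have := xq j I; rewrite /= in_itv.
Qed.

(** An open set is a countable union of cubes with rational centres and radii. *)
Lemma open_measurable_rV A : open A -> measurable A.
Proof.
move=> oA.
pose D (p : 'rV[rat]_m * nat) : set 'rV[R]_m :=
  [set x | `|x - map_mx ratr p.1| < p.2.+1%:R^-1].
rewrite (_ : A = \bigcup_p (if `[< D p `<=` A >] then D p else set0)).
  apply: countable_bigcupT_measurable; first exact: countableP.
  by move=> p; case: asboolP => // _; apply: measurable_cube; rewrite invr_gt0.
apply/seteqP; split=> [x Ax|x [p _]]; last by case: asboolP => // /[apply].
have [r r0 rA] : exists2 r : R, 0 < r & forall y, `|y - x| < r -> A y.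
  by apply: near_norm; exact: open_nbhs_nbhs.
have [k kr] : exists k, k.+1%:R^-1 < r / 2.
  have r20 : 0 < r / 2 by rewrite divr_gt0.
  have [k _ kr] := near_infty_natSinv_lt (PosNum r20).
  by exists k; exact: (kr k (leqnn k)).
have kp : 0 < k.+1%:R^-1 :> R by rewrite invr_gt0.
have rq i : exists q : rat, `|x 0 i - ratr q| < k.+1%:R^-1.
  have [|q /[!in_itv]/= /andP[q1 q2]] := @rat_in_itvoo R (x 0 i - k.+1%:R^-1) (x 0 i + k.+1%:R^-1).
    by rewrite ltrD2l gt0_cp.
  by exists q; rewrite distrC ltr_distl q1.
have [q qP] := choice rq.
have xD : D (\row_i q i, k) x.
  rewrite /D/= [ltLHS]/Num.Def.normr/= mx_normrE; apply: bigmax_lt => // -[i j] _.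
  by rewrite ord1 !mxE; exact: qP.
exists (\row_i q i, k) => //; case: asboolP => // nDA; exfalso; apply: nDA => y yD.
apply: rA; rewrite [r]splitr -(subrKA (map_mx ratr (\row_i q i))).
rewrite (le_lt_trans (ler_normD _ _))// ltrD// (lt_trans _ kr)//.
by rewrite distrC.
Qed.

Lemma closed_measurable_rV A : closed A -> measurable A.
Proof. by move/closed_openC/open_measurable_rV/measurableC; rewrite setCK. Qed.

Lemma continuous_measurable_rV V f : open V ->
  (forall P, V P -> {for P, continuous f}) -> measurable_fun V f.
Proof.
move=> oV cf; apply: (measurability _ (RGenOpens.measurableE R)).
move=> _ [_ [a [b ->] <-]]; apply: open_measurable_rV.
rewrite openE => P [VP fP]; apply: filterI; first exact: open_nbhs_nbhs.
by apply: (cf _ VP); apply: open_nbhs_nbhs; split=> //; exact: interval_open.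
Qed.

End borel_rV.

Section fubini_rV.
Context (R : realType).
Local Open Scope ereal_scope.

Notation leb := (@lebesgue_measure R).

Lemma measurable_insert_coord n (J : 'I_n.+1) :
  measurable_fun [set: measurableTypeR R * 'rV[R]_n]
    (fun p => insert_coord J p.1 p.2).
Proof.
apply: measurable_fun_rVP => i; case: (unliftP J i) => [k|] ->.
  rewrite (_ : (fun _ => _) =
      (fun x : 'rV[R]_n => x 0%R k : measurableTypeR R) \o snd).
    exact: (measurableT_comp (@measurable_rV_coord R n k)).
  by apply/funext => p /=; rewrite insert_coord_lift.
rewrite (_ : (fun _ => _) = fst).
  exact: (@measurable_fst _ _ (measurableTypeR R) 'rV[R]_n).
by apply/funext => p; rewrite insert_coordJ.
Qed.

Lemma insert_coord_pt n (k : 'I_n.+1) (s t : R) (y : 'rV[R]_n) :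
  @insert_coord R n.+2 (lift ord0 k) s (pt t y) =
  pt t (@insert_coord R n.+1 k s y).
Proof.
apply/rowP => i; have [j ->|->] := unliftP (lift ord0 k) i; last first.
  by rewrite insert_coordJ pt_lift insert_coordJ.
rewrite insert_coord_lift; have [l ->|->] := unliftP ord0 j.
  rewrite pt_lift.
  have -> : lift (lift ord0 k) (lift ord0 l) = lift ord0 (lift k l).
    by apply/val_inj => /=; rewrite /bump !leq0n !add1n ltnS addnS.
  by rewrite pt_lift insert_coord_lift.
rewrite pt_ord0 (_ : lift (lift ord0 k) ord0 = ord0) ?pt_ord0//.
exact/val_inj.
Qed.

Lemma tonelli_pt n (f : 'rV[R]_n.+1 -> \bar R) : measurable_fun setT f ->
  (forall P, 0 <= f P) ->
  \int[lebesgue_rV R n.+1]_P f P =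
    \int[lebesgue_rV R n]_y \int[leb]_s f (pt s y) /\
  \int[lebesgue_rV R n.+1]_P f P =
    \int[leb]_s \int[lebesgue_rV R n]_y f (pt s y).
Proof.
move=> mf f0; have mi := @measurable_insert_coord n ord0.
have E : \int[lebesgue_rV R n.+1]_P f P =
    \int[leb \x lebesgue_rV R n]_p f (pt p.1 p.2).
  by rewrite [LHS](ge0_integral_pushforward mi).
have mfp : measurable_fun setT (fun p : measurableTypeR R * 'rV[R]_n => f (pt p.1 p.2)).
  exact: (measurableT_comp mf mi).
split; rewrite E.
  by rewrite (fubini_tonelli2 (fun p : measurableTypeR R * 'rV[R]_n => f (pt p.1 p.2))).
by rewrite (fubini_tonelli1 (fun p : measurableTypeR R * 'rV[R]_n => f (pt p.1 p.2))).
Qed.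

(** The measure is built by adding a first coordinate; an induction on the
    dimension exchanges it with any other one. *)
Lemma tonelli_rV n (J : 'I_n.+1) (f : 'rV[R]_n.+1 -> \bar R) :
  measurable_fun setT f -> (forall P, 0 <= f P) ->
  \int[lebesgue_rV R n.+1]_P f P =
  \int[lebesgue_rV R n]_y \int[leb]_s f (insert_coord J s y).
Proof.
elim: n J f => [|n IH] J f mf f0.
  by rewrite (ord1 J); have [] := tonelli_pt mf f0.
have [k ->|->] := unliftP ord0 J; last by have [] := tonelli_pt mf f0.
have [_ ->] := tonelli_pt mf f0.
have mpt s : measurable_fun setT (fun x : 'rV[R]_n.+1 => f (pt s x)).
  apply: (measurableT_comp mf).
  exact: (measurableT_comp (@measurable_insert_coord n.+1 ord0) (measurable_pair1 s)).
under eq_integral => s _.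
  rewrite (IH k _ (mpt s))//; over.
have mg : measurable_fun setT (fun y : 'rV[R]_n.+1 =>
    \int[leb]_s f (@insert_coord R n.+2 (lift ord0 k) s y)).
  apply: (measurable_fun_fubini_tonelli_G
    (fun p : measurableTypeR R * 'rV[R]_n.+1 => f (@insert_coord R n.+2 (lift ord0 k) p.1 p.2))) => //.
  exact: (measurableT_comp mf (measurable_insert_coord _)).
have [|_ ->] := tonelli_pt mg; first by move=> y; exact: integral_ge0.
apply: eq_integral => t _; apply: eq_integral => y _; apply: eq_integral => s _.
by rewrite insert_coord_pt.
Qed.

Lemma lebesgue_rV_insert n (J : 'I_n.+1) (A : set 'rV[R]_n.+1) : measurable A ->
  lebesgue_rV R n.+1 A =
  pushforward (leb \x lebesgue_rV R n) (fun p => insert_coord J p.1 p.2) A.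
Proof.
move=> mA; have mi := @measurable_insert_coord n J.
have mindic : measurable_fun setT (fun P : 'rV[R]_n.+1 => (\1_A P)%:E : \bar R).
  exact/measurable_EFinP.
have -> : lebesgue_rV R n.+1 A = \int[lebesgue_rV R n.+1]_P (\1_A P)%:E.
  by rewrite integral_indic// setIT.
rewrite (tonelli_rV J mindic) => [|P]; last by rewrite lee_fin.
rewrite -(fubini_tonelli2 (fun p : measurableTypeR R * 'rV[R]_n =>
    (\1_A (insert_coord J p.1 p.2))%:E)) => [| |p].
- rewrite (_ : (fun _ => _) = (fun p => (\1_((fun p : measurableTypeR R * 'rV[R]_n =>
      insert_coord J p.1 p.2) @^-1` A) p)%:E)).
    rewrite integral_indic// ?setIT//.
    by rewrite -[X in measurable X]setTI; exact: mi.
  by apply/funext => p; rewrite !indicE.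
- exact: (measurableT_comp mindic mi).
- by rewrite lee_fin.
Qed.

End fubini_rV.

Section bounded_support.
Context (R : realType).

Notation leb := (@lebesgue_measure R).
Notation lam := (@lebesgue_rV R).

(** Functions of this kind are integrable and their partial integrals are of
    this kind again, so Fubini's theorem applies to them for any coordinate. *)
Definition bounded_support m (f : 'rV[R]_m -> R) : Prop :=
  measurable_fun setT f /\
  exists2 C : R, 0 < C & forall P, `|f P| <= C /\ (C <= `|P| -> f P = 0).

Lemma lebesgue_itv_sym (C : R) : 0 < C -> leb `]- C, C[%classic = (2 * C)%:E.
Proof.
move=> C0; rewrite lebesgue_measure_itv/= lte_fin gt0_cp// -EFinB opprK.
by rewrite mulr_natl mulr2n.
Qed.

Lemma lebesgue_rV_cube m (r : R) : (lam m [set P | (`|P| < r)%R] < +oo)%E.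
Proof.
have mcube k : measurable [set P : 'rV[R]_k | `|P| < r].
  have [r0|r0] := ltP 0 r.
    rewrite (_ : [set P | _] = [set P | `|P - 0| < r]); first exact: measurable_cube.
    by apply/seteqP; split=> P /=; rewrite subr0.
  rewrite (_ : [set P | _] = set0) -?subset0// => P /=.
  by rewrite ltNge (le_trans r0).
elim: m => [|m IH].
  by rewrite /= diracE ltry.
rewrite (lebesgue_rV_insert ord0 (mcube _)) /pushforward.
rewrite (_ : _ @^-1` _ = `]- r, r[ `*` [set P : 'rV[R]_m | `|P| < r]).
  rewrite product_measure1E//; last exact: mcube.
  rewrite [X in (X * _)%E](lebesgue_measure_itv `]- r, r[)/=.
  case: ifPn => [rr|_]; last by rewrite mul0e ltry.
  by rewrite -EFinD lte_mul_pinfty// lee_fin opprK addr_ge0//; move: rr; rewrite lte_fin; lra.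
apply/seteqP; split=> [[s y] /= /norm_insert_coord[]|[s y] /=].
  by rewrite in_itv/= -ltr_norml.
by rewrite in_itv/= -ltr_norml => -[? ?]; exact/norm_insert_coord.
Qed.

Lemma bounded_support_integrable m (f : 'rV[R]_m -> R) :
  bounded_support f -> (lam m).-integrable setT (EFin \o f).
Proof.
move=> [mf [C C0 fC]].
pose B := [set P : 'rV[R]_m | `|P - 0| < C].
have mB : measurable B by exact: measurable_cube.
have -> : EFin \o f = (EFin \o f) \_ B.
  apply/funext => P; rewrite patchE; case: ifPn => // /negP PB /=.
  rewrite (fC P).2// leNgt; apply/negP => PC.
  by apply: PB; rewrite inE /B/= subr0.
apply/integrable_restrict => //; rewrite setTI.
apply: measurable_bounded_integrable => //.
- rewrite (_ : B = [set P | `|P| < C]); first exact: lebesgue_rV_cube.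
  by apply/seteqP; split=> P; rewrite /B/= subr0.
- exact: measurable_funTS.
- exists C; split; first by rewrite num_real.
  by move=> x Cx P _; rewrite /= (le_trans (fC P).1)// ltW.
Qed.

Lemma bounded_support_slice n (J : 'I_n.+1) (f : 'rV[R]_n.+1 -> R) y :
  bounded_support f ->
  leb.-integrable setT (EFin \o (fun s : R => f (insert_coord J s y))).
Proof.
move=> [mf [C C0 fC]].
have ms : measurable_fun setT (fun s : measurableTypeR R => f (insert_coord J s y)).
  apply: (measurableT_comp mf).
  exact: (measurableT_comp (@measurable_insert_coord R n J) (measurable_pair2 y)).
pose B := `]- C, C[%classic : set (measurableTypeR R).
have mB : measurable B by exact: measurable_itv.
set g := EFin \o _.
have -> : g = g \_ B.
  apply/funext => s; rewrite patchE; case: ifPn => // /negP sB.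
  rewrite /g/= (fC _).2// leNgt; apply/negP => /norm_insert_coord[sC _].
  by apply: sB; rewrite inE /B/= in_itv/= -ltr_norml.
apply/integrable_restrict => //; rewrite setTI.
apply: measurable_bounded_integrable => //.
- have lebB : (leb `](- C)%R, C%R[%classic < +oo)%E by rewrite (lebesgue_itv_sym C0) ltry.
  exact: lebB.
- exact: measurable_funTS.
- exists C; split; first by rewrite num_real.
  by move=> x Cx P _; rewrite /= (le_trans (fC _).1)// ltW.
Qed.

Lemma fubini_bounded_support n (J : 'I_n.+1) (f : 'rV[R]_n.+1 -> R) :
  bounded_support f ->
  bounded_support (fun y : 'rV[R]_n => \int[leb]_s f (insert_coord J s y)) /\
  \int[lam n.+1]_P f P =
  \int[lam n]_y \int[leb]_s f (insert_coord J s y).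
Proof.
move=> bf; have [mf [C C0 fC]] := bf.
have mi := @measurable_insert_coord R n J.
have mfi : measurable_fun [set: measurableTypeR R * 'rV[R]_n]
    (EFin \o (fun p : measurableTypeR R * 'rV[R]_n => f (insert_coord J p.1 p.2))).
  apply/measurable_EFinP; exact: (measurableT_comp mf mi).
pose psi (p : measurableTypeR R * 'rV[R]_n) := insert_coord J p.1 p.2.
have mEf : measurable_fun setT (EFin \o f) by exact/measurable_EFinP.
have lamE (h : 'rV[R]_n.+1 -> \bar R) :
    (\int[lam n.+1]_P h P = \int[pushforward (leb \x lam n) psi]_P h P)%E.
  by apply: eq_measure_integral => A mA _; exact: lebesgue_rV_insert.
have intf : (leb \x lam n)%E.-integrable setT (EFin \o (fun p => f (psi p))).
  apply/integrableP; split => //.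
  have /integrableP[_] := bounded_support_integrable bf.
  rewrite lamE ge0_integral_pushforward//.
  exact: measurableT_comp.
have GE y : (\int[leb]_s (f (insert_coord J s y))%:E =
    (\int[leb]_s f (insert_coord J s y))%:E)%E.
  by rewrite fineK//; apply: integrable_fin_num => //; exact: bounded_support_slice.
split; last first.
  congr fine; rewrite lamE integral_pushforward//.
  by rewrite -(integral21_prod_meas1 intf); apply: eq_integral => y _; rewrite -GE.
split.
  apply/measurable_EFinP; rewrite [X in measurable_fun _ X](_ : _ =
    (fun y => \int[leb]_s (EFin \o (fun p => f (psi p))) (s, y))%E).
    exact: (measurable_fubini_G intf).
  by apply/funext => y /=; rewrite -GE.
have CC : 0 < C + C * (2 * C) by rewrite addr_gt0// !mulr_gt0.
exists (C + C * (2 * C)) => // y; split; last first.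
  move=> yC; rewrite (@eq_Rintegral _ _ _ _ _ (fun=> 0)); last first.
    move=> s _; apply: (fC _).2; rewrite leNgt; apply/negP => /norm_insert_coord[_].
    by rewrite ltNge (le_trans _ yC)// lerDl !mulr_ge0// ltW.
  by rewrite Rintegral_cst// mul0r.
pose B := `]- C, C[%classic : set (measurableTypeR R).
have lebB : leb B = (2 * C)%:E by exact: lebesgue_itv_sym.
rewrite (@le_trans _ _ (C * (2 * C)))//; last by rewrite lerDr ltW.
have intsl := bounded_support_slice J y bf.
rewrite (le_trans (le_normr_Rintegral _ intsl))//.
have mB : measurable B by exact: measurable_itv.
have intC : \int[leb]_(s in B) C = C * fine (leb B) by exact: Rintegral_cst mB C.
rewrite lebB/= in intC; rewrite -intC.
have -> : \int[leb]_t `|f (insert_coord J t y)| =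
    \int[leb]_(t in B) `|f (insert_coord J t y)|.
  rewrite [RHS]Rintegral_mkcond; apply: eq_Rintegral => s _.
  rewrite patchE; case: ifPn => // /negP sB.
  rewrite (fC _).2 ?normr0// leNgt; apply/negP => /norm_insert_coord[sC _].
  by apply: sB; rewrite inE /B/= in_itv/= -ltr_norml.
apply: le_Rintegral => //.
- apply: integrableS (integrable_norm intsl) => //.
- apply: measurable_bounded_integrable => //.
    have lebBy : (leb B < +oo)%E by rewrite lebB ltry.
    exact: lebBy.
  exists C; split; first by rewrite num_real.
  by move=> x Cx P _; rewrite /= ger0_norm ltW.
- by move=> s _; exact: (fC _).1.
Qed.

End bounded_support.

(** * Integrals along a line and integration by parts *)

Section integrable_real.
Context (d : measure_display) (T : measurableType d) (R : realType).
Context (mu : {measure set T -> \bar R}) (D : set T).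
Hypothesis mD : measurable D.
Implicit Types f g : T -> R.

Lemma integrableD_EFin f g : mu.-integrable D (EFin \o f) ->
  mu.-integrable D (EFin \o g) -> mu.-integrable D (EFin \o (fun x => f x + g x)).
Proof. by move=> If Ig; exact: (integrableD mD If Ig). Qed.

Lemma integrableB_EFin f g : mu.-integrable D (EFin \o f) ->
  mu.-integrable D (EFin \o g) -> mu.-integrable D (EFin \o (fun x => f x - g x)).
Proof. by move=> If Ig; exact: (integrableB mD If Ig). Qed.

Lemma integrableZ_EFin (c : R) f : mu.-integrable D (EFin \o f) ->
  mu.-integrable D (EFin \o (fun x => c * f x)).
Proof. by move=> If; exact: (integrableZl mD c If). Qed.

End integrable_real.

Section one_dimension.
Context (R : realType).
Implicit Types (f k H : R -> R) (a b s : R).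

Notation leb := (@lebesgue_measure R).

Lemma is_derive_continuous H k s : is_derive s (1 : R) H (k s) ->
  {for s, continuous H}.
Proof. by move=> [dH _]; exact/differentiable_continuous/derivable1_diffP. Qed.

Lemma continuous_integrable_itv k a b : continuous k ->
  leb.-integrable `[a, b] (EFin \o k).
Proof.
move=> ck; apply: continuous_compact_integrable; first exact: segment_compact.
exact: continuous_subspaceT.
Qed.

Lemma FTC_itv H k a b : a < b -> (forall s, is_derive s (1 : R) H (k s)) ->
  continuous k -> \int[leb]_(s in `[a, b]) k s = H b - H a.
Proof.
move=> ab dH ck.
have cH s : {for s, continuous H} by exact: is_derive_continuous (dH s).
rewrite /Rintegral (@continuous_FTC2 _ k H a b)//.
- exact: continuous_subspaceT.
- split=> [s _||]; first by have [] := dH s.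
    exact/cvg_at_right_filter/cH.
  exact/cvg_at_left_filter/cH.
- by move=> s _; rewrite derive1E; have [_ ->] := dH s.
Qed.

Lemma FTC_itvoo H k a b : a < b -> (forall s, is_derive s (1 : R) H (k s)) ->
  continuous k -> \int[leb]_(s in `]a, b[) k s = H b - H a.
Proof.
move=> ab dH ck; rewrite -(FTC_itv ab dH ck).
have ik := continuous_integrable_itv a b ck.
rewrite Rintegral_itv_bndo_bndc; last first.
  by apply: integrableS ik => //; exact: subset_itv_oo_cc.
by rewrite Rintegral_itv_obnd_cbnd//; apply: integrableS ik => //; exact: subset_itv_oc_cc.
Qed.

Lemma integral_derivative0 H k (C : R) : 0 < C ->
  (forall s, is_derive s (1 : R) H (k s)) -> continuous k ->
  (forall s, C <= `|s| -> H s = 0 /\ k s = 0) -> \int[leb]_s k s = 0.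
Proof.
move=> C0 dH ck HC.
have -> : \int[leb]_s k s = \int[leb]_(s in `[- C, C]) k s.
  rewrite [RHS]Rintegral_mkcond; apply: eq_Rintegral => s _.
  rewrite patchE; case: ifPn => // /negP sC; apply: (HC _ _).2.
  rewrite leNgt; apply/negP => sC'; apply: sC; rewrite inE/= in_itv/= -ler_norml.
  exact: ltW.
rewrite (FTC_itv _ dH ck) ?gt0_cp//.
by rewrite (HC C _).1 ?(HC (- C) _).1 ?subrr// ?normrN ger0_norm// ltW.
Qed.

(** Where [k] has the constant sign [sg], the integrals of [k] and of
    [|k| = sg k] are given by the increment of its primitive [H]. The error may
    exceed [eta |k|] by [D] on an interval of length [2 del]. *)
Lemma piece_estimate f H k a b (c eta D g del sg : R) : a < b ->
  leb.-integrable setT (EFin \o f) ->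
  (forall s, is_derive s (1 : R) H (k s)) -> continuous k ->
  0 <= D -> 0 < del ->
  (forall s, a < s < b ->
    `|f s - c * k s| <= eta * (sg * k s) + D * \1_`]g - del, g + del[ s) ->
  `|\int[leb]_(s in `]a, b[) f s - c * (H b - H a)| <=
    eta * (sg * (H b - H a)) + D * (2 * del).
Proof.
move=> ab If dH ck D0 del0 fk.
have mab : measurable (`]a, b[%classic : set (measurableTypeR R)) by exact: measurable_itv.
have ifab : leb.-integrable `]a, b[ (EFin \o f) by exact: integrableS If.
have ik : leb.-integrable `]a, b[ (EFin \o k).
  by apply: integrableS (continuous_integrable_itv a b ck) => //; exact: subset_itv_oo_cc.
have ick x : leb.-integrable `]a, b[ (EFin \o (fun s => x * k s)).
  exact: integrableZ_EFin.
pose B := `]g - del, g + del[%classic : set (measurableTypeR R).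
have mB : measurable B by exact: measurable_itv.
have iB : leb.-integrable `]a, b[ (EFin \o \1_B).
  apply: measurable_bounded_integrable => //.
    by rewrite /= lebesgue_measure_itv/=; case: ifP => _; rewrite ?ltry// -EFinD ltry.
  exists 1; split; first by rewrite num_real.
  move=> x x1 s _ /=; rewrite indicE; case: (_ \in _); rewrite ?normr1 ?normr0 ltW//.
  exact: lt_trans x1.
have iDB : leb.-integrable `]a, b[ (EFin \o (fun s => D * \1_B s)).
  exact: integrableZ_EFin.
rewrite -(FTC_itvoo ab dH ck) -RintegralZl// -RintegralB//.
have isub : leb.-integrable `]a, b[ (EFin \o (fun s => f s - c * k s)).
  exact: integrableB_EFin.
rewrite (le_trans (le_normr_Rintegral mab isub))//.
have intB : \int[leb]_(s in `]a, b[) \1_B s <= 2 * del.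
  have -> : \int[leb]_(s in `]a, b[) \1_B s = fine (leb (B `&` `]a, b[)).
    by rewrite /Rintegral integral_indic.
  have lebB : (leb B = (2 * del)%:E).
    rewrite /= lebesgue_measure_itv/= lte_fin ltrD2l gt0_cp// -EFinB.
    by congr EFin; ring.
  have lebBy : (leb B < +oo)%E by rewrite lebB ltry.
  have leB : (leb (B `&` `]a, b[%classic) <= leb B)%E by exact: (measureIl leb mB mab).
  rewrite -[leRHS]/(fine (2 * del)%:E) -lebB fine_le//.
  - by rewrite ge0_fin_numE//; exact: le_lt_trans leB lebBy.
  - by rewrite ge0_fin_numE.
rewrite (@le_trans _ _ (\int[leb]_(s in `]a, b[) (eta * sg * k s + D * \1_B s)))//.
  apply: le_Rintegral => //.
  - exact: integrable_norm isub.
  - exact: integrableD_EFin.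
  - by move=> s; rewrite /= in_itv/= => /fk; rewrite mulrA.
rewrite RintegralD// RintegralZl// RintegralZl// -mulrA lerD2l.
exact: ler_wpM2l.
Qed.

(** The primitive [H] rises from [0] to [1] before [g] and falls back to [0]
    after it, so a function close to [z c k] before [g] and to [z d k] after
    it has an integral close to [z (c - d)]: a regularised Dirac mass at [g]
    sees the jump of the coefficient. *)
Lemma slice_estimate f H k a g b (c d z eta D del : R) : a < g < b ->
  leb.-integrable setT (EFin \o f) ->
  (forall s, is_derive s (1 : R) H (k s)) -> continuous k ->
  0 <= D -> 0 < del -> H a = 0 -> H g = 1 -> H b = 0 ->
  (forall s, ~~ (a < s < b) -> f s = 0) ->
  (forall s, a < s < g ->
    `|f s - z * c * k s| <= eta * (1 * k s) + D * \1_`]g - del, g + del[ s) ->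
  (forall s, g < s < b ->
    `|f s - z * d * k s| <= eta * (-1 * k s) + D * \1_`]g - del, g + del[ s) ->
  `|\int[leb]_s f s - z * (c - d)| <= 2 * eta + 4 * (D * del).
Proof.
move=> /andP[ag gb] If dH ck D0 del0 Ha Hg Hb f0 fl fu.
have ab := lt_trans ag gb.
have -> : \int[leb]_s f s = \int[leb]_(s in `]a, b[) f s.
  rewrite [RHS]Rintegral_mkcond; apply: eq_Rintegral => s _.
  rewrite patchE; case: ifPn => // sab; apply: f0.
  by apply: contra sab => sab; rewrite inE/= in_itv.
have Iab : leb.-integrable `]a, b[ (EFin \o f) by exact: integrableS If.
have := Rintegral_itvB Iab (_ : (BRight a <= BRight g)%O) (_ : (BRight g <= BLeft b)%O).
rewrite !bnd_simp => /(_ (ltW ag) gb) split_int.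
have pl := piece_estimate ag If dH ck D0 del0 fl.
have pu := piece_estimate gb If dH ck D0 del0 fu.
rewrite Rintegral_itv_bndo_bndc in pl; last exact: integrableS If.
rewrite -split_int in pu; move: pl pu; rewrite Ha Hg Hb.
move: (\int[leb]_(s in `]a, b[) f s) (\int[leb]_(s in `]a, g]) f s) => u v.
move: (D * (2 * del)) (mulrCA D 2 del) => w ->; clear.
rewrite !ler_norml => /andP[? ?] /andP[? ?]; apply/andP; split; lra.
Qed.

End one_dimension.

Section integration_by_parts.
Context (R : realType).
Notation leb := (@lebesgue_measure R).
Notation lam := (@lebesgue_rV R).

Lemma compact_norm_ball m (r : R) : compact [set P : 'rV[R]_m | `|P| <= r].
Proof.
apply: bounded_closed_compact.
  exists r; split; first by rewrite num_real.
  by move=> x rx P /= Pr; rewrite (le_trans Pr)// ltW.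
rewrite (_ : [set P | _] = (fun P : 'rV[R]_m => `|P|) @^-1` [set x | x <= r])//.
apply: closed_comp => [P _|]; first exact: norm_continuous.
exact: closed_le.
Qed.

Lemma bounded_on_ball m (f : 'rV[R]_m -> R) (r : R) :
  (forall P, {for P, continuous f}) ->
  exists2 C : R, 0 <= C & forall P, `|P| <= r -> `|f P| <= C.
Proof.
move=> cf; pose K := [set P : 'rV[R]_m | `|P| <= Num.max r 0].
have K0 : K !=set0 by exists 0; rewrite /K/= normr0 le_max lexx orbT.
have [c _ cmax] := EVT_max_rV K0 (@compact_norm_ball m (Num.max r 0))
  (continuous_subspaceT (fun P => @continuous_comp _ _ _ f (fun x => `|x|) P
    (cf P) (@norm_continuous _ _ (f P)))).
exists `|f c| => // P Pr; apply: cmax.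
by rewrite inE/K/= (le_trans Pr)// le_max lexx.
Qed.

Lemma continuous_bounded_support m (f : 'rV[R]_m -> R) (r : R) :
  (forall P, {for P, continuous f}) -> (forall P, r <= `|P| -> f P = 0) ->
  bounded_support f.
Proof.
move=> cf fr; split; first by apply: continuous_measurable_rV => //; exact: openT.
have [C C0 HC] := bounded_on_ball r cf.
exists (C + (1 + `|r|)); first by rewrite ltr_wpDl// ltr_pwDl.
move=> P; split.
  rewrite (@le_trans _ _ C)//; last by rewrite lerDl addr_ge0.
  by have [/HC//|/ltW/fr ->] := leP `|P| r; rewrite normr0.
move=> CP; apply: fr; apply: le_trans CP.
by rewrite (le_trans (ler_norm r))// addrA lerDr addr_ge0.
Qed.

(** Integrating first along the direction of the derivative reduces this to
    the fundamental theorem of calculus on a line. *)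
Lemma integral_partial0 m (h : 'rV[R]_m -> R) (i : 'I_m) (r : R) :
  (forall P, derivable h P (delta_mx 0 i)) ->
  (forall P, {for P, continuous (partial i h)}) ->
  (forall P, r <= `|P| -> h P = 0) ->
  (forall P, r <= `|P| -> partial i h P = 0) ->
  \int[lam m]_P partial i h P = 0.
Proof.
case: m h i => [|m] h i; first by case: i.
move=> dh ch h0 dh0.
have [_ ->] := fubini_bounded_support i (continuous_bounded_support ch dh0).
rewrite (@eq_Rintegral _ _ _ _ _ (fun=> 0)) => [|y _].
  by rewrite Rintegral_cst// mul0r.
pose C := 1 + `|r|.
have ge s : C <= `|s| -> r <= `|@insert_coord R m.+1 i s y|.
  move=> Cs; rewrite leNgt; apply/negP => /norm_insert_coord[+ _].
  rewrite ltNge => /negP; apply; rewrite (le_trans (ler_norm r))// (le_trans _ Cs)//.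
  by rewrite lerDr.
apply: (@integral_derivative0 _ (fun s => h (@insert_coord R m.+1 i s y)) _ C).
- by rewrite ltr_pwDl.
- by move=> s; exact: is_derive_insert.
- move=> s; apply: (@continuous_comp _ _ _ (fun s => @insert_coord R m.+1 i s y) (partial i h)).
    exact: insert_coord_continuousl.
  exact: ch.
- by move=> s /ge rs; rewrite h0// dh0.
Qed.

End integration_by_parts.

(** * Bump functions *)

Section flat_functions.
Context (R : realType).

(** [x^(-k) exp(-1/x)], extended by [0]: the derivatives of the flat function
    [exp(-1/x)] are linear combinations of these. *)
Definition flat (k : nat) (x : R) : R :=
  if 0 < x then x^-1 ^+ k * expR (- x^-1) else 0.

Lemma flat_gt0 k x : 0 < x -> 0 < flat k x.
Proof. by move=> x0; rewrite /flat x0 mulr_gt0 ?expR_gt0// exprn_gt0// invr_gt0. Qed.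

Lemma flat_le0 k x : x <= 0 -> flat k x = 0.
Proof. by move=> x0; rewrite /flat ltNge x0. Qed.

Lemma flat_ge0 k x : 0 <= flat k x.
Proof. by have [x0|x0] := ltP 0 x; [exact/ltW/flat_gt0|rewrite flat_le0]. Qed.

(** The exponential series gives [u^(k+2) <= (k+2)! exp(u)] for [u = 1/x]; a
    quadratic bound makes the derivative at [0] vanish. *)
Lemma flat_sqr k x : `|flat k x| <= (k.+2)`!%:R * x ^+ 2.
Proof.
have [x0|x0] := ltP 0 x; last by rewrite flat_le0// normr0 mulr_ge0// sqr_ge0.
rewrite ger0_norm ?flat_ge0// /flat x0.
have u0 : 0 < x^-1 by rewrite invr_gt0.
have H : x^-1 ^+ k.+2 <= expR x^-1 * (k.+2)`!%:R.
  rewrite -ler_pdivrMr ?ltr0n ?fact_gt0//.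
  by rewrite (le_trans _ (expR_ge1Dxn k.+1 (ltW u0)))// lerDr.
rewrite expRN ler_pdivrMr ?expR_gt0// mulrAC -ler_pdivrMr ?exprn_gt0//.
by rewrite -exprVn -exprD addn2 (le_trans H)// mulrC.
Qed.

Lemma is_derive_expXN k (u : R) :
  is_derive u (1 : R) (fun u : R => u ^+ k * expR (- u))
    ((k%:R * u ^+ k.-1 - u ^+ k) * expR (- u)).
Proof.
have dX : is_derive u (1 : R) (fun u : R => u ^+ k) (k%:R * u ^+ k.-1).
  case: k => [|k]; first by rewrite mul0r; exact: is_derive_cst.
  by apply: DeriveDef; [exact: exprn_derivable|rewrite -derive1E exp_derive1].
have dN : is_derive u (1 : R) (fun u : R => - u) (- 1).
  by apply: is_deriveN.
have dE := @is_derive1_comp _ expR (fun u : R => - u) u _ _ (is_derive_expR _) dN.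
have [d1 d2] := is_deriveM dX dE.
apply: DeriveDef; first exact: d1.
by rewrite [LHS]d2 /GRing.scale/=; ring.
Qed.

Lemma is_derive_flat k (x : R) :
  is_derive x (1 : R) (flat k) (- k%:R * flat k.+1 x + 1 * flat k.+2 x).
Proof.
have [x0|x0|->] := ltgtP x 0.
- rewrite !flat_le0 ?ltW// !mulr0 addr0.
  have d0 : is_derive x (1 : R) (cst (0 : R) : R -> R) 0 by exact: is_derive_cst.
  apply: (near_eq_is_derive _ d0).
  by near=> y; rewrite flat_le0//; near: y; exact: lt_le_nbhsl.
- have xn0 : x != 0 by rewrite gt_eqF.
  have dV : is_derive x (1 : R) (fun y : R => y^-1) (- x^-1 ^+ 2).
    apply: is_derive_eq; first exact: (is_deriveV xn0).
    by rewrite /GRing.scale/= mulr1 exprVn.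
  have dG := is_derive_expXN k x^-1.
  have dGV := @is_derive1_comp _ (fun u : R => u ^+ k * expR (- u)) (fun y : R => y^-1)
    x _ _ dG dV.
  apply: (@near_eq_is_derive _ R R
    ((fun u : R => u ^+ k * expR (- u)) \o (fun y : R => y^-1))).
    by near=> y; rewrite /flat ifT//; near: y; exact: lt_nbhsr.
  apply: (is_derive_eq dGV).
  rewrite /flat x0 mul1r; case: k {dG dGV} => [|k]; rewrite /= !exprS; last by ring.
  by rewrite !expr0; ring.
- rewrite !flat_le0// !mulr0 addr0.
  have E : (fun h : R => h^-1 *: ((flat k \o shift 0) (h *: (1 : R)) - flat k 0)) @ 0^' --> (0 : R).
    apply/cvgr0Pnorm_le => e e0; near=> h.
    have hn0 : h != 0 by near: h; exact: nbhs_dnbhs_neq.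
    rewrite /= addr0 [_%:A]mulr1 (flat_le0 _ (lexx 0)) subr0 normrM normfV.
    rewrite ler_pdivrMl ?normr_gt0// (le_trans (flat_sqr k h))//.
    rewrite -[h ^+ 2]real_normK ?num_real// expr2 mulrA [leRHS]mulrC ler_wpM2r//.
    rewrite -ler_pdivlMl ?ltr0n ?fact_gt0//.
    near: h; apply: dnbhs0_le.
    by rewrite mulr_gt0// invr_gt0 ltr0n fact_gt0.
  by apply: DeriveDef; [apply/cvg_ex; exists 0|exact: cvg_lim E].
Unshelve. all: by end_near. Qed.

Lemma smooth_flat m V (f : 'rV[R]_m -> R) k : open V -> smooth V f ->
  smooth V (flat k \o f).
Proof. by move=> oV sf j; exact: (Ck_comp_family oV is_derive_flat sf). Qed.

Lemma flat0_le x y : x <= y -> flat 0 x <= flat 0 y.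
Proof.
move=> xy; have [x0|x0] := ltP 0 x; last by rewrite flat_le0// flat_ge0.
rewrite /flat x0 (lt_le_trans x0 xy) !expr0 !mul1r ler_expR lerN2 lef_pV2//.
by rewrite posrE (lt_le_trans x0).
Qed.

(** An even bump of height [1] with support [[-eps, eps]], and its derivative. *)
Definition bump1 (eps s : R) : R := flat 0 (eps ^+ 2 - s ^+ 2) / flat 0 (eps ^+ 2).

Definition dbump1 (eps s : R) : R :=
  flat 2 (eps ^+ 2 - s ^+ 2) / flat 0 (eps ^+ 2) * (- 2 * s).

Lemma bump1_0 eps : 0 < eps -> bump1 eps 0 = 1.
Proof. by move=> e0; rewrite /bump1 expr0n subr0 divff// gt_eqF// flat_gt0// exprn_gt0. Qed.

Lemma bump1_ge0 eps s : 0 <= bump1 eps s.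
Proof. by rewrite divr_ge0// flat_ge0. Qed.

Lemma bump1_le1 eps s : 0 < eps -> bump1 eps s <= 1.
Proof.
move=> e0; rewrite ler_pdivrMr ?flat_gt0 ?exprn_gt0// mul1r.
by apply: flat0_le; rewrite gerBl sqr_ge0.
Qed.

Lemma bump1_out eps s : 0 < eps -> eps <= `|s| -> bump1 eps s = 0.
Proof.
move=> e0 es; rewrite /bump1 flat_le0 ?mul0r// subr_le0 -[s ^+ 2]real_normK ?num_real//.
by rewrite ler_pXn2r// nnegrE ltW.
Qed.

Lemma is_derive_bump1 eps (s : R) : is_derive s (1 : R) (bump1 eps) (dbump1 eps s).
Proof.
have dq : is_derive s (1 : R) (fun s : R => eps ^+ 2 - s ^+ 2) (- 2 * s).
  have dX : is_derive s (1 : R) (fun s : R => s ^+ 2) (2 * s).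
    by apply: DeriveDef; [exact: exprn_derivable|rewrite -derive1E exp_derive1].
  have [d1 d2] := is_deriveB (is_derive_cst (eps ^+ 2 : R) s (1 : R)) dX.
  by apply: DeriveDef; [exact: d1|rewrite [LHS]d2 sub0r mulNr].
have df := is_derive_flat 0 (eps ^+ 2 - s ^+ 2).
have dc := @is_derive1_comp _ (flat 0) (fun s : R => eps ^+ 2 - s ^+ 2) s _ _ df dq.
rewrite (_ : bump1 eps = (flat 0 (eps ^+ 2))^-1 *:
  (flat 0 \o (fun s : R => eps ^+ 2 - s ^+ 2))); last first.
  by apply/funext => t; rewrite /bump1 mulrC.
have [d1 d2] := is_deriveZ (flat 0 (eps ^+ 2))^-1 dc.
apply: DeriveDef; [exact: d1|rewrite [LHS]d2 /GRing.scale/= /dbump1].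
by ring.
Qed.

(** The bump is monotone on both sides of [0], so its derivative does not
    change sign there and its integral is controlled by its increments. *)
Lemma dbump1_sign eps s : 0 < eps -> dbump1 eps s * s <= 0.
Proof.
move=> e0; rewrite /dbump1 -mulrA mulr_ge0_le0 ?divr_ge0 ?flat_ge0//.
by rewrite mulNr mulNr oppr_le0 -mulrA mulr_ge0// -expr2 sqr_ge0.
Qed.

Lemma smooth_bump1 m V (f : 'rV[R]_m -> R) eps : open V -> smooth V f ->
  smooth V (bump1 eps \o f).
Proof.
move=> oV sf.
have -> : bump1 eps \o f = fun P => (flat 0 (eps ^+ 2))^-1 *
    (flat 0 \o (fun P => eps ^+ 2 + - 1 * (f P * f P))) P.
  by apply/funext => P; rewrite /bump1 /= mulrC mulN1r expr2.
apply: smoothZ => //; apply: smooth_flat => //; apply: smoothD => //.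
  by move=> k; exact: Ck_cst.
by apply: smoothZ => //; exact: smoothM.
Qed.

(** A bump on [R^m] around [c], supported in the cube of side [2 r]. *)
Definition space_bump m (c : 'rV[R]_m) (r : R) (y : 'rV[R]_m) : R :=
  flat 0 (r ^+ 2 - dot (y - c) (y - c)).

Lemma smooth_bump m (c : 'rV[R]_m) r : smooth setT (space_bump c r).
Proof.
have oT := @openT 'rV[R]_m.
apply: (@smooth_flat m setT (fun y => r ^+ 2 - dot (y - c) (y - c))) => //.
have -> : (fun y => r ^+ 2 - dot (y - c) (y - c)) =
    fun y => r ^+ 2 + - 1 * \sum_i (y 0 i + - c 0 i) * (y 0 i + - c 0 i).
  by apply/funext => y; rewrite mulN1r; congr (_ - _); apply: eq_bigr => i _; rewrite !mxE.
have sc (x : R) : smooth setT (fun _ : 'rV[R]_m => x) by move=> k; exact: Ck_cst.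
have sX (i : 'I_m) : smooth setT (fun y : 'rV[R]_m => y 0 i).
  by move=> k; exact: Ck_coord.
apply: smoothD => //; apply: smoothZ => //; apply: smooth_sum => // i.
by apply: smoothM => //; exact: smoothD.
Qed.

Lemma bump_ge0 m (c : 'rV[R]_m) r y : 0 <= space_bump c r y.
Proof. exact: flat_ge0. Qed.

Lemma bump_gt0 m (c : 'rV[R]_m) r : 0 < r -> 0 < space_bump c r c.
Proof.
move=> r0; apply: flat_gt0; rewrite subrr /dot big1 ?subr0 ?exprn_gt0//.
by move=> i _; rewrite mxE mul0r.
Qed.

Lemma bump_out m (c : 'rV[R]_m) r y : 0 < r -> r <= `|y - c| -> space_bump c r y = 0.
Proof.
move=> r0 ry; apply: flat_le0; rewrite subr_le0.
have [i ri] : exists i, r <= `|(y - c) 0 i|.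
  apply: contrapT => /forallNP H; move: ry; rewrite leNgt => /negP; apply.
  rewrite [ltLHS]/Num.Def.normr/= mx_normrE; apply: bigmax_lt => // -[k i] _.
  by rewrite ord1 ltNge; apply/negP; exact: H.
rewrite (@le_trans _ _ ((y - c) 0 i ^+ 2))//.
  by rewrite -[leRHS]real_normK ?num_real// ler_pXn2r// nnegrE ltW.
rewrite /dot (bigD1 i)//= -expr2 lerDl sumr_ge0// => k _.
by rewrite -expr2 sqr_ge0.
Qed.

(** The support of [f] in [V] is contained in the closed set [K], so the
    extension by [0] is locally either [f] or [0]. *)
Lemma smooth_patch m V K (f : 'rV[R]_m -> R) k : open V -> closed K -> K `<=` V ->
  Ck k V f -> (forall P, V P -> ~ K P -> f P = 0) -> Ck k setT (f \_ V).
Proof.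
move=> oV cK KV Cf fK.
rewrite (_ : setT = V `|` ~` K); last first.
  apply/seteqP; split=> // P _; have [VP|nVP] := pselect (V P); first by left.
  by right => KP; exact/nVP/KV.
apply: CkU.
  by apply: (Ck_eq oV _ Cf) => P VP; rewrite patchE mem_set.
have oK : open (~` K) by exact: closed_openC.
apply: (Ck_eq oK _ (@Ck_cst _ _ k (~` K) 0)) => P nKP.
by rewrite patchE; case: ifPn => // /set_mem VP; rewrite fK.
Qed.

Lemma partial_patch m V (f : 'rV[R]_m -> R) i P : open V -> V P ->
  partial i (f \_ V) P = partial i f P.
Proof.
by move=> oV VP; apply: (partial_eq i oV VP) => Q VQ; rewrite patchE mem_set.
Qed.

Lemma partial_patch0 m V K (f : 'rV[R]_m -> R) i P : open V -> closed K ->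
  (forall P, V P -> ~ K P -> f P = 0) -> ~ K P -> partial i (f \_ V) P = 0.
Proof.
move=> oV cK fK nKP; have oK : open (~` K) by exact: closed_openC.
rewrite (@partial_eq _ _ (~` K) _ (fun=> 0) i P oK nKP); last first.
  by move=> Q nKQ; rewrite patchE; case: ifPn => // /set_mem VQ; rewrite fK.
exact: derive_cst.
Qed.

End flat_functions.

(** * Surface integrals *)

Section integral_density.
Local Open Scope ereal_scope.
Context (R : realType) (d1 d2 : measure_display).
Context (T1 : measurableType d1) (T2 : measurableType d2).
Context (mu : {measure set T1 -> \bar R}) (nu : {measure set T2 -> \bar R}).
Context (D1 : set T1) (D2 : set T2) (psi : T2 -> T1) (w : T2 -> R).
Hypotheses (mD1 : measurable D1) (mD2 : measurable D2).
Hypotheses (mpsi : measurable_fun D2 psi) (mw : measurable_fun D2 w).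
Hypothesis w0 : forall y, (0 <= w y)%R.
Hypothesis muE : forall A, measurable A ->
  mu (A `&` D1) = \int[nu]_(y in D2 `&` psi @^-1` A) (w y)%:E.

Import HBNNSimple.

Let mEw : measurable_fun D2 (fun y => (w y)%:E).
Proof. exact/measurable_EFinP. Qed.

Let integral_density_indic A : measurable A ->
  \int[mu]_(x in D1) (\1_A x)%:E = \int[nu]_(y in D2) ((\1_A (psi y))%:E * (w y)%:E).
Proof.
move=> mA; rewrite integral_indic// muE// integral_mkcondr.
apply: eq_integral => y _; rewrite patchE indicE.
have -> : (psi y \in A) = (y \in psi @^-1` A) by apply/idP/idP; rewrite !inE.
by case: ifPn => _; rewrite ?mul1e ?mul0e.
Qed.

Let integral_density_nnsfun (f : {nnsfun T1 >-> R}) :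
  \int[mu]_(x in D1) (f x)%:E = \int[nu]_(y in D2) ((f (psi y))%:E * (w y)%:E).
Proof.
have mind (r : R) : measurable (f @^-1` [set r]) by exact: measurable_sfunP.
have mindpsi (r : R) : measurable_fun D2 (fun y => (\1_(f @^-1` [set r]) (psi y))%:E : \bar R).
  apply/measurable_EFinP; apply: (measurable_comp measurableT) => //.
under [LHS]eq_integral do rewrite fimfunE -fsumEFin//.
rewrite [LHS]ge0_integral_fsum//; last 2 first.
  - by move=> r; apply: measurable_funTS; exact/measurable_EFinP/measurableT_comp.
  - by move=> n x _; rewrite EFinM nnfun_muleindic_ge0.
under [RHS]eq_integral.
  move=> y yD; rewrite fimfunE -fsumEFin// ge0_mule_fsuml; last first.
    by move=> r; rewrite EFinM nnfun_muleindic_ge0.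
  over.
rewrite [RHS]ge0_integral_fsum//; last 2 first.
  - move=> r; apply: emeasurable_funM => //.
    by under eq_fun do rewrite EFinM; apply: emeasurable_funM.
  - move=> r y _; rewrite EFinM mule_ge0//; last by rewrite lee_fin.
    by rewrite nnfun_muleindic_ge0.
apply: eq_fsbigr => r rf.
have r0 : (0 <= r)%R by move: rf; rewrite inE => -[x _ <-].
under eq_integral do rewrite EFinM.
have -> : \int[mu]_(x in D1) (r%:E * (\1_(f @^-1` [set r]) x)%:E) =
    r%:E * \int[mu]_(x in D1) (\1_(f @^-1` [set r]) x)%:E.
  by apply: ge0_integralZl => //; apply: measurable_funTS; exact/measurable_EFinP.
rewrite integral_density_indic//.
have -> : r%:E * \int[nu]_(y in D2) ((\1_(f @^-1` [set r]) (psi y))%:E * (w y)%:E) =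
    \int[nu]_(y in D2) (r%:E * ((\1_(f @^-1` [set r]) (psi y))%:E * (w y)%:E)).
  apply/esym; apply: ge0_integralZl => //; first exact: emeasurable_funM.
  by move=> y _; rewrite mule_ge0 ?lee_fin.
by apply: eq_integral => y _; rewrite EFinM muleA.
Qed.

(** The hypothesis [muE] is the case of indicator functions; the general case
    follows by linearity and monotone convergence along simple functions. *)
Lemma ge0_integral_density (f : T1 -> \bar R) :
  measurable_fun setT f -> (forall x, 0 <= f x) ->
  \int[mu]_(x in D1) f x = \int[nu]_(y in D2) (f (psi y) * (w y)%:E).
Proof.
move=> mf f0; pose f_ := nnsfun_approx measurableT mf.
have mf_ n : measurable_fun setT (fun x => (f_ n x)%:E).
  exact/measurable_EFinP.
have mf_psi n : measurable_fun D2 (fun y => (f_ n (psi y))%:E).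
  exact: (measurable_comp measurableT (@subsetT _ _) (mf_ n) mpsi).
transitivity (lim (\int[mu]_(x in D1) (f_ n x)%:E @[n --> \oo])).
  rewrite -monotone_convergence//=.
  - apply: eq_integral => ? /[!inE] xD; apply/esym/cvg_lim => //=.
    exact: cvg_nnsfun_approx.
  - by move=> n; exact: measurable_funTS.
  - by move=> n ? _; rewrite lee_fin.
  - by move=> ? _ ? ? mn; rewrite lee_fin; exact/lefP/nd_nnsfun_approx.
under eq_fun do rewrite integral_density_nnsfun.
rewrite -monotone_convergence//=.
- apply: eq_integral => y _; apply/cvg_lim => //=.
  apply: cvgeZr => //; exact: cvg_nnsfun_approx.
- by move=> n; exact: emeasurable_funM.
- by move=> n y _; rewrite mule_ge0 ?lee_fin.
- move=> y _ a b ab; rewrite lee_wpmul2r ?lee_fin//.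
  exact/lefP/nd_nnsfun_approx.
Qed.

Lemma Rintegral_density (f : T1 -> R) :
  measurable_fun setT f ->
  (\int[mu]_(x in D1) f x = \int[nu]_(y in D2) (f (psi y) * w y))%R.
Proof.
move=> mf; congr fine.
have mEf : measurable_fun setT (EFin \o f) by exact/measurable_EFinP.
rewrite -[LHS]/(\int[mu]_(x in D1) (EFin \o f) x).
rewrite integralE (ge0_integral_density (measurable_funepos mEf))//.
rewrite (ge0_integral_density (measurable_funeneg mEf))// [RHS]integralE.
congr (_ - _); apply: eq_integral => y _.
  rewrite !funeposE/= EFinM; have := w0 y; rewrite -lee_fin => wy.
  by rewrite muleC maxe_pMr// mule0 [X in maxe X _]muleC.
rewrite !funenegE -[(EFin \o f) _]/((f (psi y))%:E) EFinM; have := w0 y; rewrite -lee_fin => wy.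
by rewrite muleC maxe_pMr// mule0 muleN [X in maxe (- X) _]muleC.
Qed.

End integral_density.

Section cylinder.
Context (R : realType) (n : nat) (J : 'I_n.+1).
Implicit Types (z : 'rV[R]_n -> R) (Q v : 'rV[R]_n.+1).

Lemma col'_continuous : continuous (fun P : 'rV[R]_n.+1 => col' J P : 'rV[R]_n).
Proof.
move=> P A nA; have [r r0 rA] := near_norm nA.
apply: (@norm_near _ _ _ _ r r0) => Q QP; apply: rA; apply: le_lt_trans QP.
apply: normr_rV_le => // k.
have -> : (col' J Q - col' J P) 0 k = (Q - P) 0 (lift J k) by rewrite !mxE.
exact: normr_coord.
Qed.

Lemma col'_line (h : R) v Q : col' J (h *: v + Q) = h *: col' J v + col' J Q.
Proof. by apply/rowP => k; rewrite !mxE. Qed.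

Lemma derive_col' z Q v :
  'D_v (fun Q => z (col' J Q)) Q = 'D_(col' J v) z (col' J Q) /\
  (derivable z (col' J Q) (col' J v) -> derivable (fun Q => z (col' J Q)) Q v).
Proof.
have E : (fun h : R => h^-1 *: (((fun Q => z (col' J Q)) \o shift Q) (h *: v) - z (col' J Q))) =
    (fun h : R => h^-1 *: ((z \o shift (col' J Q)) (h *: col' J v) - z (col' J Q))).
  by apply/funext => h /=; rewrite col'_line.
by split; [rewrite /derive E|rewrite /derivable E].
Qed.

Lemma is_derive_vec0 z (y : 'rV[R]_n) : is_derive y 0 z 0.
Proof.
have E : (fun h : R => h^-1 *: ((z \o shift y) (h *: 0) - z y)) = fun=> 0.
  by apply/funext => h /=; rewrite scaler0 add0r subrr scaler0.
by apply: DeriveDef; rewrite ?/derivable ?/derive E; [exact: is_cvg_cst|exact: lim_cst].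
Qed.

Lemma col'_delta_lift k : col' J (delta_mx 0 (lift J k)) = delta_mx 0 k :> 'rV[R]_n.
Proof. by apply/rowP => l; rewrite !mxE (inj_eq lift_inj). Qed.

Lemma col'_deltaJ : col' J (delta_mx 0 J) = 0 :> 'rV[R]_n.
Proof. by apply/rowP => l; rewrite !mxE eq_sym (negPf (neq_lift _ _)) andbF. Qed.

Lemma grad_col' z Q : grad (fun Q => z (col' J Q)) Q = insert_coord J 0 (grad z (col' J Q)).
Proof.
apply: (rowJP (J := J)) => [|k].
  by rewrite insert_coordJ mxE /partial (derive_col' _ _ _).1 col'_deltaJ; have [_ ->] := is_derive_vec0 z (col' J Q).
by rewrite insert_coord_lift !mxE /partial (derive_col' _ _ _).1 col'_delta_lift.
Qed.

Lemma smooth_col' z : smooth setT z -> smooth setT (fun Q => z (col' J Q)).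
Proof.
have cz z' : smooth setT z' -> forall Q, {for Q, continuous (fun Q => z' (col' J Q))}.
  move=> sz Q; apply: (@continuous_comp _ _ _ (fun Q : 'rV[R]_n.+1 => col' J Q : 'rV[R]_n) z').
    exact: col'_continuous.
  exact: smooth_continuous sz I.
move=> sz k; elim: k z sz => [|k IH] z sz; first by split=> // Q _; exact: cz.
split=> [Q _|i]; first exact: cz.
split=> [Q _|].
  apply: (derive_col' _ _ _).2; have [l ->|->] := unliftP J i.
    by rewrite col'_delta_lift; exact: smooth_derivable sz I.
  by rewrite col'_deltaJ; have [] := is_derive_vec0 z (col' J Q).
have [l ->|->] := unliftP J i.
  rewrite (_ : partial _ _ = fun Q => partial l z (col' J Q)).
    exact/IH/smooth_partial.
  by apply/funext => Q; rewrite /partial (derive_col' _ _ _).1 col'_delta_lift.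
rewrite (_ : partial _ _ = fun=> 0); first exact: Ck_cst.
by apply/funext => Q; rewrite /partial (derive_col' _ _ _).1 col'_deltaJ; have [_ ->] := is_derive_vec0 z (col' J Q).
Qed.

End cylinder.

Section surface_integral.
Context (R : realType) (n : nat) (J : 'I_n.+1).
Notation lam := (@lebesgue_rV R).
Notation ins := (@insert_coord R n.+1 J).

(** On the graph of [g] a surface measure is the image of the measure of
    density [sqrt(1 + |grad g|^2)], since the areas of the pieces over Borel
    subsets of [W] are prescribed. *)
Lemma surface_integral_graph (M : set 'rV[R]_n.+1)
    (mu : {measure set 'rV[R]_n.+1 -> \bar R}) (W : set 'rV[R]_n)
    (g : 'rV[R]_n -> R) (f : 'rV[R]_n.+1 -> R) :
  is_surface_measure M mu -> open W -> Ck 1 W g ->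
  (forall y, W y -> M (ins (g y) y)) ->
  measurable_fun setT f ->
  (forall P, M P -> ~ (exists2 y, W y & ins (g y) y = P) -> f P = 0) ->
  \int[mu]_(P in M) f P = \int[lam n]_(y in W)
    (f (ins (g y) y) * Num.sqrt (1 + dot (grad g y) (grad g y))).
Proof.
move=> [_ muM] oW Cg WM mf f0.
pose D := [set ins (g y) y | y in W].
have mW : measurable W by exact: open_measurable_rV.
have cg y : W y -> {for y, continuous g} by exact: Cg.1.
have mg : measurable_fun W (g : 'rV[R]_n -> measurableTypeR R).
  exact: continuous_measurable_rV.
have mpsi : measurable_fun W (fun y => ins (g y) y).
  have mg0 : measurable_fun setT ((g : 'rV[R]_n -> measurableTypeR R) \_ W).
    by apply/(measurable_restrictT _ mW).
  have mp : measurable_fun setT (fun y => ((g \_ W) y, y) : measurableTypeR R * 'rV[R]_n).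
    exact: (measurable_fun_pair mg0 (@measurable_id _ _ _)).
  apply: (eq_measurable_fun (fun y => ins ((g \_ W) y) y)).
    by move=> y yW; rewrite patchE yW.
  apply: measurable_funTS.
  exact: (measurableT_comp (@measurable_insert_coord R n J) mp).
have mD : measurable D.
  pose O := [set P : 'rV[R]_n.+1 | W (col' J P)].
  have ccol := @col'_continuous R n J.
  have oO : open O.
    by apply: (@open_comp _ _ (fun P : 'rV[R]_n.+1 => col' J P : 'rV[R]_n)).
  have mF : measurable_fun O (fun P => P 0 J - g (col' J P)).
    apply: continuous_measurable_rV => // P OP; apply: continuousB.
      exact: coord_continuous.
    by apply: continuous_comp; [exact: ccol|exact: cg].
  have -> : D = O `&` (fun P : 'rV[R]_n.+1 => P 0 J - g (col' J P)) @^-1` [set 0].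
    apply/seteqP; split=> [_ [y Wy <-]|P [OP /= /eqP]].
      by rewrite /O/= col'_insert_coord insert_coordJ subrr.
    rewrite subr_eq0 => /eqP E; exists (col' J P) => //.
    by rewrite -E insert_coord_eta.
  by apply: mF => //; exact: open_measurable_rV.
have fMD : \int[mu]_(P in M) f P = \int[mu]_(P in D) f P.
  rewrite [LHS]Rintegral_mkcond [RHS]Rintegral_mkcond; apply: eq_Rintegral => P _.
  rewrite !patchE; case: ifPn => [/set_mem MP|/negP nMP].
    case: ifPn => // /negP nDP; apply: f0 => // -[y Wy yP].
    by apply: nDP; rewrite inE; exists y.
  case: ifPn => // /set_mem [y Wy yP]; exfalso; apply: nMP.
  by rewrite inE -yP; exact: WM.
rewrite fMD; apply: (Rintegral_density mD mW mpsi) => //.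
  have mgrad : measurable_fun W (fun y => 1 + dot (grad g y) (grad g y)).
    apply: continuous_measurable_rV => // y Wy; apply: continuousD.
      exact: cst_continuous_for.
    have cgrad : Ck 0 W (fun y => dot (grad g y) (grad g y)).
      apply: Ck_sum => // i.
      rewrite (_ : (fun P => _) = fun P => partial i g P * partial i g P); last first.
        by apply/funext => P; rewrite !mxE.
      by have [_ /(_ i)[_ cp]] := Cg; exact: CkM.
    exact: cgrad.1.
  have ms : measurable_fun setT (Num.sqrt : measurableTypeR R -> measurableTypeR R).
    exact: continuous_measurable_fun (@sqrt_continuous R).
  exact: (measurable_comp (g := fun y => 1 + dot (grad g y) (grad g y)) measurableT (@subsetT _ _) ms mgrad).
move=> A mA.
have -> : A `&` D = [set ins (g y) y | y in W `&` (fun y => ins (g y) y) @^-1` A].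
  apply/seteqP; split=> [P [AP [y Wy yP]]|_ [y [Wy Ay] <-]].
    by exists y => //; split=> //=; rewrite yP.
  by split=> //; exists y.
rewrite (muM J W)//.
- exact: mpsi.
- by move=> _ [y [Wy _] <-]; exact: WM.
Qed.

End surface_integral.

(** * The bulk term in a thin layer *)

Section bump_facts.
Context (R : realType).

Lemma dbump1_out (eps s : R) : 0 < eps -> eps <= `|s| -> dbump1 eps s = 0.
Proof.
move=> e0 es; rewrite /dbump1 flat_le0 ?mul0r// subr_le0 -[s ^+ 2]real_normK ?num_real//.
by rewrite ler_pXn2r// nnegrE ltW.
Qed.

Lemma bump1_continuous (eps : R) : continuous (bump1 eps).
Proof. by move=> s; exact: is_derive_continuous (is_derive_bump1 eps s). Qed.

Lemma continuousM_for (T : topologicalType) (f h : T -> R) x :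
  {for x, continuous f} -> {for x, continuous h} ->
  {for x, continuous (fun x => f x * h x)}.
Proof. exact: continuousM. Qed.

Lemma dbump1_continuous (eps : R) : continuous (dbump1 eps).
Proof.
have cM (f h : R -> R) := @continuousM_for R f h.
move=> s; apply: (cM (fun s => flat 2 (eps ^+ 2 - s ^+ 2) / flat 0 (eps ^+ 2)) (fun s => - 2 * s)).
  apply: (cM (fun s => flat 2 (eps ^+ 2 - s ^+ 2)) (fun=> _)); last exact: cst_continuous_for.
  apply: (@continuous_comp _ _ _ (fun s : R => eps ^+ 2 - s ^+ 2) (flat 2)).
    by apply: continuousB; [exact: cst_continuous_for|exact: exprn_continuous].
  exact: (is_derive_continuous (k := fun x => - 2%:R * flat 3 x + 1 * flat 4 x) (is_derive_flat 2 _)).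
by apply: (cM (fun=> _) id); [exact: cst_continuous_for|exact: id_continuous_for].
Qed.

Lemma measurable_dot d (T : measurableType d) m (D : set T) (u v : T -> 'rV[R]_m) :
  (forall i, measurable_fun D (fun x => u x 0 i : R)) ->
  (forall i, measurable_fun D (fun x => v x 0 i : R)) ->
  measurable_fun D (fun x => dot (u x) (v x)).
Proof.
move=> mu mv; apply: measurable_sum => i.
exact: measurable_funM.
Qed.

End bump_facts.

Section sums.
Context (R : realType).
Notation lam := (@lebesgue_rV R).

Lemma sum_norm_continuous m k (F : 'I_k -> 'rV[R]_m -> R) :
  (forall i Q, {for Q, continuous (F i)}) ->
  forall Q, {for Q, continuous (fun Q => \sum_i `|F i Q|)}.
Proof.
move=> cF Q; apply: (Ck_sum (k := 0) _ openT _).1 => // i.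
split=> // T _; apply: (@continuous_comp _ _ _ (F i) (fun x => `|x|)); first exact: cF.
exact: norm_continuous.
Qed.

(** Integration of a pointwise estimate, in the form used to localise: [z] is
    the weight of the test function and [w] collects the other errors. *)
Lemma Rintegral_approx m (f z w : 'rV[R]_m -> R) (a b d : R) :
  bounded_support f -> bounded_support z -> bounded_support w ->
  (forall y, `|f y - a * z y| <= b * z y + d * w y) ->
  `|\int[lam m]_y f y - a * \int[lam m]_y z y| <=
  b * \int[lam m]_y z y + d * \int[lam m]_y w y.
Proof.
move=> bf bz bw fz.
have If := bounded_support_integrable bf.
have Iz := bounded_support_integrable bz.
have Iw := bounded_support_integrable bw.
have Icz x : (lam m).-integrable setT (EFin \o (fun y => x * z y)).
  exact: integrableZ_EFin.
have Icw x : (lam m).-integrable setT (EFin \o (fun y => x * w y)).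
  exact: integrableZ_EFin.
have IB : (lam m).-integrable setT (EFin \o (fun y => f y - a * z y)).
  exact: integrableB_EFin.
have ID : (lam m).-integrable setT (EFin \o (fun y => b * z y + d * w y)).
  exact: integrableD_EFin.
rewrite -!RintegralZl// -RintegralB// -RintegralD//.
rewrite (le_trans (le_normr_Rintegral _ IB))//.
by apply: le_Rintegral => //; exact: integrable_norm IB.
Qed.

End sums.

Section layer.
Context (R : realType) (n : nat) (J : 'I_n.+1).
Notation ins := (@insert_coord R n.+1 J).
Notation leb := (@lebesgue_measure R).
Notation lam := (@lebesgue_rV R).
Context (S : 'rV[R]_n.+1 -> R) (g : 'rV[R]_n -> R) (sg c rho r : R) (P : 'rV[R]_n.+1).
Hypotheses (sS : smooth setT S) (ch : graph_chart J S P sg c rho r g).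
Let sg1 := chart_sg ch.
Let c0 := chart_c ch.
Let r0 := chart_r ch.
Let rrho := chart_rho ch.
Let dS := chart_partial ch.
Let growth := chart_growth ch.
Let gP := chart_graph ch.

Let rho0 : 0 < rho. Proof. exact: lt_le_trans rrho. Qed.

(** The part of the cube over the domain of the chart; unlike the cube itself
    it meets the zero set of [S] in the graph of [g] only, also when [r] is
    smaller than [rho]. *)
Definition box : set 'rV[R]_n.+1 :=
  [set Q : 'rV[R]_n.+1 | `|Q 0 J - P 0 J| < rho /\ `|col' J Q - col' J P| < r].

Lemma box_cube Q : box Q -> `|Q - P| < rho.
Proof.
move=> [QJ Qy]; rewrite -[Q](insert_coord_eta J) -[P](insert_coord_eta J).
rewrite insert_coordB; apply/norm_insert_coord; split=> //.
exact: lt_le_trans rrho.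
Qed.

Lemma box_ins s y : box (ins s y) <-> `|s - P 0 J| < rho /\ `|y - col' J P| < r.
Proof. by rewrite /box/= insert_coordJ col'_insert_coord. Qed.

Lemma open_box : open box.
Proof.
rewrite (_ : box = [set Q : 'rV[R]_n.+1 | `|Q 0 J - P 0 J| < rho] `&`
  (fun Q : 'rV[R]_n.+1 => col' J Q : 'rV[R]_n) @^-1` [set y | `|y - col' J P| < r])//.
apply: openI.
  rewrite (_ : [set Q | _] = (fun Q : 'rV[R]_n.+1 => Q 0 J) @^-1` (ball (P 0 J) rho)).
    by apply: open_comp => [Q _|]; [exact: coord_continuous|exact: ball_open].
  by apply/seteqP; split=> Q; rewrite /= -ball_normE/= distrC.
by apply: open_comp => [Q _|]; [exact: col'_continuous|exact: open_norm_ball].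
Qed.

Section side.
Variables (s : R) (y : 'rV[R]_n).
Hypotheses (sr : `|s - P 0 J| < rho) (yr : `|y - col' J P| < r).

Let gs : c * (s - g y) ^+ 2 <= sg * S (ins s y) * (s - g y).
Proof.
have [gy Sg] := gP yr; rewrite -[S (ins s y)]subr0 -{1}Sg; apply: growth => //.
by rewrite (lt_trans gy)// ltr_pdivrMr// ltr_pMr// ltr1n.
Qed.

(** The thin layer [|S| < eps] lies within [eps / c] of the graph. *)
Lemma zero_set_distance : c * `|s - g y| <= `|S (ins s y)|.
Proof.
have [->|sn] := eqVneq s (g y); first by rewrite subrr normr0 mulr0.
have sn0 : 0 < `|s - g y| by rewrite normr_gt0 subr_eq0.
rewrite -(ler_pM2r sn0) -mulrA -expr2 real_normK ?num_real//.
by rewrite (le_trans gs)// (le_trans (ler_norm _))// !normrM sg1 mul1r.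
Qed.

Lemma side_lower : s < g y -> sg * S (ins s y) < 0.
Proof.
rewrite -subr_lt0 => sn; rewrite -(nmulr_lgt0 _ sn) (lt_le_trans _ gs)//.
by rewrite mulr_gt0// exprn_even_gt0// (lt_eqF sn).
Qed.

Lemma side_upper : g y < s -> 0 < sg * S (ins s y).
Proof.
rewrite -subr_gt0 => sn; rewrite -(pmulr_lgt0 _ sn) (lt_le_trans _ gs)//.
by rewrite mulr_gt0// exprn_gt0.
Qed.

Lemma partialJ_gt0 : 0 < sg * partial J S (ins s y).
Proof. by rewrite (lt_le_trans c0)// dS//; apply: box_cube; exact/box_ins. Qed.

(** Along the [J]-axis [S] is monotone, so the profile [bump1 eps \o S]
    increases up to the graph and decreases after it. *)
Lemma layer_sign (eps : R) : 0 < eps ->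
  (s < g y -> 0 <= dbump1 eps (S (ins s y)) * partial J S (ins s y)) /\
  (g y < s -> dbump1 eps (S (ins s y)) * partial J S (ins s y) <= 0).
Proof.
move=> e0; have := partialJ_gt0; have := dbump1_sign (S (ins s y)) e0.
have sg0 : sg != 0 by rewrite -normr_gt0 sg1.
have E : S (ins s y) != 0 -> dbump1 eps (S (ins s y)) * partial J S (ins s y) =
  dbump1 eps (S (ins s y)) * S (ins s y) * (sg * partial J S (ins s y)) / (sg * S (ins s y)).
  by move=> S0; field; rewrite ?S0 ?sg0.
move=> B D; split=> [/side_lower|/side_upper] Ss.
  have S0 : S (ins s y) != 0 by apply: contraTneq Ss => ->; rewrite mulr0 ltxx.
  by rewrite E// mulr_le0 ?invr_le0 ?(ltW Ss)// mulr_le0_ge0// ltW.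
have S0 : S (ins s y) != 0 by apply: contraTneq Ss => ->; rewrite mulr0 ltxx.
by rewrite E// mulr_le0_ge0 ?invr_ge0 ?(ltW Ss)// mulr_le0_ge0// ltW.
Qed.

End side.

Context (z : 'rV[R]_n -> R).
Hypotheses (sz : smooth setT z) (z0 : forall y, 0 <= z y).
Hypothesis z_out : forall y, r / 2 <= `|y - col' J P| -> z y = 0.

Context (A : 'rV[R]_n.+1 -> 'rV[R]_n.+1) (al au eta K : R).
Hypothesis mA : forall i, measurable_fun box (fun Q => A Q 0 i).
Hypothesis AK : forall Q, box Q -> S Q != 0 -> `|A Q| <= K /\
  `|dot (A Q) (grad S Q) / partial J S Q - (if sg * S Q < 0 then al else au)| <= eta.

(** In the box this is the pairing of the field [A] with the gradient of the
    test function [z (col' J Q) * bump1 eps (S Q)]. *)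
Definition layer_density (eps : R) (Q : 'rV[R]_n.+1) : R :=
  bump1 eps (S Q) * dot (col' J (A Q)) (grad z (col' J Q)) +
  z (col' J Q) * (dbump1 eps (S Q) * dot (A Q) (grad S Q)).

(** The bounds on [A] hold off the zero set of [S]; removing this null set
    makes them valid everywhere. *)
Definition layer_integrand (eps : R) : 'rV[R]_n.+1 -> R :=
  layer_density eps \_ (box `&` [set Q | S Q != 0]).

(** The slice of the layer over [y]: the first term of the density is bounded
    by [D] in an interval of length [2 eps / c], and the second one is close
    to [z y] times the one-sided value of [A . grad S / d_J S] times the
    derivative of the profile, which integrates to [1] below the graph and to
    [-1] above it. *)
Lemma layer_slice (D eps : R) (y : 'rV[R]_n) : 0 < eps -> eps <= c * (rho / 4) -> 0 <= D ->
  (forall Q, box Q -> S Q != 0 -> `|dot (col' J (A Q)) (grad z (col' J Q))| <= D) ->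
  leb.-integrable setT (EFin \o (fun s => layer_integrand eps (ins s y))) ->
  `|y - col' J P| < r ->
  `|\int[leb]_s layer_integrand eps (ins s y) - z y * (al - au)| <=
    2 * (eta * z y) + 4 * (D * (eps / c)).
Proof.
move=> e0 ec D0 AD If yr.
have [gy Sg] := gP yr.
pose H s := bump1 eps (S (ins s y)).
pose k s := dbump1 eps (S (ins s y)) * partial J S (ins s y).
have dH s : is_derive s (1 : R) H (k s).
  have dSs := is_derive_insert (smooth_derivable sS (I : [set: 'rV[R]_n.+1] (ins s y)) (i := J)).
  exact: (@is_derive1_comp _ (bump1 eps) (fun s => S (ins s y)) s _ _ (is_derive_bump1 _ _) dSs).
have cSs f : smooth setT f -> continuous (fun s => f (ins s y)).
  move=> sf s; apply: (@continuous_comp _ _ _ (fun s => ins s y) f).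
    exact: insert_coord_continuousl.
  exact: smooth_continuous sf I.
have ck : continuous k.
  move=> s; apply: (@continuousM_for _ _ (fun s : R => dbump1 eps (S (ins s y))) (fun s : R => partial J S (ins s y))); last first.
    exact: (cSs _ (smooth_partial J sS)).
  apply: (@continuous_comp _ _ _ (fun s => S (ins s y)) (dbump1 eps)); first exact: cSs.
  exact: dbump1_continuous.
have del0 : 0 < eps / c by rewrite divr_gt0.
(* [g y] is within [rho / 2] of [P_J], so [a] and [b] are at distance at
   least [rho / 4] from it, beyond the support of the profile *)
pose a := P 0 J - 3 / 4 * rho; pose b := P 0 J + 3 / 4 * rho.
have agb : a < g y < b.
  move: gy rho0; rewrite /a /b ltr_norml => /andP[? ?] ?; apply/andP; split; lra.
have far s : `|s - P 0 J| < rho -> ~~ (a < s < b) -> eps <= `|S (ins s y)|.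
  move=> sr sab; apply: le_trans ec (le_trans _ (zero_set_distance sr yr)).
  rewrite ler_pM2l// leNgt; apply: contra sab; move: gy rho0; rewrite /a /b.
  rewrite !ltr_norml => /andP[? ?] ? /andP[? ?]; apply/andP; split; lra.
have ain : `|a - P 0 J| < rho.
  by have := rho0; rewrite /a ltr_norml => ?; apply/andP; split; lra.
have bin : `|b - P 0 J| < rho.
  by have := rho0; rewrite /b ltr_norml => ?; apply/andP; split; lra.
have Ha : H a = 0 by rewrite /H bump1_out// far// ltxx.
have Hb : H b = 0 by rewrite /H bump1_out// far// ltxx andbF.
have Hg : H (g y) = 1 by rewrite /H Sg bump1_0.
have fE s : `|s - P 0 J| < rho -> s != g y -> layer_integrand eps (ins s y) =
    bump1 eps (S (ins s y)) * dot (col' J (A (ins s y))) (grad z y) +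
    z y * (dbump1 eps (S (ins s y)) * dot (A (ins s y)) (grad S (ins s y))).
  move=> sr sgy; rewrite /layer_integrand patchE mem_set /layer_density ?col'_insert_coord//; split.
    exact/box_ins.
  rewrite /= -normr_gt0 (lt_le_trans _ (zero_set_distance sr yr))// mulr_gt0//.
  by rewrite normr_gt0 subr_eq0.
have est s d sgn : `|s - P 0 J| < rho -> s != g y ->
    (if sg * S (ins s y) < 0 then al else au) = d -> `|k s| = sgn * k s ->
    `|layer_integrand eps (ins s y) - z y * d * k s| <=
    eta * z y * (sgn * k s) + D * \1_`]g y - eps / c, g y + eps / c[ s.
  move=> sr sgy dE ksgn.
  have sbox : box (ins s y) by exact/box_ins.
  have S0 : S (ins s y) != 0.
    rewrite -normr_gt0 (lt_le_trans _ (zero_set_distance sr yr))// mulr_gt0//.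
    by rewrite normr_gt0 subr_eq0.
  have dJ0 : partial J S (ins s y) != 0.
    by have := partialJ_gt0 sr yr; apply: contraTneq => ->; rewrite mulr0 ltxx.
  have [_] := AK sbox S0; rewrite dE => Hd.
  rewrite fE// -ksgn.
  have -> : forall u v w, u + z y * (dbump1 eps (S (ins s y)) * v) - z y * w * k s =
      u + z y * (k s * (v / partial J S (ins s y) - w)).
    by move=> u v w; rewrite /k; field.
  rewrite (le_trans (ler_normD _ _))// addrC lerD//.
    rewrite normrM (ger0_norm (z0 y)) [eta * _]mulrC -[leRHS]mulrA ler_wpM2l//.
    by rewrite normrM [leRHS]mulrC ler_wpM2l.
  have := AD _ sbox S0; rewrite col'_insert_coord => HD.
  rewrite normrM indicE; case: (boolP (s \in _)) => [_|sout].
    rewrite mulr1 -[leRHS]mul1r ler_pM//.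
    by rewrite ger0_norm ?bump1_ge0// bump1_le1.
  rewrite bump1_out ?normr0 ?mul0r ?mulr0//.
  apply: le_trans (zero_set_distance sr yr); rewrite mulrC -ler_pdivrMr//.
  rewrite leNgt; apply: contra sout; rewrite inE/= in_itv/= -ltr_distl.
  by [].
have sg0 : sg != 0 by rewrite -normr_gt0 sg1.
have inr s : a < s < b -> `|s - P 0 J| < rho.
  by have := rho0; rewrite /a /b => ? /andP[? ?]; rewrite ltr_norml; apply/andP; split; lra.
have sl := @slice_estimate _ _ H k a (g y) b al au (z y) (eta * z y) D (eps / c) agb If dH ck D0 del0 Ha Hg Hb.
apply: sl.
- move=> s sab; rewrite /layer_integrand patchE; case: ifPn => // /set_mem[/box_ins[sr _] _].
  have es := far s sr sab; rewrite /layer_density bump1_out// dbump1_out//.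
  by rewrite !mul0r mulr0 addr0.
- move=> s /andP[as_ sgy]; have sr : `|s - P 0 J| < rho.
    by apply: inr; rewrite as_ (lt_trans sgy)//; case/andP: agb.
  apply: est => //; first by rewrite lt_eqF.
    by rewrite (side_lower sr yr sgy).
  by rewrite mul1r ger0_norm//; exact: (layer_sign sr yr e0).1.
- move=> s /andP[gys sb]; have sr : `|s - P 0 J| < rho.
    by apply: inr; rewrite sb andbT (lt_trans _ gys)//; case/andP: agb.
  apply: est => //; first by rewrite gt_eqF.
    by rewrite ltNge (ltW (side_upper sr yr gys)).
  by rewrite mulN1r ler0_norm//; exact: (layer_sign sr yr e0).2.
Qed.

Let cz : forall Q : 'rV[R]_n.+1, {for Q, continuous (fun Q => z (col' J Q))}.
Proof. by move=> Q; exact: smooth_continuous (smooth_col' J sz) I. Qed.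

Let cdz k : forall Q : 'rV[R]_n.+1,
  {for Q, continuous (fun Q => grad z (col' J Q) 0 k)}.
Proof.
move=> Q; rewrite (_ : (fun Q => _) = fun Q => partial k z (col' J Q)).
  exact: smooth_continuous (smooth_col' J (smooth_partial k sz)) I.
by apply/funext => T; rewrite mxE.
Qed.

Let cdS i : forall Q : 'rV[R]_n.+1, {for Q, continuous (fun Q => grad S Q 0 i)}.
Proof.
move=> Q; rewrite (_ : (fun Q => _) = partial i S).
  exact: smooth_continuous (smooth_partial i sS) I.
by apply/funext => T; rewrite mxE.
Qed.

Let cS (f : R -> R) : continuous f ->
  forall Q : 'rV[R]_n.+1, {for Q, continuous (fun Q => f (S Q))}.
Proof.
move=> cf Q; apply: (@continuous_comp _ _ _ S f); last exact: cf.
exact: smooth_continuous sS I.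
Qed.

Let box_bounded Q : box Q -> `|Q| <= `|P| + rho.
Proof.
move=> /box_cube QP; rewrite -(subrK P Q) addrC (le_trans (ler_normD _ _))//.
by rewrite lerD2l ltW.
Qed.

Let col'_le (Q : 'rV[R]_n.+1) : `|col' J Q| <= `|Q|.
Proof. by apply: normr_rV_le => // k; rewrite mxE normr_coord. Qed.

Let AK1 Q : box Q -> S Q != 0 -> `|A Q| <= `|K|.
Proof. by move=> bQ SQ; rewrite (le_trans (AK bQ SQ).1)// ler_norm. Qed.

Let dot_grad_z : exists2 D : R, 0 <= D & forall Q, box Q -> S Q != 0 ->
  `|dot (col' J (A Q)) (grad z (col' J Q))| <= D.
Proof.
have [C C0 HC] := bounded_on_ball (`|P| + rho) (sum_norm_continuous cdz).
exists (C * `|K|); first by rewrite mulr_ge0.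
move=> Q bQ SQ; rewrite (le_trans (dot_le _ _))// ler_pM ?sumr_ge0//.
  by rewrite (le_trans (ler_norm _))// HC// box_bounded.
by rewrite (le_trans (col'_le _))// AK1.
Qed.

Let continuous_measurable_box (f : 'rV[R]_n.+1 -> R) D :
  (forall Q, {for Q, continuous f}) -> measurable_fun D f.
Proof.
by move=> cf; apply: measurable_funTS; apply: continuous_measurable_rV => //; exact: openT.
Qed.

Lemma measurable_layer_density (eps : R) : measurable_fun box (layer_density eps).
Proof.
apply: measurable_funD; apply: measurable_funM.
- exact: (continuous_measurable_box (cS (@bump1_continuous R eps))).
- apply: measurable_dot => k; last exact: (continuous_measurable_box (@cdz k)).
  rewrite (_ : (fun Q => _) = fun Q => A Q 0 (lift J k)); first exact: mA.
  by apply/funext => Q; rewrite mxE.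
- exact: (continuous_measurable_box cz).
- apply: measurable_funM.
    exact: (continuous_measurable_box (cS (@dbump1_continuous R eps))).
  by apply: measurable_dot => i; [exact: mA|exact: (continuous_measurable_box (@cdS i))].
Qed.

Lemma layer_bounded_support (eps : R) : bounded_support (layer_integrand eps).
Proof.
have oD : open (box `&` [set Q | S Q != 0]).
  apply: openI; first exact: open_box.
  apply: (@open_comp _ _ S [set x | x != 0]); last exact: open_neq.
  by move=> Q _; exact: smooth_continuous sS I.
have mD := open_measurable_rV oD.
have mbox : measurable box by apply: open_measurable_rV; exact: open_box.
split.
  apply/(measurable_restrictT _ mD).
  by apply: (measurable_funS mbox _ (measurable_layer_density eps)) => Q [].
have [D D0 HD] := dot_grad_z.
have [C1 C10 HC1] := bounded_on_ball (`|P| + rho) (cS (@bump1_continuous R eps)).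
have [C2 C20 HC2] := bounded_on_ball (`|P| + rho) cz.
have [C3 C30 HC3] := bounded_on_ball (`|P| + rho) (cS (@dbump1_continuous R eps)).
have [C4 C40 HC4] := bounded_on_ball (`|P| + rho) (sum_norm_continuous cdS).
pose C := C1 * D + C2 * (C3 * (C4 * `|K|)).
have C0 : 0 <= C by rewrite addr_ge0// !mulr_ge0.
exists (C + (1 + `|P| + rho)); first by rewrite ltr_wpDl// addr_gt0// ltr_pwDl.
move=> Q; rewrite /layer_integrand patchE; case: ifPn => [/set_mem[bQ SQ]|_]; last first.
  by rewrite normr0 addr_ge0// addr_ge0 ?(ltW rho0)// addr_ge0.
have Qr := box_bounded bQ; split; last first.
  move=> CQ; exfalso; move: CQ; apply/negP; rewrite -ltNge (le_lt_trans Qr)//.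
  have -> : C + (1 + `|P| + rho) = `|P| + rho + (1 + C) by ring.
  by rewrite ltrDl ltr_pwDl.
apply: (@le_trans _ _ C); last by rewrite lerDl addr_ge0 ?(ltW rho0)// addr_ge0.
rewrite (le_trans (ler_normD _ _))// lerD//.
  by rewrite normrM ler_pM// ?HC1// HD.
rewrite normrM ler_pM ?HC2// normrM ler_pM ?HC3// (le_trans (dot_le _ _))//.
rewrite ler_pM ?sumr_ge0// ?AK1//.
by rewrite (le_trans (ler_norm _))// HC4.
Qed.

(** As [eps] tends to [0] only the jump across the front survives, up to the
    oscillation [eta] of the field on both sides. *)
Lemma layer_limit : exists C : R, forall eps : R, 0 < eps -> eps <= c * (rho / 4) ->
  `|\int[lam n.+1]_Q layer_integrand eps Q - (al - au) * \int[lam n]_y z y| <=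
  2 * eta * \int[lam n]_y z y + C * eps.
Proof.
have [D D0 HD] := dot_grad_z.
pose W := [set y : 'rV[R]_n | `|y - col' J P| < r].
have bW : bounded_support (\1_W : 'rV[R]_n -> R).
  split; first by apply: measurable_indic; exact: measurable_cube.
  exists (1 + `|P| + r); first by rewrite addr_gt0// ltr_pwDl.
  move=> y; rewrite indicE; case: (boolP (y \in W)) => [/set_mem Wy|_]; last first.
    by rewrite normr0 addr_ge0 ?(ltW r0)// addr_ge0.
  rewrite normr1 -addrA lerDl addr_ge0 ?(ltW r0)//; split=> // yr; exfalso.
  have ylt : `|y| <= `|P| + r.
    rewrite -(subrK (col' J P) y) addrC (le_trans (ler_normD _ _))//.
    by rewrite lerD ?col'_le ?ltW.
  by move: yr; apply/negP; rewrite -ltNge (le_lt_trans ylt)// ltrDr.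
have bz : bounded_support z.
  apply: (@continuous_bounded_support _ _ _ (`|P| + r / 2)).
    by move=> y; exact: smooth_continuous sz I.
  move=> y yr; apply: z_out; rewrite -(lerD2l `|P|) (le_trans yr)//.
  rewrite -{1}(subrK (col' J P) y) addrC (le_trans (ler_normD _ _))//.
  by rewrite lerD2r.
exists (4 * (D / c) * \int[lam n]_y (\1_W y : R)) => eps e0 ec.
have bh := layer_bounded_support eps.
have [bI ->] := fubini_bounded_support J bh.
rewrite [4 * _ * _ * _]mulrAC; apply: Rintegral_approx => // y.
rewrite [(al - au) * _]mulrC indicE; case: (boolP (y \in W)) => [/set_mem Wy|nWy].
  rewrite mulr1.
  have -> : 2 * eta * z y = 2 * (eta * z y) by rewrite mulrA.
  have -> : 4 * (D / c) * eps = 4 * (D * (eps / c)) by rewrite -!mulrA [c^-1 * _]mulrC.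
  by apply: layer_slice => //; exact: bounded_support_slice.
have zy : z y = 0.
  apply: z_out; rewrite (@le_trans _ _ r)//.
    by rewrite ler_pdivrMr// ler_peMr ?ler1n// ltW.
  by rewrite leNgt; apply: contra nWy; rewrite inE.
rewrite zy !mulr0 mul0r subr0 addr0 (@eq_Rintegral _ _ _ _ _ (fun=> 0)).
  by rewrite Rintegral_cst// mul0r normr0.
move=> s _; rewrite /layer_integrand patchE; case: ifPn => // /set_mem[/box_ins[_ yr] _].
by exfalso; move: nWy; apply/negP; rewrite negbK inE.
Qed.

End layer.

(** * The test functions *)

Section layer_test.
Context (R : realType) (n : nat) (J : 'I_n.+1).
Notation ins := (@insert_coord R n.+1 J).
Notation leb := (@lebesgue_measure R).
Notation lam := (@lebesgue_rV R).
Context (S : 'rV[R]_n.+1 -> R) (g : 'rV[R]_n -> R) (sg c rho r : R) (P : 'rV[R]_n.+1).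
Hypotheses (sS : smooth setT S) (ch : graph_chart J S P sg c rho r g).
Let c0 := chart_c ch.
Let r0 := chart_r ch.
Let rrho := chart_rho ch.
Let gP := chart_graph ch.

Let rho0 : 0 < rho. Proof. exact: lt_le_trans rrho. Qed.

Context (z : 'rV[R]_n -> R).
Hypothesis sz : smooth setT z.
Hypothesis z_out : forall y, r / 2 <= `|y - col' J P| -> z y = 0.

Notation box := (box J rho r P).

(** A product of a bump along the front, transported parallel to the
    [J]-axis, and of a bump across it that depends on [S] only: on the front
    the second factor is constant, so it has no tangential derivatives. *)
Definition layer_test (eps : R) : 'rV[R]_n.+1 -> R :=
  (fun Q => z (col' J Q) * bump1 eps (S Q)) \_ box.

Let core : set 'rV[R]_n.+1 := [set Q : 'rV[R]_n.+1 | `|Q 0 J - P 0 J| <= 3 / 4 * rho] `&`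
  [set Q | `|col' J Q - col' J P| <= r / 2].

Let closed_core : closed core.
Proof.
apply: closedI.
  apply: (@closed_comp _ _ (fun Q : 'rV[R]_n.+1 => `|Q 0 J - P 0 J|) [set x : R | x <= 3 / 4 * rho]).
    move=> Q _; apply: (@continuous_comp _ _ _ (fun Q : 'rV[R]_n.+1 => Q 0 J - P 0 J) (fun x => `|x|)).
      by apply: continuousB; [exact: coord_continuous|exact: cst_continuous_for].
    exact: norm_continuous.
  exact: closed_le.
apply: (@closed_comp _ _ (fun Q : 'rV[R]_n.+1 => `|col' J Q - col' J P|) [set x : R | x <= r / 2]).
  move=> Q _; apply: (@continuous_comp _ _ _ (fun Q : 'rV[R]_n.+1 => (col' J Q - col' J P : 'rV[R]_n)) (fun x => `|x|)).
    by apply: continuousB; [exact: col'_continuous|exact: cst_continuous_for].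
  exact: norm_continuous.
exact: closed_le.
Qed.

Let core_box : core `<=` box.
Proof.
move=> Q [QJ Qy]; split.
  by rewrite (le_lt_trans QJ)// gtr_pMl// ltr_pdivrMr// mul1r ltr_nat.
by rewrite (le_lt_trans Qy)// ltr_pdivrMr// ltr_pMr// ltr1n.
Qed.

Section small.
Variable eps : R.
Hypotheses (e0 : 0 < eps) (ec : eps <= c * (rho / 4)).

Let out_core Q : box Q -> ~ core Q -> z (col' J Q) * bump1 eps (S Q) = 0.
Proof.
move=> bQ nQ; have [QJ Qy] := bQ.
have [zQ|zQ] := leP (r / 2) `|col' J Q - col' J P|; first by rewrite z_out// mul0r.
rewrite bump1_out ?mulr0//; apply: (le_trans ec).
have [gy _] := gP Qy.
have QE : ins (Q 0 J) (col' J Q) = Q by exact: insert_coord_eta.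
have := zero_set_distance ch QJ Qy; rewrite QE.
apply: le_trans; rewrite ler_pM2l//.
have QJ' : 3 / 4 * rho < `|Q 0 J - P 0 J|.
  by rewrite ltNge; apply/negP => QJ'; apply: nQ; split=> //=; exact: ltW.
have := ler_normD (Q 0 J - g (col' J Q)) (g (col' J Q) - P 0 J); rewrite subrKA.
move: QJ' gy; set u := `|_|; set v := `|_|; set w := `|_|.
by move: u v w => u v w; lra.
Qed.

Let spre : smooth setT (fun Q => z (col' J Q) * bump1 eps (S Q)).
Proof.
apply: smoothM; [exact: openT|exact: smooth_col'|].
exact: (smooth_bump1 eps openT sS).
Qed.

Lemma smooth_layer_test : smooth setT (layer_test eps).
Proof.
move=> k; apply: (smooth_patch (K := core)) => //; first exact: open_box.
exact: Ck_sub (@subsetT _ _) (spre k).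
Qed.

Lemma test_function_layer_test : test_function (layer_test eps).
Proof.
split; first exact: smooth_layer_test.
exists core; last first.
  move=> Q nQ; rewrite /layer_test patchE; case: ifPn => // /set_mem bQ.
  exact: out_core.
apply: bounded_closed_compact => //.
exists (`|P| + rho); split; first by rewrite num_real.
move=> x Px Q /core_box/(box_cube ch) QP /=; rewrite -(subrK P Q) addrC.
rewrite (le_trans (ler_normD _ _))// (le_trans _ (ltW Px))//.
by rewrite lerD2l ltW.
Qed.

Lemma layer_test_grad Q : box Q -> grad (layer_test eps) Q =
  bump1 eps (S Q) *: ins 0 (grad z (col' J Q)) +
  (z (col' J Q) * dbump1 eps (S Q)) *: grad S Q.
Proof.
move=> bQ; apply/rowP => i; rewrite [LHS]mxE.
rewrite (partial_patch _ _ _ bQ); last exact: open_box.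
rewrite (partialM _ (smooth_col' J sz) (smooth_bump1 eps openT sS) I).
rewrite -grad_col' !mxE mulrC; congr (_ + _); rewrite -mulrA; congr (_ * _).
have dSi := smooth_derivable sS (I : [set: 'rV[R]_n.+1] Q) (i := i).
by rewrite /partial; have [_ ->] := is_derive_comp1 dSi (is_derive_bump1 eps (S Q)).
Qed.

Lemma layer_test_out Q : ~ box Q -> layer_test eps Q = 0 /\ grad (layer_test eps) Q = 0.
Proof.
move=> nQ; split; first by rewrite /layer_test patchE memNset.
apply/rowP => i; rewrite !mxE.
apply: (partial_patch0 (K := core)) => //; first exact: open_box.
by move=> /core_box.
Qed.

End small.

Let measurable_zero : measurable (box `&` [set Q | S Q = 0]).
Proof.
apply: measurableI; first by apply: open_measurable_rV; exact: open_box.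
apply: closed_measurable_rV; apply: (@closed_comp _ _ S [set x | x = 0]).
  by move=> Q _; exact: smooth_continuous sS I.
exact: closed_eq.
Qed.

(** Every line parallel to the [J]-axis meets this set in one point at most. *)
Lemma zero_set_null : lam n.+1 (box `&` [set Q | S Q = 0]) = 0%E.
Proof.
set Z := _ `&` _; have mZ : measurable Z := measurable_zero.
have mindic : measurable_fun setT (fun Q : 'rV[R]_n.+1 => (\1_Z Q)%:E : \bar R).
  exact/measurable_EFinP.
have -> : lam n.+1 Z = (\int[lam n.+1]_Q (\1_Z Q)%:E)%E by rewrite integral_indic// setIT.
rewrite (tonelli_rV J mindic) => [|Q]; last by rewrite lee_fin.
apply: integral0_eq => y _.
rewrite (_ : (fun s => _) = (fun s => (\1_[set s | Z (ins s y)] s)%:E)); last first.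
  by apply/funext => s; rewrite !indicE.
have Zg : [set s | Z (ins s y)] `<=` [set g y].
  move=> s [/box_ins[sr yr] S0] /=; apply/eqP; rewrite -subr_eq0 -normr_eq0 eq_le normr_ge0 andbT.
  rewrite -(ler_pM2l c0) mulr0 (le_trans (zero_set_distance ch sr yr))//.
  by rewrite S0 normr0.
have [->|->] := subset_set1 Zg.
  by rewrite integral_indic// set0I measure0.
by rewrite integral_indic// setIT; exact: lebesgue_measure_set1.
Qed.

Lemma layer_test_bulk (A : 'rV[R]_n.+1 -> 'rV[R]_n.+1) (D : set 'rV[R]_n.+1) (eps : R) :
  0 < eps -> eps <= c * (rho / 4) -> box `<=` D ->
  (forall i, measurable_fun box (fun Q => A Q 0 i)) ->
  \int[lam n.+1]_(Q in D) dot (A Q) (grad (layer_test eps) Q) =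
  \int[lam n.+1]_Q layer_integrand J S rho r P z A eps Q.
Proof.
move=> e0 ec bD mA.
have mbox : measurable box by apply: open_measurable_rV; exact: open_box.
have mf := measurable_layer_density sS sz mA eps.
have oD : open (box `&` [set Q | S Q != 0]).
  apply: openI; first exact: open_box.
  apply: (@open_comp _ _ S [set x | x != 0]); last exact: open_neq.
  by move=> Q _; exact: smooth_continuous sS I.
have mD := open_measurable_rV oD.
transitivity (\int[lam n.+1]_Q (layer_density J S z A eps \_ box) Q).
  rewrite Rintegral_mkcond; apply: eq_Rintegral => Q _; rewrite !patchE.
  case: (boolP (Q \in box)) => [/set_mem bQ|/negP nbQ].
    rewrite mem_set; last exact: bD.
    rewrite layer_test_grad// dotC dotDl !dotZl dotC [dot (grad S Q) _]dotC.
    rewrite [dot (A Q) (ins _ _)]dotC dot_insert_coord mul0r add0r [dot (grad z _) _]dotC.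
    by rewrite -mulrA.
  case: ifPn => // _; have [|_ ->] := layer_test_out e0 ec (Q := Q); last first.
    by rewrite dotC /dot big1// => i _; rewrite mxE mul0r.
  by move=> bQ; apply: nbQ; rewrite inE.
congr fine; apply: ae_eq_integral => //.
- by apply/measurable_EFinP; exact/(measurable_restrictT _ mbox).
- apply/measurable_EFinP; apply/(measurable_restrictT _ mD).
  by apply: (measurable_funS mbox _ mf) => Q [].
exists (box `&` [set Q | S Q = 0]); split.
- exact: measurable_zero.
- exact: zero_set_null.
move=> Q /= H; apply: contrapT => nQ; apply: H => _; congr EFin.
rewrite /layer_integrand !patchE.
case: (boolP (Q \in box)) => [/set_mem bQ|nbQ].
  by rewrite mem_set//; split=> //; apply/negP => /eqP SQ; apply: nQ.
by rewrite memNset// => -[bQ _]; move: nbQ; rewrite mem_set.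
Qed.

End layer_test.

(** * Divergence along a graph *)

Section graph_calculus.
Context (R : realType) (n : nat) (J : 'I_n.+1).
Notation ins := (@insert_coord R n.+1 J).
Implicit Types (S : 'rV[R]_n.+1 -> R) (Q : 'rV[R]_n.+1).

(** The algebra behind the next lemma, with [d] for the derivatives of [S],
    [b] and [a] for the derivatives of the field along its own direction and
    along [J], and [w i] for [h_i d_i d_J S]. *)
Let graph_divergence_sum (w d a b : 'I_n.+1 -> R) (B : R) : B != 0 -> d J = B -> a J = b J ->
  \sum_i (a i * d i + w i) = 0 ->
  \sum_k (b (lift J k) + a (lift J k) * (- d (lift J k) / B)) =
  (\sum_i (b i * B + w i)) / B.
Proof.
move=> B0 dJ abJ; rewrite big_split/= => /eqP; rewrite addrC addr_eq0 => /eqP E.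
have -> : \sum_i (b i * B + w i) = \sum_i b i * B - \sum_i a i * d i.
  by rewrite big_split/= E.
rewrite (bigD1_ord J)//= [X in _ - X](bigD1_ord J)//= dJ abJ.
rewrite opprD addrACA subrr add0r -sumrB mulr_suml; apply: eq_bigr => k _.
by field.
Qed.

(** The divergence, in the coordinates of the graph, of a field [h] tangent to
    the level sets of [S]. The tangency relation, differentiated along [J],
    trades the terms coming from the slope [d_k g = - d_k S / d_J S] of the
    graph for the missing component [h_J] and for the derivatives of [d_J S],
    the mixed derivatives of [S] being symmetric. *)
Lemma graph_divergence S V (h : 'I_n.+1 -> 'rV[R]_n.+1 -> R) Q :
  smooth setT S -> open V -> (forall i, smooth V (h i)) ->
  (forall T, V T -> \sum_i h i T * partial i S T = 0) ->
  V Q -> partial J S Q != 0 ->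
  \sum_k (partial (lift J k) (h (lift J k)) Q +
    partial J (h (lift J k)) Q * (- partial (lift J k) S Q / partial J S Q)) =
  (\sum_i partial i (fun T => h i T * partial J S T) Q) / partial J S Q.
Proof.
move=> sS oV sh tan VQ B0.
have sp i : smooth V (partial i S).
  by apply: (smooth_sub (@subsetT _ _)); exact: smooth_partial.
have E0 : partial J (fun T => \sum_i h i T * partial i S T) Q = 0.
  by rewrite (partial_eq J oV VQ tan); exact: derive_cst.
have E1 : partial J (fun T => \sum_i h i T * partial i S T) Q =
    \sum_i partial J (fun T => h i T * partial i S T) Q.
  by apply: (partial_sum (V := V)) => [i|//]; exact: smoothM.
have E2 i : partial J (fun T => h i T * partial i S T) Q =
    partial J (h i) Q * partial i S Q + h i Q * partial i (partial J S) Q.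
  by rewrite (partialM _ (sh i) (sp i) VQ) (schwarz _ _ openT sS I).
have E3 i : partial i (fun T => h i T * partial J S T) Q =
    partial i (h i) Q * partial J S Q + h i Q * partial i (partial J S) Q.
  exact: (partialM _ (sh i) (sp J) VQ).
rewrite (eq_bigr _ (fun i _ => E3 i)).
exact: (@graph_divergence_sum (fun i => h i Q * partial i (partial J S) Q)
  (fun i => partial i S Q) (fun i => partial J (h i) Q) (fun i => partial i (h i) Q)
  (partial J S Q) B0 (erefl _) (erefl _)
  (esym (etrans (esym E0) (etrans E1 (eq_bigr _ (fun i _ => E2 i)))))).
Qed.

Lemma graph_comp_Ck1 V W (f : 'rV[R]_n.+1 -> R) (g : 'rV[R]_n -> R) :
  open V -> smooth V f -> open W -> Ck 1 W g ->
  (forall y, W y -> V (ins (g y) y)) -> Ck 1 W (fun y => f (ins (g y) y)).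
Proof.
move=> oV sf oW Cg gV.
have ch f' (sf' : smooth V f') y (Wy : W y) := graph_chain oV (sf' 1) oW Cg (gV _ Wy) Wy.
have C0 f' : smooth V f' -> Ck 0 W (fun y => f' (ins (g y) y)).
  by move=> sf'; split=> // y Wy; exact/differentiable_continuous/(ch _ sf' _ Wy).1.
split=> [y Wy|k]; first exact: (C0 _ sf).1.
split=> [y Wy|]; first exact: diff_derivable (ch _ sf _ Wy).1.
apply: (@Ck_eq _ _ 0 W (fun y => partial (lift J k) f (ins (g y) y) +
    partial J f (ins (g y) y) * partial k g y) _ oW).
  by move=> y Wy; rewrite (ch _ sf _ Wy).2.
have [_ /(_ k)[_ Cgk]] := Cg.
apply: CkD => //; first exact/C0/smooth_partial.
by apply: CkM => //; exact/C0/smooth_partial.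
Qed.

(** Both [1 + |grad g|^2] and [1 + G^2] are quotients of the square of the
    space-time gradient of [S], by [(d_J S)^2] and by [|grad_x S|^2]. *)
Lemma area_ratio S Q (g : 'rV[R]_n -> R) y : regular S Q -> partial J S Q != 0 ->
  (forall k, partial k g y = - partial (lift J k) S Q / partial J S Q) ->
  Num.sqrt (1 + dot (grad g y) (grad g y)) / Num.sqrt (1 + Defs.G S Q ^+ 2) =
  enorm (gradx S Q) / `|partial J S Q|.
Proof.
move=> rQ B0 dg; have q0 : 0 < sqgradx S Q by [].
pose N := dot (grad S Q) (grad S Q).
have N0 : 0 < N.
  by rewrite /N gradE dot_pt ltr_wpDl// -expr2 sqr_ge0.
have B20 : 0 < partial J S Q ^+ 2 by rewrite exprn_even_gt0.
have -> : 1 + dot (grad g y) (grad g y) = N / partial J S Q ^+ 2.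
  rewrite /N /dot (bigD1_ord J)//= [grad S Q 0 J]mxE mulrDl -expr2 divff ?gt_eqF//.
  congr (_ + _); rewrite mulr_suml; apply: eq_bigr => k _; rewrite !mxE dg.
  by move: B0; generalize (partial J S Q) (partial (lift J k) S Q) => B d B0; field.
have -> : 1 + Defs.G S Q ^+ 2 = N / sqgradx S Q.
  rewrite /N gradE dot_pt -/(sqgradx S Q) addrC mulrDl divff ?gt_eqF//; congr (_ + _).
  rewrite /Defs.G exprMn sqrrN exprVn sqr_sqrtr ?expr2//; exact: ltW.
rewrite !sqrtrM ?ltW// !sqrtrV ?ltW// sqrtr_sqr /enorm -/(sqgradx S Q).
have sN0 : Num.sqrt N != 0 by rewrite gt_eqF// sqrtr_gt0.
have sq0 : Num.sqrt (sqgradx S Q) != 0 by rewrite gt_eqF// sqrtr_gt0.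
have aB : `|partial J S Q| != 0 by rewrite normr_eq0.
have alg (a b d : R) : a != 0 -> b != 0 -> d != 0 -> a / d / (a / b) = b / d.
  by move=> a0 b0 d0; field; rewrite ?a0 ?b0 ?d0.
exact: alg.
Qed.

End graph_calculus.

Section zero_integrals.
Context (R : realType).
Notation lam := (@lebesgue_rV R).

Lemma Rintegral_sum0 m k (F : 'I_k -> 'rV[R]_m -> R) :
  (forall i, bounded_support (F i)) -> (forall i, \int[lam m]_y F i y = 0) ->
  (lam m).-integrable setT (EFin \o (fun y => \sum_i F i y)) /\
  \int[lam m]_y \sum_i F i y = 0.
Proof.
elim: k F => [|k IH] F bF F0.
  rewrite (_ : (fun y => _) = fun=> 0); last by apply/funext => y; rewrite big_ord0.
  split; last by rewrite Rintegral_cst// mul0r.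
  exact: integrable0.
rewrite (_ : (fun y => _) = fun y => F ord0 y + \sum_i F (lift ord0 i) y); last first.
  by apply/funext => y; rewrite big_ord_recl.
have [Is s0] := IH (fun i => F (lift ord0 i)) (fun i => bF _) (fun i => F0 _).
have I0 := bounded_support_integrable (bF ord0).
by split; [exact: integrableD_EFin|rewrite RintegralD// F0 s0 addr0].
Qed.

End zero_integrals.

(** * The front term *)

Section front_term.
Context (R : realType) (n : nat) (J : 'I_n.+1).
Notation ins := (@insert_coord R n.+1 J).
Notation lam := (@lebesgue_rV R).
Context (S : 'rV[R]_n.+1 -> R) (g : 'rV[R]_n -> R) (sg c rho r : R) (P : 'rV[R]_n.+1).
Hypothesis S_front : moving_front S.
Hypothesis ch : graph_chart J S P sg c rho r g.
Let sg1 := chart_sg ch.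
Let c0 := chart_c ch.
Let r0 := chart_r ch.
Let rrho := chart_rho ch.
Let dS := chart_partial ch.
Let gP := chart_graph ch.
Context (z : 'rV[R]_n -> R).
Hypothesis sz : smooth setT z.
Hypothesis z_out : forall y, r / 2 <= `|y - col' J P| -> z y = 0.

Notation box := (box J rho r P).

Context (mu : {measure set 'rV[R]_n.+1 -> \bar R}) (Omega V : set 'rV[R]_n.+1).
Hypothesis mu_area : is_surface_measure (Gamma S) mu.
Hypotheses (Omega_open : open Omega) (Omega_upper : Omega `<=` @upper_half_space R n).
Notation M := (Gamma S `&` Omega).
Context (a at_ : 'rV[R]_n.+1 -> R).
Hypotheses (oV : open V) (Vr : V `<=` regular S) (sa : smooth V at_).
Hypotheses (ea : smooth_extension M a at_) (boxV : box `<=` V) (boxO : box `<=` Omega).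

Let sS : smooth [set: 'rV[R]_n.+1] S := S_front.1.
Let B Q := partial J S Q.
Let W := [set y : 'rV[R]_n | `|y - col' J P| < r].
Let oW : open W. Proof. exact: open_norm_ball. Qed.
Let Cg : Ck 1 W g. Proof. exact: graph_Ck1 sS ch. Qed.
Let obox : open box. Proof. exact: open_box. Qed.

Let graph_box y : W y -> box (ins (g y) y).
Proof.
move=> Wy; apply/box_ins; split=> //; have [gy _] := gP Wy.
rewrite (lt_le_trans gy)// ler_pdivrMr// ler_peMr ?ler1n//.
exact: le_trans (ltW r0) rrho.
Qed.

Let graph_front y : W y -> M (ins (g y) y).
Proof.
move=> Wy; have OQ := boxO (graph_box Wy); split=> //; split; last exact: (gP Wy).2.
exact/ltW/Omega_upper.
Qed.

Let B_gt0 Q : box Q -> 0 < sg * B Q.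
Proof. by move=> bQ; rewrite (lt_le_trans c0)// dS// (box_cube ch bQ). Qed.

Let B_neq0 Q : box Q -> B Q != 0.
Proof. by move/B_gt0; apply: contraTneq => ->; rewrite mulr0 ltxx. Qed.

Let absB Q : box Q -> `|B Q| = sg * B Q.
Proof. by move=> bQ; rewrite -[LHS]mul1r -sg1 -normrM gtr0_norm// B_gt0. Qed.

(* the transport field divided by [|d_J S|], which is the density of the
   front relative to the coordinates of the graph *)
Let field_ i Q := transport_field S at_ i Q * rsqrt (B Q * B Q).

Let field_B i Q : box Q -> field_ i Q * B Q = sg * transport_field S at_ i Q.
Proof.
move=> bQ; have sg0 : sg != 0 by rewrite -normr_gt0 sg1.
have sg2 : sg * sg = 1 by rewrite -expr2 -[LHS]ger0_norm ?sqr_ge0// normrX sg1 expr1n.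
rewrite /field_ /rsqrt -expr2 sqrtr_sqr absB// invfM mulrA mulfVK; last exact: B_neq0.
by rewrite mulrC; congr (_ * _); rewrite -[LHS]mul1r -sg2 mulfK.
Qed.

Let smooth_field_ i : smooth box (field_ i).
Proof.
apply: smoothM => //.
  by apply: (smooth_sub boxV); exact: smooth_transport_field.
have sB : smooth box B by apply: (smooth_sub (@subsetT _ _)); exact: smooth_partial.
apply: smooth_rsqrt => //; first exact: smoothM.
by move=> Q bQ; rewrite -expr2 exprn_even_gt0// B_neq0.
Qed.

Let field_tangent Q : box Q -> \sum_i field_ i Q * partial i S Q = 0.
Proof.
move=> bQ; have rQ := Vr (boxV bQ).
transitivity (at_ Q * enorm (gradx S Q) * rsqrt (B Q * B Q) *
  dot (pt 1 (Udelta S Q)) (grad S Q)); last by rewrite ddt_level// mulr0.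
rewrite mulr_sumr; apply: eq_bigr => i _; rewrite /field_ transport_fieldE// [grad S Q 0 i]mxE.
by rewrite [RHS]mulrA; congr (_ * _); rewrite mulrAC.
Qed.

Let flux k y := field_ (lift J k) (ins (g y) y).

Let C_flux k : Ck 1 W (flux k).
Proof. exact: graph_comp_Ck1 obox (smooth_field_ _) oW Cg graph_box. Qed.

(** The left-hand side of the Rankine-Hugoniot condition, weighted by the
    factor [|grad_x S| / |d_J S|] that converts the measure
    [d mu / sqrt(1 + G^2)] of the front into [dy]. *)
Definition front_density (y : 'rV[R]_n) : R :=
  let Q := ins (g y) y in enorm (gradx S Q) / `|partial J S Q| *
    (delta_t S M a Q + tangent_div S M (fun Q => a Q *: Udelta S Q) Q).

Let front_divergence y : W y -> \sum_k partial k (flux k) y = front_density y.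
Proof.
move=> Wy; have bQ := graph_box Wy; set Q := ins (g y) y in bQ.
have [_ dg] := graph_diff sS ch Wy.
have E k : partial k (flux k) y = partial (lift J k) (field_ (lift J k)) Q +
    partial J (field_ (lift J k)) Q * (- partial (lift J k) S Q / partial J S Q).
  have [_ ->] := graph_chain obox (smooth_field_ (lift J k) 1) oW Cg bQ Wy.
  by rewrite dg.
rewrite (eq_bigr _ (fun k _ => E k)).
rewrite (graph_divergence sS obox smooth_field_ field_tangent bQ (B_neq0 bQ)).
have E2 i : partial i (fun T => field_ i T * partial J S T) Q =
    sg * partial i (transport_field S at_ i) Q.
  rewrite (@partial_eq _ _ box _ (fun T => sg * transport_field S at_ i T) i Q obox bQ).
    have dT := smooth_derivable (smooth_transport_field sS i oV Vr sa) (boxV bQ) (i := i).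
    by rewrite /partial; exact: (deriveZ sg dT).
  exact: field_B.
rewrite (eq_bigr _ (fun i _ => E2 i)) -mulr_sumr.
rewrite (front_transport S_front Omega_open Omega_upper oV Vr sa ea (graph_front Wy) (boxV bQ)).
rewrite /front_density -/Q -/(B Q) absB// mulrA mulrAC; congr (_ * _).
have sg0 : sg != 0 by rewrite -normr_gt0 sg1.
have sg2 : sg * sg = 1 by rewrite -expr2 -[LHS]ger0_norm ?sqr_ge0// normrX sg1 expr1n.
rewrite invfM mulrA; congr (_ / _).
by rewrite mulrC -[in RHS](mulr1 (enorm _)) -sg2 mulrA mulfK.
Qed.

Let K := [set y : 'rV[R]_n | `|y - col' J P| <= r / 2].

Let closed_K : closed K.
Proof.
apply: (@closed_comp _ _ (fun y : 'rV[R]_n => `|y - col' J P|) [set x : R | x <= r / 2]).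
  move=> y _; apply: (@continuous_comp _ _ _ (fun y : 'rV[R]_n => y - col' J P) (fun x => `|x|)).
    by apply: continuousB; [exact: id_continuous_for|exact: cst_continuous_for].
  exact: norm_continuous.
exact: closed_le.
Qed.

Let KW : K `<=` W.
Proof. by move=> y Ky; rewrite /W/= (le_lt_trans Ky)// ltr_pdivrMr// ltr_pMr// ltr1n. Qed.

Let zK y : ~ K y -> z y = 0.
Proof. by move=> nK; apply: z_out; rewrite leNgt; apply/negP => H; exact/nK/ltW. Qed.

Let far_K y : `|P| + r <= `|y| -> ~ K y.
Proof.
move=> yr /KW Ky; move: yr; apply/negP; rewrite -ltNge -(subrK (col' J P) y) addrC.
rewrite (le_lt_trans (ler_normD _ _))// ler_ltD//.
by apply: normr_rV_le => // k; rewrite mxE normr_coord.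
Qed.

Let patch_support (f : 'rV[R]_n -> R) : Ck 0 W f ->
  bounded_support ((fun y => z y * f y) \_ W).
Proof.
move=> Cf; apply: (@continuous_bounded_support _ _ _ (`|P| + r)).
  have Czf : Ck 0 W (fun y => z y * f y).
    by apply: CkM => //; exact: Ck_sub (@subsetT _ _) (sz 0).
  have zf0 y : W y -> ~ K y -> z y * f y = 0 by move=> _ /zK ->; rewrite mul0r.
  by move=> y; exact: (smooth_patch oW closed_K KW Czf zf0).1.
move=> y /far_K nK; rewrite patchE; case: ifPn => // _; by rewrite zK// mul0r.
Qed.

Lemma front_density_bounded_support :
  bounded_support ((fun y => z y * front_density y) \_ W).
Proof.
rewrite (_ : _ \_ W = (fun y => z y * \sum_k partial k (flux k) y) \_ W).
  apply: patch_support; apply: Ck_sum => // k.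
  by have [_ /(_ k)[]] := C_flux k.
apply/funext => y; rewrite !patchE; case: ifPn => // /set_mem Wy.
by rewrite front_divergence.
Qed.

Let by_parts :
  \int[lam n]_(y in W) (\sum_k partial k z y * flux k y) =
  - \int[lam n]_y ((fun y => z y * front_density y) \_ W) y.
Proof.
pose F k := (fun y => z y * flux k y) \_ W.
have Czf k : Ck 1 W (fun y => z y * flux k y).
  by apply: CkM => //; exact: Ck_sub (@subsetT _ _) (sz 1).
have zf0 k y : W y -> ~ K y -> z y * flux k y = 0 by move=> _ /zK ->; rewrite mul0r.
have CF k : Ck 1 setT (F k) := smooth_patch oW closed_K KW (Czf k) (@zf0 k).
have Fout k y : `|P| + r <= `|y| -> F k y = 0.
  move=> /far_K nK; rewrite /F patchE; case: ifPn => // _; by rewrite zK// mul0r.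
have dFout k y : `|P| + r <= `|y| -> partial k (F k) y = 0.
  by move=> /far_K nK; exact: (partial_patch0 k oW closed_K (@zf0 k) nK).
have cdF k y : {for y, continuous (partial k (F k))}.
  by have [_ /(_ k)[_ [+ _]]] := CF k; exact.
have bF k : bounded_support (partial k (F k)).
  exact: (continuous_bounded_support (cdF k) (dFout k)).
have F0 k : \int[lam n]_y partial k (F k) y = 0.
  apply: (integral_partial0 (r := `|P| + r)) => //; last exact: dFout.
  - by move=> y; have [_ /(_ k)[+ _]] := CF k; exact.
  - exact: Fout.
have [Isum sum0] := Rintegral_sum0 bF F0.
have Iu := bounded_support_integrable front_density_bounded_support.
rewrite Rintegral_mkcond -[RHS]add0r -[X in _ = X - _]sum0 -RintegralB//.
apply: eq_Rintegral => y _; rewrite !patchE; case: ifPn => [/set_mem Wy|nWy]; last first.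
  rewrite subr0 big1// => k _; apply: (partial_patch0 k oW closed_K (@zf0 k)).
  by move=> /KW Wy; move: nWy; rewrite mem_set.
rewrite -front_divergence// mulr_sumr -sumrB; apply: eq_bigr => k _.
rewrite (partial_patch (fun y => z y * flux k y) k oW Wy).
have dz := smooth_derivable sz (I : [set: 'rV[R]_n] y) (i := k).
have df : derivable (flux k) y (delta_mx 0 k).
  by have [_ /(_ k)[+ _]] := C_flux k; exact.
rewrite [X in _ = X - _](_ : _ = z y * partial k (flux k) y + flux k y * partial k z y).
  by rewrite addrC addKr mulrC.
exact: (deriveM dz df).
Qed.

Let smooth_measurable_box f X : smooth X f -> box `<=` X -> measurable_fun box f.
Proof.
move=> sf bX; apply: continuous_measurable_rV => // Q bQ.
exact: smooth_continuous sf (bX _ bQ).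
Qed.

(** On the front the test function equals [z] in the coordinates of the graph,
    whatever [eps] is, and [delta / delta t] is a tangential derivative. The
    integral becomes the pairing of a field with [grad z] in these
    coordinates, and an integration by parts moves the derivatives onto the
    field. *)
Lemma front_term eps : 0 < eps -> eps <= c * (rho / 4) ->
  \int[mu]_(Q in Gamma S) (a Q * ddt S (layer_test J S rho r P z eps) Q /
    Num.sqrt (1 + Defs.G S Q ^+ 2)) =
  - \int[lam n]_y ((fun y => z y * front_density y) \_ W) y.
Proof.
move=> e0 ec.
have boxR : box `<=` regular S by move=> Q /boxV/Vr.
pose f := (fun Q => at_ Q * dot (col' J (pt 1 (Udelta S Q))) (grad z (col' J Q)) *
  rsqrt (1 + Defs.G S Q * Defs.G S Q)) \_ box.
have fE Q : Gamma S Q -> a Q * ddt S (layer_test J S rho r P z eps) Q /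
    Num.sqrt (1 + Defs.G S Q ^+ 2) = f Q.
  move=> GQ; rewrite ddtE /f patchE; case: (boolP (Q \in box)) => [/set_mem bQ|nbQ]; last first.
    have [|_ ->] := layer_test_out ch z_out e0 ec (Q := Q).
      by move=> bQ; move: nbQ; rewrite mem_set.
    by rewrite dotC /dot big1 ?mulr0 ?mul0r// => i _; rewrite mxE mul0r.
  have [X [_ _ _ aE]] := ea.
  rewrite aE; last by split=> //; exact: boxO.
  rewrite layer_test_grad// dotC dotDl !dotZl [dot (grad S Q) _]dotC.
  rewrite ddt_level ?mulr0 ?addr0; last exact: boxR.
  by rewrite GQ.2 bump1_0// mul1r dot_insert_coord mul0r add0r dotC -expr2.
rewrite (eq_Rintegral _ (g := f)); last by move=> Q /set_mem; exact: fE.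
rewrite (surface_integral_graph (J := J) mu_area oW Cg).
- rewrite -by_parts; apply: eq_Rintegral => y /set_mem Wy.
  have bQ := graph_box Wy; have [_ dg] := graph_diff sS ch Wy.
  rewrite /f patchE mem_set// col'_insert_coord -mulrA.
  have -> : rsqrt (1 + Defs.G S (ins (g y) y) * Defs.G S (ins (g y) y)) *
      Num.sqrt (1 + dot (grad g y) (grad g y)) =
      enorm (gradx S (ins (g y) y)) / `|partial J S (ins (g y) y)|.
    by rewrite -(area_ratio (boxR _ bQ) (B_neq0 bQ) dg) mulrC /rsqrt expr2.
  rewrite mulrAC mulr_sumr; apply: eq_bigr => k _.
  rewrite /flux /field_ transport_fieldE; last exact: boxR.
  rewrite /rsqrt -/(B _) -expr2 sqrtr_sqr !mxE.
  by rewrite [RHS]mulrC !mulrA; congr (_ * _); rewrite -!mulrA; do 2 congr (_ * _); rewrite mulrC.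
- by move=> y Wy; have [] := graph_front Wy.
- apply/(measurable_restrictT _ (open_measurable_rV obox)).
  apply: measurable_funM; last first.
    apply: (smooth_measurable_box (X := regular S)) => //.
    have sG := smooth_G sS; have oR := open_regular sS.
    apply: (@smooth_rsqrt _ _ (regular S) (fun Q => 1 + Defs.G S Q * Defs.G S Q)) => //.
      by apply: smoothD => //; [move=> k; exact: Ck_cst|exact: smoothM].
    by move=> Q _; rewrite ltr_wpDr// -expr2 sqr_ge0.
  apply: measurable_funM; first exact: (smooth_measurable_box sa).
  apply: measurable_dot => k.
    rewrite (_ : (fun Q => _) = fun Q => pt 1 (Udelta S Q) 0 (lift J k)); last first.
      by apply/funext => Q; rewrite mxE.
    have [j ->|->] := unliftP ord0 (lift J k).
      rewrite (_ : (fun Q => _) = fun Q => Udelta S Q 0 j); last first.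
        by apply/funext => Q; rewrite pt_lift.
      exact: (smooth_measurable_box (smooth_Udelta sS j)).
    rewrite (_ : (fun Q => _) = fun=> 1); first exact: measurable_cst.
    by apply/funext => Q; rewrite pt_ord0.
  apply: (smooth_measurable_box (X := setT)) => //.
  rewrite (_ : (fun Q => _) = fun Q => partial k z (col' J Q)); last first.
    by apply/funext => Q; rewrite mxE.
  exact/smooth_col'/smooth_partial.
- move=> Q GQ nQ; rewrite /f patchE; case: ifPn => // /set_mem bQ; exfalso; apply: nQ.
  have [QJ Qy] := bQ; exists (col' J Q) => //.
  have QE : ins (Q 0 J) (col' J Q) = Q by exact: insert_coord_eta.
  have := zero_set_distance ch QJ Qy.
  rewrite QE GQ.2 normr0 pmulr_rle0// normr_le0 subr_eq0 => /eqP <-.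
  exact: QE.
Qed.

End front_term.

(** * The jump conditions *)

Section positive_integral.
Context (R : realType).
Notation lam := (@lebesgue_rV R).

Lemma lebesgue_rV_cube_gt0 m (q : 'rV[R]_m) (s : R) : 0 < s ->
  (0 < lam m [set y | (`|y - q| < s)%R])%E.
Proof.
move=> s0; elim: m q => [|m IH] q.
  by rewrite /= diracE mem_set ?lte_fin//= (thinmx0 (0 - q)) normr0.
rewrite (lebesgue_rV_insert ord0 (measurable_cube _ s0)) /pushforward.
rewrite (_ : _ @^-1` _ = `]q 0 ord0 - s, q 0 ord0 + s[ `*`
    [set y : 'rV[R]_m | `|y - col' ord0 q| < s]).
  rewrite product_measure1E//; last exact: measurable_cube.
  rewrite [X in (_ < X * _)%E](lebesgue_measure_itv `]q 0 ord0 - s, q 0 ord0 + s[)/=.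
  rewrite lte_fin ltrD2l gt0_cp// mule_gt0// lte_fin.
  by rewrite opprD opprK addrACA subrr add0r addr_gt0.
have E (t : R) (y : 'rV[R]_m) : insert_coord ord0 t y - q =
    insert_coord ord0 (t - q 0 ord0) (y - col' ord0 q).
  by rewrite -[in LHS](insert_coord_eta ord0 q) insert_coordB.
apply/seteqP; split=> [[t y] /=|[t y] /= [ts ys]]; rewrite E.
  by move=> /norm_insert_coord[ts ys]; split=> //; rewrite in_itv/= -ltr_distl.
by apply/norm_insert_coord; split=> //; rewrite ltr_distl; rewrite in_itv/= in ts.
Qed.

Lemma Rintegral_gt0 m (f : 'rV[R]_m -> R) q : bounded_support f ->
  (forall y, 0 <= f y) -> {for q, continuous f} -> 0 < f q -> 0 < \int[lam m]_y f y.
Proof.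
move=> bf f0 cf fq.
have [s s0 sf] : exists2 s : R, 0 < s & forall y, `|y - q| < s -> f q / 2 <= f y.
  apply: near_norm; have /cvgrPdist_lt/(_ (f q / 2)) := cf.
  rewrite divr_gt0// => /(_ isT); apply: filterS => y; rewrite ltr_norml => /andP[_ ?]; lra.
pose D := [set y : 'rV[R]_m | `|y - q| < s].
have mD : measurable D by exact: measurable_cube.
have If := bounded_support_integrable bf.
have If' : (lam m).-integrable D (EFin \o f) by exact: integrableS If.
have Dfin : (lam m D < +oo)%E.
  apply: le_lt_trans (lebesgue_rV_cube m (`|q| + s)).
  have mD' : measurable [set y : 'rV[R]_m | `|y| < `|q| + s].
    rewrite (_ : [set y | _] = [set y | `|y - 0| < `|q| + s]).
      by apply: measurable_cube; rewrite ltr_wpDl.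
    by apply/seteqP; split=> y /=; rewrite subr0.
  apply: le_measure; rewrite ?inE// => y /= yq.
  rewrite -(subrK q y) addrC (le_lt_trans (ler_normD _ _))// ltrD2l//.
have -> : \int[lam m]_y f y = fine (\int[lam m]_y (f y)%:E) by [].
have D0 := lebesgue_rV_cube_gt0 q s0.
have le1 : ((f q / 2)%:E * lam m D <= \int[lam m]_y (f y)%:E)%E.
  rewrite -integral_cst//.
  apply: (@le_trans _ _ (\int[lam m]_(y in D) (f y)%:E)%E).
    apply: ge0_le_integral => //.
    - by move=> y _; rewrite lee_fin divr_ge0// ltW.
    - by have /integrableP[] := If'.
  apply: ge0_subset_integral => //; first by have /integrableP[] := If.
  by move=> y _; rewrite lee_fin.
have fin : (\int[lam m]_y (f y)%:E)%E \is a fin_num by exact: integrable_fin_num.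
rewrite -lte_fin fineK// (lt_le_trans _ le1)//.
by rewrite mule_gt0// lte_fin divr_gt0.
Qed.

End positive_integral.

Section limits.
Context (R : realType) (T : topologicalType) (F : set_system T) (FF : Filter F).

Lemma cvg_dot m (u v : T -> 'rV[R]_m) (ul vl : 'rV[R]_m) :
  (forall i, u x 0 i @[x --> F] --> ul 0 i) ->
  (forall i, v x 0 i @[x --> F] --> vl 0 i) ->
  dot (u x) (v x) @[x --> F] --> dot ul vl.
Proof.
move=> cu cv; rewrite /dot; elim: (index_enum _) => [|i s IH].
  rewrite big_nil (_ : (fun x => _) = fun=> 0); first exact: cvg_cst.
  by apply/funext => x; rewrite big_nil.
rewrite big_cons (_ : (fun x => _) = fun x => u x 0 i * v x 0 i +
    \sum_(j <- s) u x 0 j * v x 0 j).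
  by apply: cvgD => //; exact: cvgM.
by apply/funext => x; rewrite big_cons.
Qed.

End limits.

Lemma measurable_upper_half_space (R : realType) (n : nat) :
  measurable (@upper_half_space R n).
Proof.
apply: open_measurable_rV; apply: (@open_comp _ _ (@time R n) [set x | 0 < x]).
  by move=> Q _; exact: coord_continuous.
exact: open_gt.
Qed.

Section jump.
Context (R : realType) (n : nat) (S : 'rV[R]_n.+1 -> R).
Notation point := 'rV[R]_n.+1.
Notation lam := (@lebesgue_rV R).
Hypothesis S_front : moving_front S.
Let sS : smooth [set: point] S := S_front.1.
Context (mu : {measure set point -> \bar R}) (Gamma0 : set 'rV[R]_n)
  (mu0 : {measure set 'rV[R]_n -> \bar R}).
Hypothesis mu_area : is_surface_measure (Gamma S) mu.
Context (Omega : set point).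
Hypotheses (Omega_open : open Omega) (Omega_upper : Omega `<=` @upper_half_space R n).
Notation M := (Gamma S `&` Omega).

(** The one-sided limit of [A] combines with the continuity of [grad S] and
    of [1 / d_J S] at [P]. *)
Lemma side_near J P (D : set point) (A : point -> point) (Al : point) (eta : R) :
  partial J S P != 0 -> 0 < eta ->
  (forall i, A Q 0 i @[Q --> within D (nbhs P)] --> Al 0 i) ->
  \forall Q \near P, D Q -> `|A Q| <= `|Al| + 1 /\
    `|dot (A Q) (grad S Q) / partial J S Q - dot Al (grad S P) / partial J S P| <= eta.
Proof.
move=> B0 eta0 cA.
have cp i : partial i S Q @[Q --> within D (nbhs P)] --> partial i S P.
  by apply: cvg_within_filter; exact: smooth_continuous (smooth_partial i sS) I.
have c1 : dot (A Q) (grad S Q) / partial J S Q @[Q --> within D (nbhs P)] -->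
    dot Al (grad S P) / partial J S P.
  apply: cvgM; last exact: cvgV.
  apply: cvg_dot => // i; rewrite mxE.
  by rewrite (_ : (fun Q => _) = partial i S)//; apply/funext => Q; rewrite mxE.
have c2 : \forall Q \near within D (nbhs P), forall i, `|Al 0 i - A Q 0 i| < 1.
  by apply: filter_forall => i; have /cvgrPdist_lt/(_ 1 ltr01) := cA i.
have /cvgrPdist_le/(_ eta eta0) c3 := c1.
have {}c2 : \forall Q \near P, D Q -> forall i, `|Al 0 i - A Q 0 i| < 1 by exact: c2.
have {}c3 : \forall Q \near P, D Q ->
  `|dot Al (grad S P) / partial J S P - dot (A Q) (grad S Q) / partial J S Q| <= eta.
  by exact: c3.
apply: filterS (filterI c2 c3) => Q [+ + DQ] => /(_ DQ) H1 /(_ DQ) H2.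
split; last by rewrite distrC.
rewrite -(subrK Al (A Q)) addrC (le_trans (ler_normD _ _))// lerD2l.
by apply: normr_rV_le => // i; rewrite !mxE distrC ltW.
Qed.

Section balance.
Context (r : point -> R) (fl : point -> 'rV[R]_n) (a : point -> R) (r0 a0 : 'rV[R]_n -> R).
Hypothesis balance : weak_balance S mu Gamma0 mu0 r fl a r0 a0.
Hypothesis a_smooth : smooth_on_front M a.
Hypothesis mr : measurable_fun (@upper_half_space R n) r.
Hypothesis mfl : forall j, measurable_fun (@upper_half_space R n) (fun Q => fl Q 0 j).
Context (P : point) (rm rp : R) (fm fp : 'rV[R]_n).
Hypothesis MP : M P.
Hypotheses (crm : r Q @[Q --> within (Omega `&` [set Q | S Q < 0]) (nbhs P)] --> rm)
  (crp : r Q @[Q --> within (Omega `&` [set Q | 0 < S Q]) (nbhs P)] --> rp).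
Hypothesis cfm : forall j,
  fl Q 0 j @[Q --> within (Omega `&` [set Q | S Q < 0]) (nbhs P)] --> fm 0 j.
Hypothesis cfp : forall j,
  fl Q 0 j @[Q --> within (Omega `&` [set Q | 0 < S Q]) (nbhs P)] --> fp 0 j.

Let A Q := pt (r Q) (fl Q).
Let lhs := delta_t S M a P + tangent_div S M (fun Q => a Q *: Udelta S Q) P.

Let cvg_A (D : set point) (s : R) (u : 'rV[R]_n) :
  r Q @[Q --> within D (nbhs P)] --> s ->
  (forall j, fl Q 0 j @[Q --> within D (nbhs P)] --> u 0 j) ->
  forall i, A Q 0 i @[Q --> within D (nbhs P)] --> pt s u 0 i.
Proof.
move=> cr cf i; have [j ->|->] := unliftP ord0 i.
  rewrite pt_lift (_ : (fun Q => _) = fun Q => fl Q 0 j)//.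
  by apply/funext => Q; rewrite /A pt_lift.
rewrite pt_ord0 (_ : (fun Q => _) = r)//.
by apply/funext => Q; rewrite /A pt_ord0.
Qed.

Let mA i : measurable_fun (@upper_half_space R n) (fun Q => A Q 0 i).
Proof.
have [j ->|->] := unliftP ord0 i.
  rewrite (_ : (fun Q => _) = fun Q => fl Q 0 j); first exact: mfl.
  by apply/funext => Q; rewrite /A pt_lift.
rewrite (_ : (fun Q => _) = r); first exact: mr.
by apply/funext => Q; rewrite /A pt_ord0.
Qed.

(* The weak form for the test functions [layer_test eps] equates the bulk term,
   which tends to the jump, with the front term, which does not depend on
   [eps]. Both are compared with the integral of [z], which is positive; [eta]
   bounds the oscillation in the box of the fields on each side and of the
   density on the front. *)
Let jump_approx J (sg eta : R) : sg = 1 \/ sg = -1 -> 0 < sg * partial J S P -> 0 < eta ->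
  `|dot (pt rm fm - pt rp fp) (grad S P) / `|partial J S P| -
    enorm (gradx S P) / `|partial J S P| * lhs| <= 3 * eta.
Proof.
move=> sgP B0 eta0; have sg1 : `|sg| = 1 by case: sgP => ->; rewrite ?normrN normr1.
have Bn0 : partial J S P != 0 by apply: contraTneq B0 => ->; rewrite mulr0 ltxx.
have [at_ ea] := a_smooth; have [V0 [oV0 MV0 sa0 aE]] := ea.
pose V := V0 `&` regular S.
have oV : open V by apply: openI => //; exact: open_regular.
have Vr : V `<=` regular S by move=> Q [].
have sa : smooth V at_ by apply: smooth_sub sa0 => Q [].
have VP : V P by split; [exact: MV0|exact: front_regular S_front _ MP.1].
pose Df Q := (\sum_i partial i (transport_field S at_ i) Q) / `|partial J S Q|.
have DfE Q : M Q -> V Q -> Df Q = enorm (gradx S Q) / `|partial J S Q| *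
    (delta_t S M a Q + tangent_div S M (fun Q => a Q *: Udelta S Q) Q).
  move=> MQ VQ; rewrite /Df (front_transport S_front Omega_open Omega_upper oV Vr sa ea MQ VQ).
  by rewrite mulrAC.
have cDf : \forall Q \near P, `|Df Q - Df P| <= eta.
  have sdiv : smooth V (fun Q => \sum_i partial i (transport_field S at_ i) Q).
    apply: smooth_sum => // i; apply: smooth_partial.
    exact: smooth_transport_field.
  have cB : {for P, continuous (partial J S)}.
    exact: smooth_continuous (smooth_partial J sS) I.
  have cV : {for P, continuous (fun Q => `|partial J S Q|^-1)}.
    apply: (@continuousV _ _ (fun Q => `|partial J S Q|)); first by rewrite normr_eq0.
    apply: (@continuous_comp _ _ _ (partial J S) (fun x => `|x|)); first exact: cB.
    exact: norm_continuous.
  have : {for P, continuous Df} := continuousM_for (smooth_continuous sdiv VP) cV.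
  by move=> /cvgrPdist_le/(_ eta eta0); apply: filterS => Q; rewrite distrC.
have nm := side_near Bn0 eta0 (cvg_A crm cfm).
have np := side_near Bn0 eta0 (cvg_A crp cfp).
have nVO : \forall Q \near P, V Q /\ Omega Q.
  by apply: filterI; apply: open_nbhs_nbhs; split=> //; exact: MP.2.
have [d d0 dP] := near_norm (filterI nVO (filterI cDf (filterI nm np))).
have NP : [set Q : point | `|Q - P| < d] P by rewrite /= subrr normr0.
have [rho [r1 [c [g [ch chN]]]]] :=
  zero_set_graph sS MP.1.2 sg1 B0 (@open_norm_ball _ _ P d) NP.
have r10 := chart_r ch; have r1rho := chart_rho ch; have gP := chart_graph ch.
have boxN Q : box J rho r1 P Q -> `|Q - P| < d.
  by move=> /(box_cube ch)/chN.
have boxV : box J rho r1 P `<=` V by move=> Q /boxN/dP[[]].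
have boxO : box J rho r1 P `<=` Omega by move=> Q /boxN/dP[[]].
have boxU Q : box J rho r1 P Q -> upper_half_space Q by move/boxO/Omega_upper.
pose z := space_bump (col' J P) (r1 / 2).
have r20 : 0 < r1 / 2 by rewrite divr_gt0.
have sz : smooth setT z := smooth_bump _ _.
have z0 y : 0 <= z y := bump_ge0 _ _ y.
have z_out y : r1 / 2 <= `|y - col' J P| -> z y = 0 by exact: bump_out.
pose Am := dot (pt rm fm) (grad S P) / partial J S P.
pose Ap := dot (pt rp fp) (grad S P) / partial J S P.
(* below the graph lies the minus side if [S] increases along the [J]-axis,
   and the plus side otherwise *)
pose al := if 0 < sg then Am else Ap; pose au := if 0 < sg then Ap else Am.
have alau : al - au = dot (pt rm fm - pt rp fp) (grad S P) / `|partial J S P|.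
  rewrite dotBl /al /au /Am /Ap.
  case: sgP B0 => ->.
    by rewrite ltr01 mul1r => /gtr0_norm ->; rewrite mulrBl.
  rewrite ltr0N1 mulN1r oppr_gt0 => /ltr0_norm ->.
  by rewrite invrN mulrN mulrBl opprB.
have AK Q : box J rho r1 P Q -> S Q != 0 -> `|A Q| <= `|pt rm fm| + `|pt rp fp| + 1 /\
    `|dot (A Q) (grad S Q) / partial J S Q - (if sg * S Q < 0 then al else au)| <= eta.
  move=> bQ SQ; have [[_ OQ] [_ [Hm Hp]]] := dP _ (boxN _ bQ).
  have [Sn|Sp|S0] := ltgtP (S Q) 0; last by rewrite S0 eqxx in SQ.
    have [|K1 K2] := Hm; first by split.
    split; first by rewrite (le_trans K1)// lerD2r lerDl.
    rewrite [X in _ - X](_ : _ = Am) ?K2// /al /au.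
    by case: sgP => ->; rewrite ?ltr01 ?ltr0N1 ?mul1r ?mulN1r ?oppr_lt0 ?Sn // ltNge (ltW Sn).
  have [|K1 K2] := Hp; first by split.
  split; first by rewrite (le_trans K1)// lerD2r lerDr.
  rewrite [X in _ - X](_ : _ = Ap) ?K2// /al /au.
  by case: sgP => ->; rewrite ?ltr01 ?ltr0N1 ?mul1r ?mulN1r ?oppr_lt0 ?Sp // ltNge (ltW Sp).
have mAbox i : measurable_fun (box J rho r1 P) (fun Q => A Q 0 i).
  have mupper := @measurable_upper_half_space R n.
  exact: (measurable_funS mupper boxU (mA i)).
have [C HC] := layer_limit sS ch sz z0 z_out mAbox AK.
have bfd := front_density_bounded_support S_front ch sz z_out
  Omega_open Omega_upper oV Vr sa ea boxV boxO.
set zfd := _ \_ _ in bfd.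
have bz : bounded_support z.
  apply: (@continuous_bounded_support _ _ _ (`|P| + r1 / 2)).
    by move=> y; exact: smooth_continuous sz I.
  move=> y yr; apply: z_out; rewrite -(lerD2l `|P|) (le_trans yr)//.
  rewrite -{1}(subrK (col' J P) y) addrC (le_trans (ler_normD _ _))//.
  by rewrite lerD2r; apply: normr_rV_le => // k; rewrite mxE normr_coord.
have weak (eps : R) : 0 < eps -> eps <= c * (rho / 4) ->
    \int[lam n.+1]_Q layer_integrand J S rho r1 P z A eps Q = \int[lam n]_y zfd y.
  move=> e0 ec.
  have out x : ~ box J rho r1 P (pt 0 x).
    by move/boxU; rewrite /upper_half_space /= /time pt_ord0 ltxx.
  have tout x := (layer_test_out ch z_out e0 ec (out x)).1.
  have := balance (test_function_layer_test sS ch sz z_out e0 ec).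
  rewrite (front_term S_front ch sz z_out mu_area
    Omega_open Omega_upper oV Vr sa ea boxV boxO e0 ec) -/zfd.
  have -> : \int[lam n]_x (r0 x * layer_test J S rho r1 P z eps (pt 0 x)) = 0.
    by rewrite /Rintegral integral0_eq// => x _; rewrite tout mulr0.
  have -> : \int[mu0]_(x in Gamma0) (a0 x * layer_test J S rho r1 P z eps (pt 0 x)) = 0.
    by rewrite /Rintegral integral0_eq// => x _; rewrite tout mulr0.
  rewrite !addr0 => /eqP; rewrite subr_eq0 => /eqP <-.
  rewrite -(layer_test_bulk sS ch sz z_out e0 ec boxU mAbox).
  by apply: eq_Rintegral => Q _; rewrite gradE /A dot_pt.
pose Iz := \int[lam n]_y z y.
have cz y : {for y, continuous z} by exact: smooth_continuous sz I.
have Iz0 : 0 < Iz.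
  apply: (Rintegral_gt0 (q := col' J P) bz z0 (cz _)).
  exact: bump_gt0.
pose D := enorm (gradx S P) / `|partial J S P| * lhs.
have DP : Df P = D by exact: DfE.
have lim1 : `|\int[lam n]_y zfd y - (al - au) * Iz| <= 2 * eta * Iz.
  apply/ler_addgt0Pr => e e0.
  have C0 : 0 < `|C| + 1 by rewrite ltr_wpDl.
  (* small enough for the layer to fit in the box and for the error [C eps] *)
  pose eps := Num.min (c * (rho / 4)) (e / (`|C| + 1)).
  have eps0 : 0 < eps.
    by rewrite lt_min !mulr_gt0 ?invr_gt0 ?(chart_c ch)// (lt_le_trans r10).
  have := HC eps eps0; rewrite (weak _ eps0) => [|//]; last by rewrite ge_min lexx.
  move=> /(_ _)/le_trans; apply; first by rewrite ge_min lexx.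
  rewrite lerD2l (le_trans (ler_norm _))// normrM (gtr0_norm eps0).
  rewrite (@le_trans _ _ ((`|C| + 1) * eps))//.
    by rewrite ler_wpM2r ?(ltW eps0)// lerDl.
  by rewrite mulrC -ler_pdivlMr// ge_min lexx orbT.
have lim2 : `|\int[lam n]_y zfd y - D * Iz| <= eta * Iz + 0 * Iz.
  apply: Rintegral_approx => // y; rewrite mul0r addr0 /zfd patchE.
  case: ifPn => [/set_mem yr|nyr]; last first.
    rewrite z_out ?mulr0 ?subr0 ?normr0// (@le_trans _ _ r1)//.
      by rewrite ler_pdivrMr// ler_peMr ?ler1n// ltW.
    by rewrite leNgt; apply: contra nyr; rewrite inE.
  have bQ : box J rho r1 P (insert_coord J (g y) y).
    apply/box_ins; split=> //; have [gy _] := gP _ yr.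
    rewrite (lt_le_trans gy)// ler_pdivrMr// ler_peMr ?ler1n//.
    exact: le_trans (ltW r10) r1rho.
  have MQ : M (insert_coord J (g y) y).
    split; last exact: boxO; split; last exact: (gP _ yr).2.
    exact/ltW/boxU.
  have [_ [HD _]] := dP _ (boxN _ bQ).
  rewrite [D * _]mulrC -mulrBr normrM (ger0_norm (z0 y)) mulrC ler_wpM2r//.
  by move: HD; rewrite DP (DfE _ MQ (boxV _ bQ)).
rewrite -alau -/D -(ler_pM2r Iz0).
have -> : `|al - au - D| * Iz =
    `|(\int[lam n]_y zfd y - D * Iz) - (\int[lam n]_y zfd y - (al - au) * Iz)|.
  by rewrite -{1}(gtr0_norm Iz0) -normrM; congr `|_|; ring.
rewrite (le_trans (ler_normB _ _))// (le_trans (lerD lim2 lim1))//.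
by rewrite mul0r addr0 -!mulrDl [leRHS](_ : _ = (eta + 2 * eta) * Iz)//; ring.
Qed.

(** The Rankine-Hugoniot condition of a scalar balance law. As [grad_x S] does
    not vanish on the front, near [P] the front is the graph of one space
    coordinate as a function of the others and of time; the approximate
    identity found in this chart holds for every [eta] and involves only
    quantities at [P]. *)
Lemma jump_balance : lhs = dot (pt (rm - rp) (fm - fp)) (st_normal S P).
Proof.
have [j Bj] : exists j, dx j S P != 0.
  have := S_front.2 _ MP.1; apply: contraNP => /forallNP H.
  by apply/eqP/rowP => j; rewrite !mxE; apply/eqP/negbNE/negP; exact: H.
pose J := lift ord0 j; have B0 : partial J S P != 0 by exact: Bj.
have rP := front_regular S_front MP.1.
have N0 : 0 < enorm (gradx S P) by rewrite sqrtr_gt0; exact: rP.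
have [sg sgP sgB] : exists2 sg : R, sg = 1 \/ sg = -1 & 0 < sg * partial J S P.
  have [Bp|Bn] := ltP 0 (partial J S P).
    by exists 1; [left|rewrite mul1r].
  by exists (-1); [right|rewrite mulN1r oppr_gt0 lt_neqAle B0].
have : dot (pt rm fm - pt rp fp) (grad S P) / `|partial J S P| =
    enorm (gradx S P) / `|partial J S P| * lhs.
  apply/eqP; rewrite -subr_eq0 -normr_le0; apply/ler_addgt0Pl => e e0; rewrite addr0.
  have e3 : 0 < e / 3 by rewrite divr_gt0.
  by rewrite (le_trans (jump_approx sgP sgB e3))// mulrC divfK.
have Bn : `|partial J S P| != 0 by rewrite normr_eq0.
rewrite mulrAC => /(mulIf (invr_neq0 Bn)) E.
have -> : pt (rm - rp) (fm - fp) = pt rm fm - pt rp fp by rewrite /pt insert_coordB.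
rewrite st_normalE; last exact: MP.1.
by rewrite dotC dotZl dotC E mulKf// gt_eqF.
Qed.

End balance.
End jump.

Lemma measurable_continuous_comp (R : realType) d (T : measurableType d) m
    (D : set T) (u : T -> 'rV[R]_m) (h : 'rV[R]_m -> R) :
  measurable D -> (forall i, measurable_fun D (fun x => u x 0 i)) -> continuous h ->
  measurable_fun D (fun x => h (u x)).
Proof.
move=> mD mu ch; pose v x := if x \in D then u x else 0.
have mv : measurable_fun setT v.
  apply: measurable_fun_rVP => i.
  rewrite (_ : (fun x => _) = (fun x => u x 0 i) \_ D).
    by apply/(measurable_restrictT _ mD); exact: mu.
  by apply/funext => x; rewrite patchE /v; case: ifP => // _; rewrite mxE.
apply: (eq_measurable_fun (h \o v)); first by move=> x xD; rewrite /= /v xD.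
apply: measurable_funTS; apply: measurableT_comp mv.
by apply: continuous_measurable_rV => [|y _]; [exact: openT|exact: ch].
Qed.

Unset Implicit Arguments.

Theorem theorem2p1 (R : realType) (n : nat)
  (F : 'rV[R]_n -> 'rV[R]_n) (N : 'rV[R]_n -> 'M[R]_n)
  (F_cont : continuous F) (N_cont : continuous N)
  (S : 'rV[R]_n.+1 -> R) (S0 : 'rV[R]_n -> R)
  (S_front : moving_front S) (S0_front : initial_front S S0)
  (mu : {measure set 'rV[R]_n.+1 -> \bar R})
  (mu0 : {measure set 'rV[R]_n -> \bar R})
  (mu_area : is_surface_measure (Gamma S) mu)
  (mu0_area : is_surface_measure [set x | S0 x = 0] mu0)
  (Omega : set 'rV[R]_n.+1)
  (Omega_open : open Omega) (Omega_conn : connected Omega)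
  (Omega_upper : Omega `<=` @upper_half_space R n)
  (e : 'rV[R]_n.+1 -> R)
  (e_smooth : smooth_on_front (Gamma S `&` Omega) e)
  (U : 'rV[R]_n.+1 -> 'rV[R]_n) (rho : 'rV[R]_n.+1 -> R)
  (U0 : 'rV[R]_n -> 'rV[R]_n) (rho0 e0 : 'rV[R]_n -> R)
  (Ud0 : 'rV[R]_n -> 'rV[R]_n)
  (Um Up : 'rV[R]_n.+1 -> 'rV[R]_n) (rm rp : 'rV[R]_n.+1 -> R) :
  let M := Gamma S `&` Omega in
  let Omega_minus := Omega `&` [set P | S P < 0] in
  let Omega_plus := Omega `&` [set P | 0 < S P] in
  (delta_shock_solution F N S S0 mu mu0 U rho e U0 rho0 e0 Ud0 ->
   smooth_vec Omega_minus U -> smooth Omega_minus rho ->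
   smooth_vec Omega_plus U -> smooth Omega_plus rho ->
   one_sided_limit Omega_minus M U Um -> one_sided_limit Omega_minus M rho rm ->
   one_sided_limit Omega_plus M U Up -> one_sided_limit Omega_plus M rho rp ->
   forall P, M P ->
     RH_mass F S M e Um Up rm rp P /\ RH_momentum N S M e Um Up rm rp P) /\
  (forall P, M P ->
     st_normal S P = (enorm (gradx S P))^-1 *: grad S P /\
     [/\ RH_mass F S M e Um Up rm rp P <->
           RH_mass_velocity F S M e Um Up rm rp P,
         RH_momentum N S M e Um Up rm rp P <->
           RH_momentum_velocity N S M e Um Up rm rp P,
         RH_mass F S M e Um Up rm rp P <->
           RH_mass_curvature F S M e Um Up rm rp P &
         RH_momentum N S M e Um Up rm rp P <->
           RH_momentum_curvature N S M e Um Up rm rp P]).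
Proof.
move=> M Omega_minus Omega_plus; split; last exact: RH_equivalent_forms.
move=> [_ [U_Linfty [mrho _] _] mass momentum] _ _ _ _ cUm crm cUp crp P MP.
have mupper := @measurable_upper_half_space R n.
have mU k : measurable_fun (@upper_half_space R n) (fun Q => U Q 0 k).
  by have [] := U_Linfty k.
have cF j : continuous (fun u => F u 0 j).
  move=> u; apply: (@continuous_comp _ _ _ F (fun w => w 0 j)); first exact: F_cont.
  exact: coord_continuous.
have cN k j : continuous (fun u => N u k j).
  move=> u; apply: (@continuous_comp _ _ _ N (fun w => w k j)); first exact: N_cont.
  exact: coord_continuous.
have mcomp h : continuous h -> measurable_fun (@upper_half_space R n) (fun Q => rho Q * h (U Q)).
  by move=> ch; apply: measurable_funM => //; exact: measurable_continuous_comp.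
have lim (D : set 'rV[R]_n.+1) (u0 : 'rV[R]_n) (s : R) (h : 'rV[R]_n -> R) :
    continuous h ->
    rho Q @[Q --> within D (nbhs P)] --> s -> U Q @[Q --> within D (nbhs P)] --> u0 ->
    rho Q * h (U Q) @[Q --> within D (nbhs P)] --> s * h u0.
  move=> ch cr cu; apply: cvgM => //.
  exact: (cvg_comp _ _ cu (ch u0)).
split.
  apply: (jump_balance S_front mu_area Omega_open Omega_upper mass e_smooth mrho _ MP).
  - move=> j; rewrite (_ : (fun Q => _) = fun Q => rho Q * F (U Q) 0 j).
      exact: (mcomp (fun u => F u 0 j)).
    by apply/funext => Q; rewrite mxE.
  - exact: crm.
  - exact: crp.
  - move=> j; rewrite mxE (_ : (fun Q => _) = fun Q => rho Q * F (U Q) 0 j).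
      exact: (lim _ _ _ (fun u => F u 0 j) _ (crm _ MP) (cUm _ MP)).
    by apply/funext => Q; rewrite mxE.
  - move=> j; rewrite mxE (_ : (fun Q => _) = fun Q => rho Q * F (U Q) 0 j).
      exact: (lim _ _ _ (fun u => F u 0 j) _ (crp _ MP) (cUp _ MP)).
    by apply/funext => Q; rewrite mxE.
move=> k; rewrite /momentum_lhs.
have ek := smooth_on_front_velocity S_front k e_smooth.
have -> : row k (jump_rhoN N Um Up rm rp P) =
    rm P *: row k (N (Um P)) - rp P *: row k (N (Up P)).
  by apply/rowP => j; rewrite !mxE.
have -> : jump_rhoU Um Up rm rp P 0 k = rm P * Um P 0 k - rp P * Up P 0 k.
  by rewrite !mxE.
have ck : continuous (fun u : 'rV[R]_n => u 0 k) by exact: coord_continuous.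
apply: (jump_balance S_front mu_area Omega_open Omega_upper (momentum k) ek _ _ MP).
- exact: (mcomp (fun u => u 0 k)).
- move=> j; rewrite (_ : (fun Q => _) = fun Q => rho Q * N (U Q) k j).
    exact: (mcomp (fun u => N u k j)).
  by apply/funext => Q; rewrite !mxE.
- exact: (lim _ _ _ (fun u => u 0 k) ck (crm _ MP) (cUm _ MP)).
- exact: (lim _ _ _ (fun u => u 0 k) ck (crp _ MP) (cUp _ MP)).
- move=> j; rewrite !mxE (_ : (fun Q => _) = fun Q => rho Q * N (U Q) k j).
    exact: (lim _ _ _ (fun u => N u k j) _ (crm _ MP) (cUm _ MP)).
  by apply/funext => Q; rewrite !mxE.
- move=> j; rewrite !mxE (_ : (fun Q => _) = fun Q => rho Q * N (U Q) k j).
    exact: (lim _ _ _ (fun u => N u k j) _ (crp _ MP) (cUp _ MP)).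
  by apply/funext => Q; rewrite !mxE.
Qed.
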